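(* Fix an integer $n \ge 2$ and let $G$ be a subgroup of $S_n$ (considered up to conjugacy in $S_n$). Let $p$ be a prime and let $K_{\mathfrak p}$ be a finite extension of $\mathbb{Q}_p$ with residue field $\mathbb{F}_q$, $q = p^f$. (1) If $G$ is cyclic, $n \ge 3$, and $q > n^2$, then $$\left| \nu_{n,\mathfrak p}\left(P^{*}_{n,\mathfrak p}(G)\right) - \tilde{\nu}_n(G) \right| < \frac{n^2}{q - n^2}\, \tilde{\nu}_n(G),$$ and in consequence $$\left| \nu_{n,\mathfrak p}\left(P_{n,\mathfrak p}(G)\right) - \tilde{\nu}_n(G) \right| < \frac{n^2}{q - n^2}\, \tilde{\nu}_n(G) + \frac{1}{q}.$$ If $G$ is cyclic, $n = 2$, and $q \ge n^2 + n$, then $$\left| \nu_{n,\mathfrak p}\left(P^{*}_{n,\mathfrak p}(G)\right) - \tilde{\nu}_n(G) \right| < \frac{n^2 + n}{q - (n^2 + n)}\, \tilde{\nu}_n(G),$$ and in consequence $$\left| \nu_{n,\mathfrak p}\left(P_{n,\mathfrak p}(G)\right) - \tilde{\nu}_n(G) \right| < \frac{n^2 + n}{q - (n^2 + n)}\, \tilde{\nu}_n(G) + \frac{1}{q}.$$ (2) For the non-cyclic subgroups of $S_n$ one has $$\sum_{\substack{G \subset S_n \\ G \text{ non-cyclic}}} \frac{\nu_{n,\mathfrak p}\left(P_{n,\mathfrak p}(G)\right)}{|C_G|} \le \frac{1}{q},$$ where the sum is over all non-cyclic subgroups $G$ of $S_n$.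
   Context: $\mathfrak{O}_{\mathfrak p}$ is the ring of integers of $K_{\mathfrak p}$, $\mathfrak p$ its maximal ideal. Let $h_{\mathfrak p}$ be the additive Haar measure on $\mathfrak{O}_{\mathfrak p}$ with total mass $1$, and let $\nu_{n,\mathfrak p}$ be the product measure $h_{\mathfrak p}^{\otimes n}$ on $(\mathfrak{O}_{\mathfrak p})^n$. A tuple $(a_0,\dots,a_{n-1}) \in (\mathfrak{O}_{\mathfrak p})^n$ is identified with the monic polynomial $f(x) = x^n + a_{n-1}x^{n-1} + \cdots + a_0$. For $f$ with distinct roots, let $K_f$ be its splitting field over $K_{\mathfrak p}$ and $G_f = \mathrm{Gal}(K_f/K_{\mathfrak p})$. An ordering of the roots realizes $G_f$ as a subgroup of $S_n$, well defined up to conjugation. (Tuples whose polynomial has a repeated root form a set of measure zero and are disregarded.) For a subgroup $G \subset S_n$, $C_G$ is the set of subgroups of $S_n$ conjugate to $G$ and $|C_G|$ is its cardinality. $P_{n,\mathfrak p}(G)$ is the set of tuples for which $G_f \in C_G$, and $P^{*}_{n,\mathfrak p}(G)$ is the subset of those whose polynomial has discriminant not divisible by $\mathfrak p$. For a partition $\mu = (\mu_1 \ge \cdots \ge \mu_k\ge 1)$ of $n$, $C_\mu \subset S_n$ is the conjugacy class of permutations with cycle lengths $\mu_1,\dots,\mu_k$ (fixed points included), and $\nu_n(\mu) = |C_\mu|/n!$. The Erdős–Turán distribution $\tilde{\nu}_n$ is defined as follows: if $G \subset S_n$ is cyclic, let $\mu_G$ be the partition such that for every $\sigma \in C_{\mu_G}$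 the group $\langle \sigma \rangle$ is conjugate to $G$ (i.e. the cycle type of a generator of $G$), and set $\tilde{\nu}_n(G) = \nu_n(\mu_G)$; if $G$ is non-cyclic, set $\tilde{\nu}_n(G) = 0$. *)

(* Defs.v *)
From HB Require Import structures.
From mathcomp Require Import all_boot all_order all_algebra all_fingroup.
From mathcomp Require Import all_solvable all_field.
From mathcomp Require Import all_classical all_reals all_analysis.

Set Implicit Arguments.
Unset Strict Implicit.
Unset Printing Implicit Defensive.

Import Order.TTheory GRing.Theory Num.Theory.

Local Open Scope group_scope.
Local Open Scope ring_scope.

(* Since [logn p 0 = 0], the value at 0 has to be singled out. *)
Definition padic_abs (R : realType) (p : nat) (x : rat) : R :=
  if x == 0 then 0
  else p%:R ^+ logn p `|denq x|%N / p%:R ^+ logn p `|numq x|%N.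

(* The field of p-adic numbers, given up to (unique) isomorphism as a          *)
(* completion of the rationals with respect to the p-adic absolute value.      *)
Record padicField (R : realType) (p : nat) := PadicField {
  padic_sort :> fieldType;
  padic_norm : padic_sort -> R;
  padic_norm_ge0 : forall x, 0 <= padic_norm x;
  padic_norm_eq0 : forall x, padic_norm x = 0 <-> x = 0;
  padic_normM : forall x y,
    padic_norm (x * y) = padic_norm x * padic_norm y;
  padic_normD : forall x y,
    padic_norm (x + y) <= Num.max (padic_norm x) (padic_norm y);
  padic_norm_rat : forall x : rat, padic_norm (ratr x) = padic_abs R p x;
  padic_dense : forall (x : padic_sort) (e : R), 0 < e ->
    exists r : rat, padic_norm (x - ratr r) < e;
  padic_complete : forall u : nat -> padic_sort,
    (forall e : R, 0 < e -> exists N, forall i j, (N <= i)%N -> (N <= j)%N ->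
      padic_norm (u i - u j) < e) ->
    exists x, forall e : R, 0 < e -> exists N, forall i, (N <= i)%N ->
      padic_norm (u i - x) < e
}.

Section PadicIntegers.
Variables (R : realType) (p : nat) (Q : padicField R p).

Definition padic_integer : {pred Q} := fun x => padic_norm x <= 1.

Lemma padic_norm1 : padic_norm (1 : Q) = 1.
Proof.
have nz1 : padic_norm (1 : Q) != 0.
  by apply/eqP => /padic_norm_eq0/eqP; rewrite oner_eq0.
by apply: (mulfI nz1); rewrite -padic_normM !mulr1.
Qed.

Lemma padic_normN (x : Q) : padic_norm (- x) = padic_norm x.
Proof.
rewrite -mulN1r padic_normM; suff -> : padic_norm (-1 : Q) = 1 by rewrite mul1r.
have /eqP : padic_norm (-1 : Q) ^+ 2 = 1.
  by rewrite expr2 -padic_normM mulrNN mulr1 padic_norm1.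
by rewrite -[X in _ == X](expr1n _ 2) eqrXn2 ?padic_norm_ge0 ?ler01 // => /eqP.
Qed.

Fact padic_integer_subring : subring_closed padic_integer.
Proof.
split=> [|x y|x y]; rewrite !unfold_in.
- by rewrite padic_norm1.
- move=> x1 y1; apply: le_trans (padic_normD _ _) _.
  by rewrite ge_max padic_normN x1.
- by move=> x1 y1; rewrite padic_normM mulr_ile1 ?padic_norm_ge0.
Qed.

HB.instance Definition _ :=
  GRing.isSubringClosed.Build Q padic_integer padic_integer_subring.

Record padic_integers := MkPadicInteger {
  padic_integers_val :> Q;
  _ : padic_integers_val \in padic_integer
}.

HB.instance Definition _ := [isSub for padic_integers_val].
HB.instance Definition _ := [Choice of padic_integers by <:].
HB.instance Definition _ := [SubChoice_isSubComNzRing of padic_integers by <:].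

End PadicIntegers.

Section RingOfIntegers.
Variables (R : realType) (p : nat) (Q : padicField R p) (K : fieldExtType Q).

Definition padic_to_ext : padic_integers Q -> K := in_alg K \o val.
HB.instance Definition _ := GRing.RMorphism.on padic_to_ext.

Definition integral_elt : {pred K} := fun x => `[< integralOver padic_to_ext x >].

Fact integral_elt_subring : subring_closed integral_elt.
Proof.
split=> [|x y /asboolP x1 /asboolP y1|x y /asboolP x1 /asboolP y1].
- by apply/asboolP/integral1.
- by apply/asboolP/integral_sub.
- by apply/asboolP/integral_mul.
Qed.

HB.instance Definition _ :=
  GRing.isSubringClosed.Build K integral_elt integral_elt_subring.

Record integers := MkIntegers {
  integers_val :> K;
  _ : integers_val \in integral_elt
}.

HB.instance Definition _ := [isSub for integers_val].
HB.instance Definition _ := [Choice of integers by <:].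
HB.instance Definition _ := [SubChoice_isSubComNzRing of integers by <:].

(* The ring of integers is local: its maximal ideal is the set of nonunits. *)
Definition max_ideal : set integers := [set x | ~ exists y, x * y = 1].

(* The p-adic topology: [integers] is free of finite rank over the p-adic      *)
(* integers, so the cosets of p^k * integers form a base of the topology       *)
(* induced from K.                                                             *)
Definition integers_open : set (set integers) :=
  [set U | forall x, U x -> exists k, forall y, U (x + p%:R ^+ k * y)].

Fact integers_openT : integers_open setT.
Proof. by move=> x _; exists 0%N. Qed.

Fact integers_openI : setI_closed integers_open.
Proof.
move=> U V oU oV x [/oU[k Uk] /oV[l Vl]]; exists (k + l)%N => y; split.
  by rewrite exprD -mulrA; apply: Uk.
by rewrite addnC exprD -mulrA; apply: Vl.
Qed.

Fact integers_open_bigU (I : Type) (F : I -> set integers) :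
  (forall i, integers_open (F i)) -> integers_open (\bigcup_i F i)%classic.
Proof.
by move=> oF x [i Ii /oF[k Fk]]; exists k => y; exists i => //; apply: Fk.
Qed.

HB.instance Definition _ := isPointed.Build integers 0.
HB.instance Definition _ := isOpenTopological.Build integers
  integers_openT integers_openI integers_open_bigU.

Definition borel_integers := g_sigma_algebraType (@open integers).

End RingOfIntegers.

Definition is_haar (R : realType) (p : nat) (Q : padicField R p)
    (K : fieldExtType Q) (h : probability (borel_integers K) R) : Prop :=
  forall (a : integers K) (A : set (borel_integers K)), measurable A ->
    h [set (a + x : integers K) | x in A]%classic = h A.

Definition is_residue_map (R : realType) (p : nat) (Q : padicField R p)
    (K : fieldExtType Q) (k : finFieldType) (red : {rmorphism integers K -> k}) :=
  (forall z, exists x, red x = z) /\ (forall x, red x = 0 <-> max_ideal x).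

Section ProductMeasure.
Context {d : measure_display} {T : measurableType d} {R : realType}.
Variable h : probability T R.

Definition consT n (x : T * n.-tuple T) : n.+1.-tuple T := [tuple of x.1 :: x.2].

Fact measurable_consT n : measurable_fun setT (@consT n).
Proof. exact: measurable_cons. Qed.

HB.instance Definition _ n := isMeasurableFun.Build _ _ _ _ (@consT n)
  (@measurable_consT n).

Fixpoint tuple_probability n : probability (n.-tuple T) R :=
  match n with
  | 0 => dirac [tuple]
  | m.+1 => distribution (h \x tuple_probability m)%E (@consT m)
  end.

End ProductMeasure.

Section GaloisGroups.
Variables (R : realType) (p : nat) (Q : padicField R p) (K : fieldExtType Q).
Variable n : nat.

Definition monic_poly (a : n.-tuple (integers K)) : {poly integers K} :=
  'X^n + \poly_(i < n) a`_i.

(* For monic f this is disc f = (-1)^(n (n - 1) / 2) Res(f, f'). *)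
Definition discriminant (f : {poly integers K}) : integers K :=
  (-1) ^+ 'C((size f).-1, 2) * resultant f f^`().

Definition root_perms (L : splittingFieldType K) (r : n.-tuple L) : {set 'S_n} :=
  [set s : 'S_n | [exists g in 'Gal({:L} / 1),
    [forall i, g (tnth r i) == tnth r (s i)]]].

Definition conj_class (G : {set 'S_n}) : {set {set 'S_n}} :=
  G :^: [set: 'S_n].

(* The Galois group of f belongs to [conj_class G]; in particular f has distinct roots. *)
Definition has_galois_group (f : {poly K}) (G : {set 'S_n}) : Prop :=
  exists (L : splittingFieldType K) (r : n.-tuple L),
    let fL := map_poly (in_alg L) f in
    [/\ fL = \prod_(i < n) ('X - (tnth r i)%:P), uniq r,
        splittingFieldFor 1 fL {:L} & root_perms r \in conj_class G].

Definition galois_tuples (G : {set 'S_n}) : set (n.-tuple (borel_integers K)) :=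
  [set a | has_galois_group (map_poly val (monic_poly a)) G].

Definition unramified_galois_tuples (G : {set 'S_n}) :
    set (n.-tuple (borel_integers K)) :=
  [set a | galois_tuples G a /\ ~ max_ideal (discriminant (monic_poly a))].

End GaloisGroups.

Section ErdosTuran.
Variables (R : realType) (n : nat).

Definition cycle_type (s : 'S_n) : seq nat :=
  sort geq [seq #|(c : {set 'I_n})| | c <- enum (porbits s)].

Definition cycle_class (mu : seq nat) : {set 'S_n} :=
  [set s | cycle_type s == mu].

Definition cycle_freq (mu : seq nat) : R := #|cycle_class mu|%:R / n`!%:R.

Definition generator_type (G : {set 'S_n}) : seq nat :=
  if [pick s | generator G s] is Some s then cycle_type s else [::].

Definition erdos_turan (G : {set 'S_n}) : R :=
  if cyclic G then cycle_freq (generator_type G) else 0.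

End ErdosTuran.

(* Main.v *)
Require Import Defs.
From HB Require Import structures.
From mathcomp Require Import all_boot all_order all_algebra all_fingroup.
From mathcomp Require Import all_solvable all_field.
From mathcomp Require Import all_classical all_reals all_analysis.
From mathcomp Require Import measurable_realfun ring lra zify.

Import Order.TTheory GRing.Theory Num.Theory.
Import numFieldNormedType.Exports.

Set Implicit Arguments.
Unset Strict Implicit.
Unset Printing Implicit Defensive.

Local Open Scope group_scope.
Local Open Scope ring_scope.

(** The proof turns both assertions into counting problems over the residue field
    k, with q elements.

    Unramified polynomials. Let f be monic of degree n over the integers of K, with
    separable reduction; this is the case of unit discriminant
    ([discriminant_unit]). The integral elements of the splitting field L form a
    valuation ring ([integral_or_inv], a consequence of Hensel's lemma
    [hensel_factor] over the p-adic integers), whose maximal ideal is therefore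
    preserved by the Galois group. So the Galois group acts on the residue field of
    L, faithfully because the roots of f have distinct reductions. Its image is
    generated by the Frobenius map x |-> x^q: instead of going through the Galois
    theory of the residue field, [frobenius_root_perms] compares two groups acting
    on the reduced roots by means of [fixed_coefficients]: if the polynomial with
    roots b_j(r), for all b_j in one group and a generic linear combination r of the
    roots, is fixed by an automorphism a, then a acts on the roots as some b_j.
    Hence the Galois group of f is conjugate to G if and only if G is cyclic and
    Frobenius permutes the roots of the reduction with the cycle type of a generator
    of G ([cycle_type_conj], [unramified_galois_tuplesE]). The measure of a set
    defined by reductions is its proportion among the q^n reductions
    ([tuple_probability_residue]), so it remains to count.

    Counting by cycle type. For s in S_n let X_s be the set of injective n-tuples x
    over a large finite field with x_i^q = x_(s i). Ordering the roots of a
    polynomial gives n! |S_mu| = sum |X_s| over the s of cycle type mu, where S_mu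
    is the set of polynomials with Frobenius of type mu ([card_frob_polys]). Without
    injectivity there are exactly q^n such tuples, one choice in the field with q^d
    elements for each cycle of length d, and each equation x_i = x_j cuts out a
    proper k-subspace. Hence q^n - n^2 q^(n-1) <= |X_s| <= q^n
    ([card_frob_roots]), which compares |S_mu| / q^n with nu_n(mu).

    The other polynomials. At most q^(n-1) monic polynomials of degree n >= 2 over
    k are not separable ([card_nonseparable]). The tuples with such a reduction form
    a set of measure at most 1/q, which contains all tuples whose Galois group is
    not cyclic and all tuples with discriminant in the maximal ideal. For the sum over the non-cyclic groups, the
    sets attached to non-conjugate groups are disjoint as the Galois group does not
    depend on the splitting field ([has_galois_group_conj]).

    Measurability. The set of polynomials with a given Galois group is open, by
    Krasner's argument inside a common extension of two splitting fields
    ([galois_tuples_open]), and the rationals provide a countable dense set, so it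
    is a countable union of boxes ([measurable_galois_tuples]). *)


(** * Cycle types of permutations *)

Section CycleTypes.
Variable n : nat.
Implicit Types (s t : 'S_n) (G H : {group 'S_n}).

Lemma porbit_gen s t : <[s]>%g = <[t]>%g -> porbit s =1 porbit t.
Proof. by move=> e x; rewrite !porbitE e. Qed.

Lemma cycle_type_gen s t : <[s]>%g = <[t]>%g -> cycle_type s = cycle_type t.
Proof.
move=> e; rewrite /cycle_type; suff -> : porbits s = porbits t by [].
by rewrite /porbits; apply: eq_imset; apply: porbit_gen.
Qed.

Lemma expp_porbit s x j j' :
  ((s ^+ j)%g x == (s ^+ j')%g x) = (j == j' %[mod #|porbit s x|]).
Proof.
set d := #|porbit s x|.
have d0 : (0 < d)%N by rewrite lt0n card_porbit_neq0.
have red i : (s ^+ i)%g x = nth x (traject s x d) (i %% d).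
  rewrite nth_traject ?ltn_mod // permX {1}(divn_eq i d) addnC iterD.
  congr (iter _ _ _); elim: (i %/ d)%N => // m IH.
  by rewrite mulSn addnC iterD iter_porbit IH.
by rewrite !red nth_uniq ?size_traject ?ltn_mod // uniq_traject_porbit.
Qed.

Definition orbit_points s d : {set 'I_n} := [set i | #|porbit s i| == d].

Lemma card_orbit_points s d :
  #|orbit_points s d| = (d * count_mem d (cycle_type s))%N.
Proof.
have -> : count_mem d (cycle_type s) = #|[set c in porbits s | #|pred_of_set c| == d]|.
  rewrite /cycle_type; have /seq.permP -> := permEl (perm_sort geq [seq #|pred_of_set c| | c <- enum (porbits s)]).
  rewrite count_map -size_filter cardE /enum_mem /= -filter_predI.
  by congr size; apply: eq_filter => c /=; rewrite !inE andbC.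
have -> : orbit_points s d = finset.cover [set c in porbits s | #|pred_of_set c| == d].
  apply/finset.setP => i; rewrite inE; apply/idP/finset.bigcupP => [di|[c]].
    by exists (porbit s i); rewrite ?porbit_id // inE di andbT imset_f.
  rewrite inE => /andP[/imsetP[j _ ->] dj].
  by rewrite -eq_porbit_mem => /eqP ->.
have /eqP <- : finset.trivIset [set c in porbits s | #|pred_of_set c| == d].
  apply/finset.trivIsetP => A B; rewrite !inE => /andP[/imsetP[i _ ->] _].
  move=> /andP[/imsetP[j _ ->] _] nAB; rewrite -setI_eq0; apply/eqP/setP => u.
  rewrite !inE; apply/andP => -[]; rewrite -!eq_porbit_mem => /eqP e1 /eqP e2.
  by rewrite -e1 e2 eqxx in nAB.
rewrite (eq_bigr (fun=> d)) => [|c]; last by rewrite inE => /andP[_ /eqP].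
by rewrite sum_nat_const mulnC.
Qed.

Lemma cycle_type_neq0 s : count_mem 0%N (cycle_type s) = 0%N.
Proof.
apply/count_memPn; rewrite /cycle_type mem_sort; apply/mapP => -[c].
rewrite mem_enum => /imsetP[i _ ->] /eqP.
by rewrite eq_sym (negPf (card_porbit_neq0 s i)).
Qed.

Lemma eq_cycle_type s t :
  (forall d, #|orbit_points s d| = #|orbit_points t d|) ->
  cycle_type s = cycle_type t.
Proof.
move=> e; rewrite /cycle_type; apply/perm_sortP.
- exact: (fun x y => leq_total y x).
- by move=> x y z h1 h2; exact: leq_trans h2 h1.
- by move=> x y; rewrite andbC => /anti_leq.
have /permPl <- := permEl (perm_sort geq [seq #|(c : {set 'I_n})| | c <- enum (porbits s)]).
have /permPr <- := permEl (perm_sort geq [seq #|(c : {set 'I_n})| | c <- enum (porbits t)]).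
rewrite -/(cycle_type s) -/(cycle_type t).
apply/allP => d _ /=; apply/eqP.
have [->|d0] := posnP d; first by rewrite !cycle_type_neq0.
by apply/eqP; rewrite -(eqn_pmul2l d0) -!card_orbit_points e.
Qed.

Lemma card_fix_expg s e :
  #|[set i | (s ^+ e)%g i == i]| = \sum_(d < n.+1 | (d %| e)%N) #|orbit_points s d|.
Proof.
have dle i : (#|porbit s i| < n.+1)%N.
  by rewrite ltnS -[X in (_ <= X)%N](card_ord n) max_card.
rewrite -sum1dep_card (partition_big (fun i => inord #|porbit s i| : 'I_n.+1)
  (fun d => d %| e)%N) /=; last first.
  move=> i; rewrite -[X in _ == X](perm1 i) -(expg0 s) expp_porbit mod0n inordK //.
apply: eq_bigr => d de; rewrite -sum1dep_card; apply: eq_bigl => i.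
have -> : (inord #|porbit s i| == d) = (#|porbit s i| == d).
  by rewrite -(inj_eq val_inj) /= inordK.
rewrite andb_idl // => /eqP di.
by rewrite -[X in _ == X](perm1 i) -(expg0 s) expp_porbit mod0n di.
Qed.

(** By induction on d: the fixed points of s^d are the points whose orbit length
    divides d, and those of length less than d are already accounted for. *)
Lemma eq_cycle_type_fix s t :
  (forall e, (0 < e)%N ->
     #|[set i | (s ^+ e)%g i == i]| = #|[set i | (t ^+ e)%g i == i]|) ->
  cycle_type s = cycle_type t.
Proof.
move=> fixE; apply: eq_cycle_type => d.
elim/ltn_ind: d => d IH.
have [->|d0] := posnP d; first by rewrite !card_orbit_points !mul0n.
have [nd|dn] := ltnP n d.
  suff z u : orbit_points u d = finset.set0 by rewrite !z.
  apply/finset.setP => i; rewrite !inE; apply/negP => /eqP di.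
  by have := max_card (porbit u i); rewrite di card_ord leqNgt nd.
have := fixE d d0; rewrite !card_fix_expg.
rewrite (bigD1 (inord d)) /= ?inordK // [in RHS](bigD1 (inord d)) /= ?inordK //.
set S1 := \sum_(_ | _) _; set S2 := \sum_(_ | _) _.
suff -> : S1 = S2 by move/addIn.
apply: eq_bigr => i /andP[id iNd]; apply: IH.
rewrite ltn_neqAle dvdn_leq // andbT; apply: contraNneq iNd => e.
by rewrite -(inj_eq val_inj) /= inordK ?e.
Qed.

Lemma porbitJ s x i : porbit (s ^ x)%g (x i) = x @: porbit s i.
Proof.
apply/finset.setP => j; apply/porbitP/imsetP => [[m ->]|[_ /porbitP[m ->] ->]].
  by exists ((s ^+ m)%g i); rewrite ?mem_porbit // -conjXg permJ.
by exists m; rewrite -conjXg permJ.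
Qed.

Lemma cycle_typeJ s x : cycle_type (s ^ x)%g = cycle_type s.
Proof.
apply: eq_cycle_type => d; rewrite -(card_imset (orbit_points s d) (@perm_inj _ x)).
apply: eq_card => j; rewrite inE; apply/idP/imsetP => [dj|[i]].
  exists ((x^-1)%g j); rewrite ?permKV // inE -(card_imset _ (@perm_inj _ x)).
  by rewrite -porbitJ permKV.
by rewrite inE => di ->; rewrite porbitJ card_imset //; exact: perm_inj.
Qed.

(** Match the orbits of s with orbits of t of the same length, choose a base point
    in every orbit, and send s^m y to t^m z for matching base points y and z. *)
Lemma cycle_type_conj s t :
  cycle_type s = cycle_type t -> exists x, t = (s ^ x)%g.
Proof.
(* The two sorted lists of lengths agree up to a permutation pi of the indices. *)
pose sz := fun c : {set 'I_n} => #|c|.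
pose A := enum (porbits s); pose B := enum (porbits t).
move=> est; have pAB : perm_eq (map sz A) (map sz B).
  rewrite -(perm_sort geq) perm_sym -(perm_sort geq) perm_sym.
  by rewrite -/(cycle_type s) -/(cycle_type t) est.
have [ph phI phE] : exists2 ph : {set 'I_n} -> {set 'I_n},
    {in porbits s &, injective ph} &
    forall c, c \in porbits s -> ph c \in porbits t /\ #|ph c| = #|c|.
  have /tuple_permP[pi piE] : perm_eq (map sz A) (map_tuple sz (in_tuple B)) by [].
  have iA c : c \in porbits s -> (index c A < size B)%N.
    by move=> cs; rewrite -(size_map sz) -(perm_size pAB) size_map index_mem mem_enum.
  pose ph c := if insub (index c A) : option 'I_(size B) is Some j
               then nth finset.set0 B (pi j) else finset.set0.
  have phd c (cs : c \in porbits s) : ph c = nth finset.set0 B (pi (Ordinal (iA c cs))).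
    by rewrite /ph insubT ?iA // => h; congr (nth _ _ (pi _)); apply: val_inj.
  exists ph.
    move=> c c' cs cs'; rewrite !phd => /eqP; rewrite nth_uniq ?enum_uniq //.
    move=> /eqP/val_inj/perm_inj[] e.
    by rewrite -[c](nth_index finset.set0 (s := A)) ?mem_enum // e nth_index ?mem_enum.
  move=> c cs; rewrite phd; split; first by rewrite -mem_enum mem_nth.
  have lt : (index c A < size A)%N by rewrite index_mem mem_enum.
  have /(congr1 (fun u => nth 0%N u (index c A))) := piE.
  rewrite (nth_map finset.set0) // nth_index ?mem_enum // /sz => ->.
  have lt' := iA c cs.
  rewrite (nth_map (Ordinal lt')) /= ?size_enum_ord //.
  rewrite (tnth_nth 0%N) /= (nth_map finset.set0) //.
  by congr (#|pred_of_set (nth _ _ (pi _))|); apply: val_inj; rewrite /= nth_enum_ord.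
pose rp (c : {set 'I_n}) i0 : 'I_n := odflt i0 [pick i in c].
have rpE u i : rp (porbit u i) i \in porbit u i.
  by rewrite /rp; case: pickP => [//|/(_ i)] /=; rewrite porbit_id.
have rpE2 (c : {set 'I_n}) u i : c \in porbits u -> porbit u (rp c i) = c.
  move=> /imsetP[j _ ->]; apply/eqP; rewrite eq_porbit_mem /rp.
  by case: pickP => [//|/(_ j)] /=; rewrite porbit_id.
pose yo i := rp (porbit s i) i; pose zo i := rp (ph (porbit s i)) i.
have rpi (c : {set 'I_n}) i i' j : j \in c -> rp c i = rp c i'.
  by move=> jc; rewrite /rp; case: pickP => [//|/(_ j)] /=; rewrite jc.
have inS i : porbit s i \in porbits s by exact: imset_f.
have yoS i : porbit s (yo i) = porbit s i by exact: rpE2.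
have zoT i : porbit t (zo i) = ph (porbit s i).
  by apply: rpE2; case: (phE _ (inS i)).
have szE i : #|porbit t (zo i)| = #|porbit s (yo i)|.
  by rewrite zoT yoS; case: (phE _ (inS i)).
have yo_eq i i' : porbit s i = porbit s i' -> yo i = yo i' /\ zo i = zo i'.
  move=> e; rewrite /yo /zo e; split; first exact: (rpi _ _ _ _ (porbit_id s i')).
  have [/imsetP[j _ e'] _] := phE _ (inS i'); rewrite e'.
  exact: (rpi _ _ _ _ (porbit_id t j)).
have ex i : exists m, i == (s ^+ m)%g (yo i).
  have : i \in porbit s (yo i) by rewrite -eq_porbit_mem yoS.
  by case/porbitP => m /eqP im; exists m.
pose m i := xchoose (ex i); have mE i : i = (s ^+ m i)%g (yo i).
  exact/eqP/(xchooseP (ex i)).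
pose x0 i := (t ^+ m i)%g (zo i).
have x0I : injective x0.
  move=> i i' e.
  have : porbit t (x0 i) = porbit t (x0 i') by rewrite e.
  rewrite !porbit_perm !zoT => /phI => /(_ (inS _) (inS _)) /yo_eq[ey ez].
  have /eqP := e; rewrite /x0 -ez expp_porbit szE -expp_porbit -mE ey -mE.
  by move/eqP.
exists (perm x0I); apply/permP => j.
rewrite -[j](permKV (perm x0I)) permJ; set i := ((perm x0I)^-1)%g j.
rewrite !permE -permM -expgSr.
have [ey ez] : yo (s i) = yo i /\ zo (s i) = zo i.
  by apply: yo_eq; apply/eqP; rewrite eq_porbit_mem; exact: (mem_porbit s 1 i).
apply/eqP; rewrite /x0 ez expp_porbit szE -expp_porbit expgSr permM -mE -ey -mE.
exact: eqxx.
Qed.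

Lemma cycle_conj_classE s G :
  (<[s]>%g \in conj_class G) = cyclic G && (cycle_type s == generator_type G).
Proof.
apply/imsetP/andP => [[x _ e]|[cG]].
  have cG : cyclic G by rewrite -(cyclicJ G x) -e cycle_cyclic.
  split=> //; rewrite /generator_type; case: pickP => [g|]; last first.
    by have /cyclicP[g ->] := cG; move=> /(_ g); rewrite generator_cycle.
  move=> /eqP eG; rewrite -(cycle_typeJ g x); apply/eqP/cycle_type_gen.
  by rewrite e eG cycleJ.
rewrite /generator_type; case: pickP => [g|]; last first.
  by have /cyclicP[g ->] := cG; move=> /(_ g); rewrite generator_cycle.
move=> /eqP eG /eqP/esym/cycle_type_conj[x ->]; exists x; rewrite ?inE //.
by rewrite eG cycleJ.
Qed.

Lemma cycle_class_generator G : cyclic G ->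
  exists s, s \in cycle_class n (generator_type G).
Proof.
move=> cG; rewrite /generator_type; case: pickP => [g|].
  by exists g; rewrite inE.
by have /cyclicP[g ->] := cG; move=> /(_ g); rewrite generator_cycle.
Qed.

End CycleTypes.

(** * Monic polynomials given by their coefficients *)

Section TuplePolynomials.

Definition tuple_poly (A : nzRingType) n (c : n.-tuple A) : {poly A} :=
  'X^n + \poly_(i < n) c`_i.

Lemma size_tuple_poly (A : nzRingType) n (c : n.-tuple A) :
  size (tuple_poly c) = n.+1.
Proof. by rewrite size_polyDl size_polyXn // ltnS size_poly. Qed.

Lemma monic_tuple_poly (A : nzRingType) n (c : n.-tuple A) :
  tuple_poly c \is monic.
Proof.
rewrite monicE lead_coefE size_tuple_poly coefD coefXn eqxx coef_poly ltnn.
by rewrite addr0.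
Qed.

Lemma coef_tuple_poly (A : nzRingType) n (c : n.-tuple A) (i : 'I_n) :
  (tuple_poly c)`_i = tnth c i.
Proof.
by rewrite coefD coefXn ltn_eqF // add0r coef_poly ltn_ord (tnth_nth 0).
Qed.

Lemma tuple_poly_inj (A : nzRingType) n : injective (@tuple_poly A n).
Proof.
by move=> c d e; apply: eq_from_tnth => i; rewrite -!coef_tuple_poly e.
Qed.

Lemma map_tuple_poly (A B : nzRingType) (g : {rmorphism A -> B}) n
    (c : n.-tuple A) :
  map_poly g (tuple_poly c) = tuple_poly (map_tuple g c).
Proof.
rewrite rmorphD /= map_polyXn; congr (_ + _); apply/polyP => i.
rewrite coef_map !coef_poly; case: ifP => [lt|_]; last exact: rmorph0.
by rewrite -[i]/(nat_of_ord (Ordinal lt)) -!tnth_nth tnth_map.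
Qed.

Lemma tuple_polyP (A : nzRingType) n (g : {poly A}) :
  g \is monic -> size g = n.+1 -> exists c : n.-tuple A, g = tuple_poly c.
Proof.
move=> gm sg; exists [tuple g`_i | i < n]; apply/polyP => i.
have [lt|] := ltnP i n.
  by rewrite -[i]/(nat_of_ord (Ordinal lt)) coef_tuple_poly tnth_mktuple.
rewrite leq_eqVlt => /orP[/eqP <-|gt].
  rewrite -[n in LHS]/(n.+1.-1) -sg -lead_coefE (monicP gm).
  by rewrite -(monicP (monic_tuple_poly [tuple g`_i | i < n])) lead_coefE size_tuple_poly.
by rewrite !nth_default ?size_tuple_poly ?sg.
Qed.

(** This is how a ring endomorphism that fixes a polynomial acts on its roots. *)
Lemma prod_XsubC_perm (A : idomainType) n (r r' : 'I_n -> A) :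
  injective r -> \prod_i ('X - (r i)%:P) = \prod_i ('X - (r' i)%:P) ->
  exists s : 'S_n, forall i, r i = r' (s i).
Proof.
move=> rI e; have ex i : exists j, r i == r' j.
  have : root (\prod_i ('X - (r i)%:P)) (r i).
    by rewrite (bigD1 i) //= rootM root_XsubC eqxx.
  rewrite e /root horner_prod => /prodf_eq0[j _].
  by rewrite hornerXsubC subr_eq0; exists j.
pose s i := xchoose (ex i); have sE i : r i = r' (s i) by exact/eqP/(xchooseP (ex i)).
have sI : injective s by move=> i j e'; apply: rI; rewrite sE e' -sE.
by exists (perm sI) => i; rewrite permE.
Qed.

Lemma prod_XsubC_reindex (A : comNzRingType) n (r : 'I_n -> A) (s : 'S_n) :
  \prod_i ('X - (r (s i))%:P) = \prod_i ('X - (r i)%:P).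
Proof. by rewrite [RHS](reindex_inj (@perm_inj _ s)). Qed.

End TuplePolynomials.

(** * Tuples on which Frobenius acts by a given permutation *)

Section OrbitRepresentatives.
Variable n : nat.

Lemma orbit_reps (s : 'S_n) : exists (y : 'I_n -> 'I_n) (m : 'I_n -> nat),
  [/\ forall i, i = (s ^+ m i)%g (y i),
      forall i, (m i < #|porbit s i|)%N,
      forall i, y i \in porbit s i
    & forall i j, j \in porbit s i -> y j = y i].
Proof.
pose y i := odflt i [pick j in porbit s i].
have yS i : y i \in porbit s i.
  by rewrite /y; case: pickP => [//|/(_ i)] /=; rewrite porbit_id.
have yE i j : j \in porbit s i -> y j = y i.
  rewrite -eq_porbit_mem => /eqP e; rewrite /y e.
  by case: pickP => // /(_ i); rewrite porbit_id.
have yP i : porbit s (y i) = porbit s i by apply/eqP; rewrite eq_porbit_mem.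
have ex i : exists m : 'I_#|porbit s i|, i == (s ^+ m)%g (y i).
  have : i \in porbit s (y i) by rewrite yP porbit_id.
  case/porbitP => m im; pose d := #|porbit s i|.
  have d0 : (0 < d)%N by rewrite lt0n card_porbit_neq0.
  exists (Ordinal (ltn_pmod m d0)); rewrite {1}im /=.
  by rewrite expp_porbit yP modn_mod.
exists y, (fun i => nat_of_ord (xchoose (ex i))); split=> // i.
exact/eqP/(xchooseP (ex i)).
Qed.

End OrbitRepresentatives.

Section FrobeniusTuples.
Variables (n : nat) (k E : finFieldType) (io : {rmorphism k -> E}).
Local Notation q := #|k|.
Hypothesis card_roots : forall d, (0 < d)%N -> (d <= n)%N ->
  #|[set y : E | y ^+ (q ^ d) == y]| = (q ^ d)%N.

Implicit Type s : 'S_n.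

Lemma q_gt1 : (1 < q)%N. Proof. exact: finNzRing_gt1. Qed.
Lemma q_gt0 : (0 < q)%N. Proof. exact: ltnW q_gt1. Qed.

Lemma frobD (A : comNzRingType) (j : {rmorphism k -> A}) (x y : A) :
  (x + y) ^+ q = x ^+ q + y ^+ q.
Proof.
have [p p_pr pk] := finPcharP k.
have pE : p \in [pchar A] by rewrite (rmorph_pchar j).
apply: exprDn_pchar; have := card_pprimeChar pk; rewrite /pPrimeCharType => ->.
by rewrite pnatX (eq_pnat _ (pcharf_eq pE)) pnat_id.
Qed.


Definition frob_tuples (s : 'S_n) : {set {ffun 'I_n -> E}} :=
  [set x : {ffun 'I_n -> E} | [forall i, x i ^+ q == x (s i)]].

Definition frob_roots (s : 'S_n) : {set {ffun 'I_n -> E}} :=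
  [set x in frob_tuples s | injectiveb x].

Lemma frob_tuplesX s x m i : x \in frob_tuples s ->
  x ((s ^+ m)%g i) = x i ^+ (q ^ m).
Proof.
rewrite inE => /forallP/(_ _)/eqP xs.
elim: m => [|m IH]; first by rewrite perm1 expr1.
by rewrite expgSr permM -xs IH expnSr exprM.
Qed.

Lemma fix_expX (y : E) d m : y ^+ (q ^ d) = y -> y ^+ (q ^ (m * d)) = y.
Proof.
by move=> yd; elim: m => [|m IH]; rewrite ?expr1 // mulSn expnD exprM yd.
Qed.

(** One value z per cycle, fixed by the power of Frobenius given by the length of
    the cycle, extends to a whole tuple: put z^(q^m) at the m-th point after the base
    point. *)
Lemma frob_tuples_ext s : exists (y : 'I_n -> 'I_n) (m : 'I_n -> nat),
  [/\ forall i, i = (s ^+ m i)%g (y i),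
      forall i, (m i < #|porbit s i|)%N,
      forall i, y i \in porbit s i,
      forall i j, j \in porbit s i -> y j = y i
    & forall z : 'I_n -> E,
      (forall i, y i = i -> z i ^+ (q ^ #|porbit s i|) = z i) ->
      [ffun i => z (y i) ^+ (q ^ m i)] \in frob_tuples s].
Proof.
have [y [m [mE mlt yS yE]]] := orbit_reps s.
exists y, m; split=> // z zE; rewrite inE; apply/forallP => i; rewrite !ffunE.
have si : s i \in porbit s i by exact: (mem_porbit s 1 i).
have ysi := yE _ _ si; rewrite ysi -exprM -expnSr.
have yy : y (y i) = y i by apply: yE; apply: yS.
have oE j j' : j \in porbit s j' -> porbit s j = porbit s j'.
  by rewrite -eq_porbit_mem => /eqP.
have zd := zE _ yy; rewrite (oE _ _ (yS i)) in zd.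
set d := #|porbit s i| in zd *.
have /eqP : ((s ^+ (m i).+1)%g (y i) == (s ^+ m (s i))%g (y i)).
  by rewrite expgSr permM -mE -{1}ysi -mE.
move/eqP; rewrite expp_porbit (oE _ _ (yS i)) -/d => /eqP e.
have lt : (m (s i) < d)%N by rewrite /d -(oE _ _ si).
by rewrite (divn_eq (m i).+1 d) e (modn_small lt) expnD exprM fix_expX.
Qed.

Lemma porbit_le_n (s : 'S_n) i : (0 < #|porbit s i| <= n)%N.
Proof. by rewrite lt0n card_porbit_neq0 -[X in (_ <= X)%N](card_ord n) max_card. Qed.

Lemma card_frob_tuples s : #|frob_tuples s| = (q ^ n)%N.
Proof.
have [y [m [mE mlt yS yE zE]]] := frob_tuples_ext s.
pose D := [pred i | y i == i].
pose F i := [pred z : E | z ^+ (q ^ #|porbit s i|) == z].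
have yy i : y (y i) = y i by apply: yE; apply: yS.
pose g (z : {ffun 'I_n -> E}) := [ffun i => z (y i) ^+ (q ^ m i)].
have oE j j' : j \in porbit s j' -> porbit s j = porbit s j'.
  by rewrite -eq_porbit_mem => /eqP.
have m0 i : y i = i -> m i = 0%N.
  move=> yi; have /eqP := mE i; rewrite yi -{1}(perm1 i) -(expg0 s) expp_porbit.
  by rewrite mod0n (modn_small (mlt i)) => /eqP.
have <- : g @: pfamily 0 D F = frob_tuples s.
  apply/finset.setP => x; apply/imsetP/idP => [[z /pfamilyP[_ zF] ->]|xs].
    by apply: zE => i yi; have /eqP := zF i (introT eqP yi).
  exists [ffun i => if i \in D then x i else 0].
    apply/pfamilyP; split.
      by apply/supportP => i /negPf iD; rewrite ffunE iD.
    move=> i iD; rewrite ffunE iD inE -(frob_tuplesX _ _ xs); apply/eqP; congr (x _).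
    apply/eqP; rewrite -[X in _ == X](perm1 i) -(expg0 s) expp_porbit.
    by rewrite mod0n modnn.
  by apply/ffunP => i; rewrite !ffunE inE yy eqxx -(frob_tuplesX _ _ xs) -mE.
rewrite card_in_imset; last first.
  move=> z z' /pfamilyP[/supportP zD _] /pfamilyP[/supportP zD' _] e.
  apply/ffunP => i; have [iD|iD] := boolP (i \in D); last by rewrite zD ?zD'.
  move/ffunP/(_ i): e; rewrite !ffunE (m0 _ (eqP iD)) !expr1.
  by rewrite (eqP iD).
rewrite card_pfamily foldrE big_map big_enum /=.
rewrite (eq_bigr (fun i => q ^ #|porbit s i|)%N) => [|i iD]; last first.
  have /andP[d0 dn] := porbit_le_n s i.
  rewrite -[RHS](card_roots d0 dn); apply: eq_card => z.
  by rewrite [RHS]inE unfold_in.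
rewrite -expn_sum; congr (_ ^ _)%N; rewrite -[RHS](card_ord n) -sum1_card.
rewrite [RHS](partition_big y (fun i => i \in D)) => [|i _]; last by rewrite inE yy.
apply: eq_bigr => i iD; have yi : y i = i by exact/eqP.
rewrite sum1_card; apply: eq_card => j.
rewrite [RHS]unfold_in /=; apply/idP/eqP => [/yE ->|/val_inj ji]; first by rewrite yi.
by rewrite (mE j) ji mem_porbit.
Qed.

(** For i and j in different cycles take the indicator of one cycle. In the same
    cycle of length d, a value z with z^(q^a) <> z^(q^b) is wanted, where a, b < d are
    the positions of i and j: the polynomial X^(q^a) - X^(q^b) has fewer than q^d
    roots. *)
Lemma frob_tuples_sep s i j : i != j ->
  exists2 x, x \in frob_tuples s & x i != x j.
Proof.
move=> ij; have [y [m [mE mlt yS yE zE]]] := frob_tuples_ext s.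
have oE u u' : u \in porbit s u' -> porbit s u = porbit s u'.
  by rewrite -eq_porbit_mem => /eqP.
have [yij|yij] := eqVneq (y i) (y j); last first.
  exists [ffun u => (if y u == y i then 1 else 0) ^+ (q ^ m u)].
    apply: (zE (fun v => if v == y i then 1 else 0)) => u _; case: ifP; rewrite ?expr1n //.
    by rewrite expr0n expn_eq0 -leqn0 leqNgt q_gt0.
  rewrite !ffunE eqxx expr1n eq_sym [y j == _]eq_sym (negPf yij).
  by rewrite expr0n expn_eq0 -leqn0 leqNgt q_gt0 /= eq_sym oner_neq0.
set d := #|porbit s i|.
have dj : #|porbit s j| = d.
  by rewrite /d -(oE _ _ (yS i)) yij (oE _ _ (yS j)).
have mij : m i != m j by apply: contraNneq ij => e; rewrite [i]mE e yij -mE.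
have /andP[d0 dn] := porbit_le_n s i.
have [z zd zij] : exists2 z : E, z ^+ (q ^ d) = z & z ^+ (q ^ m i) != z ^+ (q ^ m j).
  have lt u : (m u < d)%N -> (q ^ m u < q ^ d)%N by rewrite ltn_exp2l ?q_gt1.
  set P : {poly E} := 'X^(q ^ m i) - 'X^(q ^ m j).
  have sP : (size P <= q ^ d)%N.
    apply: leq_trans (size_polyD _ _) _; rewrite size_polyN !size_polyXn.
    by rewrite geq_max !lt // -?dj mlt.
  have P0 : P != 0.
    rewrite subr_eq0; apply: contraNneq mij => /(congr1 (fun P : {poly E} => size P)).
    by rewrite !size_polyXn => -[] /eqP; rewrite eqn_exp2l ?q_gt1.
  have : ~~ all (root P) (enum [set y : E | y ^+ (q ^ d) == y]).
    apply/negP => /(max_poly_roots P0); rewrite enum_uniq => /(_ isT).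
    by rewrite -cardE card_roots // ltnNge sP.
  case/allPn => z; rewrite mem_enum inE => /eqP zd; rewrite /root /P.
  by rewrite hornerD hornerN !hornerXn subr_eq0 => zij; exists z.
exists [ffun u => (if y u == y i then z else 0) ^+ (q ^ m u)].
  apply: (zE (fun v => if v == y i then z else 0)) => u yu; case: eqP => [ui|_]; last first.
    by rewrite expr0n expn_eq0 -leqn0 leqNgt q_gt0.
  by rewrite ui (oE _ _ (yS i)).
by rewrite !ffunE /= eqxx -yij eqxx.
Qed.

(** The tuples with x_i = x_j form a proper k-subspace W; for v outside W the
    cosets c v + W, for c in k, are disjoint. *)
Lemma card_frob_tuples_eq s i j : i != j ->
  (q * #|[set x in frob_tuples s | x i == x j]| <= #|frob_tuples s|)%N.
Proof.
move=> /(frob_tuples_sep s)[v vs vij].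
set W := [set x in frob_tuples s | _].
rewrite -cardsT -cardsX.
pose g (u : k * {ffun 'I_n -> E}) : {ffun 'I_n -> E} := [ffun l => io u.1 * v l + u.2 l].
have gI : {in finset.setX [set: k] W &, injective g}.
  move=> [c w] [c' w']; rewrite !inE /= => /andP[_ /eqP wij] /andP[_ /eqP wij'] e.
  have /ffunP eg := e; have ei := eg i; have ej := eg j; rewrite !ffunE /= in ei ej.
  have cc : c = c'.
    apply: (fmorph_inj io); apply/eqP; rewrite -subr_eq0.
    have : (io c - io c') * (v i - v j) == 0.
      have -> : (io c - io c') * (v i - v j)
          = (io c * v i + w i - (io c' * v i + w' i))
            - (io c * v j + w j - (io c' * v j + w' j)).
        by rewrite wij wij'; ring.
      by rewrite ei ej !subrr.
    by rewrite mulf_eq0 [_ - v j == _]subr_eq0 (negPf vij) orbF.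
  subst c'; congr (_, _); apply/ffunP => l; have := eg l; rewrite !ffunE /=.
  exact: addrI.
rewrite -(card_in_imset gI); apply: subset_leq_card.
apply/fintype.subsetP => _ /imsetP[[c w] cw ->]; move: cw; rewrite !inE /=.
move=> /andP[/forallP ws _]; apply/forallP => l; rewrite !ffunE /=.
rewrite (frobD io) exprMn -rmorphXn expf_card (eqP (ws l)).
by move: vs; rewrite inE => /forallP/(_ l)/eqP ->.
Qed.

(** The tuples that fail to be injective lie on at most n^2 proper subspaces. *)
Lemma card_frob_roots s :
  (q * q ^ n <= q * #|frob_roots s| + n ^ 2 * q ^ n)%N /\
  (#|frob_roots s| <= q ^ n)%N.
Proof.
rewrite -(card_frob_tuples s); split; last first.
  by apply: subset_leq_card; apply/fintype.subsetP => x; rewrite inE => /andP[].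
pose W (u : 'I_n * 'I_n) := [set x in frob_tuples s | x u.1 == x u.2].
have sub : frob_tuples s \subset frob_roots s :|: \bigcup_(u | u.1 != u.2) W u.
  apply/fintype.subsetP => x xs; rewrite finset.in_setU [x \in frob_roots s]inE xs /=.
  case: injectiveP => //= /injectiveP/injectivePn[i [j ij e]].
  by apply/finset.bigcupP; exists (i, j) => //; rewrite inE xs e /=.
have := subset_leq_card sub; move/(leq_mul (leqnn q)) => h.
apply: leq_trans h _; apply: leq_trans (leq_mul (leqnn q) (leq_card_setU _ _)) _.
rewrite mulnDr leq_add2l.
have hb : (#|\bigcup_(u | u.1 != u.2) W u| <= \sum_(u | u.1 != u.2) #|W u|)%N.
  elim/big_rec2: _ => [|u a b _ IH]; first by rewrite cards0.
  by apply: leq_trans (leq_card_setU _ _) _; rewrite leq_add2l.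
apply: leq_trans (leq_mul (leqnn q) hb) _.
rewrite big_distrr /=.
apply: (@leq_trans (\sum_(u : 'I_n * 'I_n | u.1 != u.2) #|frob_tuples s|)).
  by apply: leq_sum => u; exact: card_frob_tuples_eq.
rewrite sum_nat_const leq_mul2r; apply/orP; right.
by apply: leq_trans (max_card _) _; rewrite card_prod card_ord mulnn.
Qed.

End FrobeniusTuples.

(** * The Frobenius map and descent to the residue field *)

Section Frobenius.
Variables (k : finFieldType) (A : comNzRingType) (j : {rmorphism k -> A}).
Local Notation q := #|k|.

(** The morphism i makes this a ring morphism: it shows that A has the
    characteristic of k. *)
Definition frob (i : {rmorphism k -> A}) (x : A) : A := x ^+ q.
Local Notation frobj := (frob j).

Fact frob_is_nmod_morphism : nmod_morphism frobj.
Proof.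
split=> [|x y]; first by rewrite /frob expr0n -leqn0 leqNgt (q_gt0 k).
exact: (frobD j).
Qed.

Fact frob_is_monoid_morphism : monoid_morphism frobj.
Proof. by split=> [|x y]; rewrite /frob ?expr1n // exprMn. Qed.

HB.instance Definition _ := GRing.isNmodMorphism.Build A A frobj
  frob_is_nmod_morphism.
HB.instance Definition _ := GRing.isMonoidMorphism.Build A A frobj
  frob_is_monoid_morphism.

Lemma frob_emb c : frobj (j c) = j c.
Proof. by rewrite /frob -rmorphXn expf_card. Qed.

End Frobenius.

Section FrobeniusDescent.
Variables (k : finFieldType) (A : idomainType) (j : {rmorphism k -> A}).
Local Notation q := #|k|.

(** The polynomial X^q - X has at most q roots in A, and those coming from k are
    already q in number. *)
Lemma frob_fixed (y : A) : y ^+ q = y -> exists c, y = j c.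
Proof.
move=> yq; apply: contrapT => nex.
have P0 : 'X^q - 'X != 0 :> {poly A}.
  rewrite subr_eq0; apply/eqP => /(congr1 (fun P : {poly A} => size P)).
  by rewrite size_polyXn size_polyX => -[] e; have := q_gt1 k; rewrite e.
have rP (z : A) : z ^+ q = z -> root ('X^q - 'X) z.
  by move=> zq; rewrite /root hornerD hornerN hornerXn hornerX zq subrr.
have := @max_poly_roots _ _ (y :: [seq j c | c <- enum k]) P0.
rewrite /= rP // map_inj_uniq ?enum_uniq; last exact: fmorph_inj.
rewrite size_map -cardE andbT.
have -> : size ('X^q - 'X : {poly A}) = q.+1.
  by rewrite size_polyDl size_polyXn // size_polyN size_polyX ltnS q_gt1.
rewrite ltnn => h; apply: Bool.diff_false_true; apply: h.
  apply/allP => _ /mapP[c _ ->]; apply: rP.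
  exact: (frob_emb j c).
by apply/negP => /mapP[c _ yc]; apply: nex; exists c.
Qed.

Lemma frob_descent (P : {poly A}) :
  (forall i, P`_i ^+ q = P`_i) -> exists g, P = map_poly j g.
Proof.
move=> PE; have /choice[c cE] := fun i => frob_fixed (PE i).
exists (\poly_(i < size P) c i); apply/polyP => i.
rewrite coef_map coef_poly; case: ltnP => [_|le]; first exact: cE.
by rewrite nth_default //; apply/esym/rmorph0.
Qed.

Lemma frob_descent_prod n (r : 'I_n -> A) (s : 'S_n) :
  (forall i, r i ^+ q = r (s i)) ->
  exists g, \prod_i ('X - (r i)%:P) = map_poly j g.
Proof.
move=> rs; apply: frob_descent => i.
set P := \prod_i _; suff e : map_poly (frob j) P = P.
  by rewrite -{2}e coef_map.
rewrite rmorph_prod -[RHS](prod_XsubC_reindex r s); apply: eq_bigr => l _.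
by rewrite rmorphB /= map_polyX map_polyC /= /frob rs.
Qed.

End FrobeniusDescent.

(** * Counting polynomials by the cycle type of Frobenius *)

Section CountByCycleType.
Variables (n : nat) (k E : finFieldType) (io : {rmorphism k -> E}).
Local Notation q := #|k|.
Implicit Types s t : 'S_n.

Definition frob_polys (mu : seq nat) : {set n.-tuple k} :=
  [set c | [exists s : 'S_n, exists r : {ffun 'I_n -> E},
    [&& cycle_type s == mu, r \in frob_roots k E s
      & map_poly io (tuple_poly c) == \prod_i ('X - (r i)%:P)]]].

Lemma frob_rootsP s (r : {ffun 'I_n -> E}) :
  reflect (injective r /\ forall i, r i ^+ q = r (s i)) (r \in frob_roots k E s).
Proof.
apply: (iffP idP).
  rewrite !inE => /andP[/forallP rs /injectiveP rI]; split=> // i.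
  exact/eqP.
case=> rI rs; rewrite !inE; apply/andP; split; last exact/injectiveP.
by apply/forallP => i; rewrite rs.
Qed.

(** Count the injective Frobenius-compatible tuples with some permutation of type mu.
    The permutation is determined by the tuple, the product of the X - x_i descends
    to k, and every polynomial arises from the n! orderings of its roots. *)
Lemma card_frob_polys mu :
  (n`! * #|frob_polys mu| = \sum_(s in cycle_class n mu) #|frob_roots k E s|)%N.
Proof.
pose X := [set r : {ffun 'I_n -> E} |
  [exists s, (s \in cycle_class n mu) && (r \in frob_roots k E s)]].
have inX r : r \in X -> exists2 s, cycle_type s = mu & r \in frob_roots k E s.
  by rewrite inE => /existsP[s]; rewrite inE => /andP[/eqP sm rs]; exists s.
have -> : (\sum_(s in cycle_class n mu) #|frob_roots k E s| = #|X|)%N.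
  rewrite -sum1_card; under eq_bigr do rewrite -sum1_card.
  rewrite (exchange_big_dep (fun r => r \in X)) /=; last first.
    by move=> s r sC rs; rewrite inE; apply/existsP; exists s; rewrite sC.
  apply: eq_bigr => r /inX[s sm rs].
  rewrite (bigD1 s) /=; last by rewrite inE sm eqxx.
  rewrite big1 // => t /andP[/andP[_ rt]] /eqP ts; case: ts; apply/permP => i.
  have [rI rsE] := frob_rootsP _ _ rs; have [_ rtE] := frob_rootsP _ _ rt.
  by apply: rI; rewrite -rsE rtE.
pose m (c : n.-tuple k) (r : {ffun 'I_n -> E}) :=
  map_poly io (tuple_poly c) == \prod_i ('X - (r i)%:P).
have mI c d r : m c r -> m d r -> c = d.
  move=> /eqP ec /eqP ed; apply: tuple_poly_inj; apply: (map_poly_inj io).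
  by rewrite ec ed.
have mX r : r \in X -> exists2 c, m c r & c \in frob_polys mu.
  move=> /inX[s sm rs]; have [rI rsE] := frob_rootsP _ _ rs.
  have [g gE] := frob_descent_prod io rsE.
  have gm : g \is monic.
    by rewrite -(map_monic io) -gE; apply: monic_prod => i _; exact: monicXsubC.
  have sg : size g = n.+1.
    by rewrite -(size_map_poly io) -gE size_prod_XsubC /index_enum -enumT size_enum_ord.
  have [c cE] := tuple_polyP gm sg.
  have mc : m c r by rewrite /m -cE gE.
  exists c => //; rewrite inE.
  apply/existsP; exists s; apply/existsP; exists r.
  by rewrite sm eqxx rs; exact: mc.
pose F r := odflt (nseq_tuple n 0) [pick c | m c r].
have FE c r : m c r -> F r = c.
  move=> mc; rewrite /F; case: pickP => [d /= md|/(_ c)]; last by rewrite mc.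
  exact: (mI _ _ _ md mc).
rewrite -[in RHS]sum1_card (partition_big F (fun c => c \in frob_polys mu)) /=; last first.
  by move=> r /mX[c mc cS]; rewrite (FE _ _ mc).
rewrite mulnC -sum_nat_const; apply: eq_bigr => c cS.
have [r0 [s0 [s0m r0s0 mc0]]] : exists r0 s0,
    [/\ cycle_type s0 = mu, r0 \in frob_roots k E s0 & m c r0].
  move: cS; rewrite inE => /existsP[s0 /existsP[r0 /and3P[/eqP ? ? ?]]].
  by exists r0, s0.
have [r0I r0E] := frob_rootsP _ _ r0s0.
pose g (t : 'S_n) : {ffun 'I_n -> E} := [ffun i => r0 (t i)].
have gI : injective g.
  move=> t t' /ffunP e; apply/permP => i; apply: r0I.
  by have := e i; rewrite !ffunE.
rewrite sum1dep_card -[n`!](card_Sn n) -(card_imset _ gI).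
apply: eq_card => r; rewrite [RHS]inE; apply/imsetP/andP => [[t _ ->]|[rX /eqP rc]].
  have gs : g t \in frob_roots k E (s0 ^ t^-1)%g.
    apply/frob_rootsP; split=> [i i'|i]; first by rewrite !ffunE => /r0I/perm_inj.
    by rewrite !ffunE r0E conjgE invgK !permM permKV.
  have gX : g t \in X.
    rewrite inE; apply/existsP; exists (s0 ^ t^-1)%g; rewrite gs andbT inE.
    by rewrite cycle_typeJ s0m.
  split=> //; apply/eqP; apply: FE; rewrite /m (eqP mc0).
  rewrite -(prod_XsubC_reindex r0 t); apply/eqP/eq_bigr => i _.
  by rewrite ffunE.
have [d md _] := mX _ rX; have dc : d = c by rewrite -rc; exact/esym/FE.
rewrite dc in md; have [s _ rs] := inX _ rX; have [rI _] := frob_rootsP _ _ rs.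
have [t tE] : exists t : 'S_n, forall i, r i = r0 (t i).
  by apply: prod_XsubC_perm rI _; rewrite -(eqP md) (eqP mc0).
by exists t; rewrite ?inE //; apply/ffunP => i; rewrite ffunE.
Qed.

(** Over A the gcd is the product of the X - r_i with r_i^(q^e) = r_i. As it can be
    formed over k, the cycle type of Frobenius does not depend on the extension that
    contains the roots. *)
Lemma frob_fix_count (A : idomainType) (j : {rmorphism k -> A}) (g : {poly k})
    (r : 'I_n -> A) s e : (0 < e)%N -> injective r ->
  (forall i, r i ^+ q = r (s i)) -> map_poly j g = \prod_i ('X - (r i)%:P) ->
  #|[set i | (s ^+ e)%g i == i]| = (size (gcdp g ('X^(q ^ e) - 'X))).-1.
Proof.
move=> e0 rI rs gE; pose h : {poly k} := 'X^(q ^ e) - 'X.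
have rse i : r ((s ^+ e)%g i) = r i ^+ (q ^ e).
  elim: (e) => [|m IH]; first by rewrite perm1 expr1.
  by rewrite expgSr permM -rs IH expnSr exprM.
pose D := [set i | (s ^+ e)%g i == i].
have hj : map_poly j h = 'X^(q ^ e) - 'X by rewrite rmorphB /= map_polyXn map_polyX.
have rootD i : (i \in D) = root (map_poly j h) (r i).
  rewrite inE -(inj_eq rI) rse hj /root hornerD hornerN hornerXn hornerX.
  by rewrite subr_eq0.
rewrite -(size_map_poly j) gcdp_map.
suff /eqp_size -> : gcdp (map_poly j g) (map_poly j h) %= \prod_(i in D) ('X - (r i)%:P).
  by rewrite -big_enum /= size_prod_XsubC -cardE.
rewrite gE [\prod_i _](bigID (fun i => i \in D)) /=.
have cop : coprimep (map_poly j h) (\prod_(i | i \notin D) ('X - (r i)%:P)).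
  rewrite coprimep_sym; elim/big_rec: _ => [|i P iD IH]; first exact: coprime1p.
  by rewrite coprimepMl IH andbT coprimep_sym coprimep_XsubC -rootD.
have dvd : \prod_(i in D) ('X - (r i)%:P) %| map_poly j h.
  rewrite -big_enum /=; have := enum_uniq D.
  have : all (fun i => i \in D) (enum D) by apply/allP => i; rewrite mem_enum.
  elim: (enum D) => [|i l IH] /=; first by rewrite big_nil dvd1p.
  move=> /andP[iD lD] /andP[il ul]; rewrite big_cons Gauss_dvdp.
    by rewrite dvdp_XsubCl -rootD iD IH.
  rewrite coprimep_sym coprimep_XsubC /root horner_prod prodf_seq_neq0.
  apply/allP => i' i'l /=; rewrite hornerXsubC subr_eq0 (inj_eq rI).
  by apply: contraNneq il => ->.
rewrite coprimep_sym in cop.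
apply: eqp_trans (gcdpC _ _) _; rewrite coprimep_sym in cop.
by apply: eqp_trans (Gauss_gcdpl _ cop) _; apply: dvdp_gcd_idr.
Qed.

Lemma frob_cycle_type (A B : idomainType) (a : {rmorphism k -> A})
    (b : {rmorphism k -> B}) (g : {poly k}) (r : 'I_n -> A) (r' : 'I_n -> B) s t :
  injective r -> (forall i, r i ^+ q = r (s i)) ->
  map_poly a g = \prod_i ('X - (r i)%:P) ->
  injective r' -> (forall i, r' i ^+ q = r' (t i)) ->
  map_poly b g = \prod_i ('X - (r' i)%:P) -> cycle_type s = cycle_type t.
Proof.
move=> rI rs ga r'I r't gb; apply: eq_cycle_type_fix => e e0.
by rewrite (frob_fix_count e0 rI rs ga) (frob_fix_count e0 r'I r't gb).
Qed.

End CountByCycleType.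

(** * Polynomials that are not separable *)

Section SquarefreeDecomposition.
Variable k : fieldType.
Implicit Types f g h u : {poly k}.

Definition squarefree h := forall u, u \is monic -> u ^+ 2 %| h -> size u = 1.

Lemma monic_normalize u : u != 0 ->
  exists2 g, g \is monic & g %= u.
Proof.
move=> u0; exists ((lead_coef u)^-1 *: u).
  by rewrite monicE lead_coefZ mulVf ?lead_coef_eq0.
by rewrite eqp_scale // invr_eq0 lead_coef_eq0.
Qed.

Lemma monic_quot f u : f \is monic -> u \is monic -> u %| f -> f %/ u \is monic.
Proof.
by move=> fm um /divpK e; rewrite -(monicMr _ um) e.
Qed.

Lemma squarefree_decomposition f : f \is monic ->
  exists g h, [/\ g \is monic, h \is monic, squarefree h & f = g ^+ 2 * h].
Proof.
move: {2}(size f) (leqnn (size f)) => N; elim: N f => [|N IH] f.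
  by rewrite leqn0 size_poly_eq0 => /eqP -> /monic_neq0; rewrite eqxx.
move=> sf fm; have [sq|] := pselect (squarefree f).
  by exists 1, f; rewrite monic1 expr1n mul1r.
move/existsNP => [u /not_implyP[um /not_implyP[uf su]]].
have fE := divpK uf; set f' := f %/ _ in fE.
have f'm : f' \is monic by apply: monic_quot; rewrite ?monic_exp.
have u0 : u != 0 by exact: monic_neq0.
have [|g [h [gm hm hs f'E]]] := IH f' _ f'm.
  rewrite -ltnS; apply: leq_trans sf; rewrite -fE.
  rewrite size_Mmonic ?monic_exp ?(monic_neq0 f'm) // expr2 size_Mmonic //.
  have := size_poly_gt0 f'; have := size_poly_gt0 u; rewrite u0 (monic_neq0 f'm).
  by move/eqP: su; lia.
exists (u * g), h; split=> //; first by rewrite monicMl.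
by rewrite -fE f'E exprMn mulrC mulrA.
Qed.

(** Divide both square factors by their greatest common divisor: the cofactor a of
    the first one satisfies a^2 %| h', hence is constant. *)
Lemma squarefree_decomposition_unique g h g' h' :
  g \is monic -> h \is monic -> squarefree h ->
  g' \is monic -> h' \is monic -> squarefree h' ->
  g ^+ 2 * h = g' ^+ 2 * h' -> g = g' /\ h = h'.
Proof.
suff dv u v w z : u \is monic -> v \is monic -> squarefree z ->
    u ^+ 2 * w = v ^+ 2 * z -> u %| v.
  move=> gm hm hs gm' hm' hs' e.
  have gg : g = g'.
    apply/eqP; rewrite -eqp_monic //; apply/andP; split; first exact: dv e.
    exact: dv (esym e).
  split=> //; move: e; rewrite gg; apply: mulfI; by rewrite expf_neq0 ?monic_neq0.
move=> um vm zs e; pose d := gcdp u v.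
have d0 : d != 0 by rewrite gcdp_eq0 negb_and monic_neq0.
have uE := divpK (dvdp_gcdl u v); have vE := divpK (dvdp_gcdr u v).
set a := u %/ _ in uE; set b := v %/ _ in vE.
have cop : coprimep a b by rewrite coprimep_div_gcd // monic_neq0.
have aez : a ^+ 2 * w = b ^+ 2 * z.
  have {}e : (a * d) ^+ 2 * w = (b * d) ^+ 2 * z by rewrite uE vE.
  rewrite !exprMn in e.
  by apply: (mulIf (expf_neq0 2 d0)); rewrite mulrAC e mulrAC.
have az : a ^+ 2 %| z.
  rewrite -(@Gauss_dvdpr _ z (b ^+ 2)) -?aez ?dvdp_mulIl //.
  by rewrite coprimep_expl // coprimep_expr.
have a0 : a != 0 by apply: contraTneq (monic_neq0 um) => a0; rewrite -uE a0 mul0r eqxx.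
have [a' a'm a'a] := monic_normalize a0.
have sa : size a = 1.
  rewrite -(eqp_size a'a); apply: zs => //; apply: dvdp_trans az.
  by rewrite dvdp_exp2r // (eqp_dvdl _ a'a).
have /eqp_dvdl <- : d %= u; last exact: dvdp_gcdr.
have : 1 * d %= a * d by rewrite eqp_mulr // eqp_sym -size_poly_eq1 sa.
by rewrite mul1r uE.
Qed.

End SquarefreeDecomposition.

Section NonSeparable.
Variable k : finFieldType.
Implicit Types f g h u : {poly k}.
Local Notation q := #|k|.

(** Only exponents divisible by p survive, and k is perfect. *)
Lemma deriv0_pth_power p u : p \in [pchar k] -> u^`() = 0 -> exists w, u = w ^+ p.
Proof.
move=> pk u'; have p_pr := pcharf_prime pk; have p0 := prime_gt0 p_pr.
(* Roots of order p exist since x^q = x and p divides q. *)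
have [a aE] : exists a : k -> k, forall x, a x ^+ p = x.
  exists (fun x => x ^+ (q %/ p)) => x; rewrite -exprM divnK ?expf_card //.
  have := card_pprimeChar pk; rewrite /pPrimeCharType => ->.
  have := q_gt1 k; have := card_pprimeChar pk; rewrite /pPrimeCharType.
  by case: (logn p q) => [->//|l _ _]; rewrite expnS dvdn_mulr.
pose w := \poly_(i < size u) a u`_(i * p).
have pkx : p \in [pchar {poly k}] by rewrite pchar_poly.
exists w; rewrite /w poly_def -(pFrobenius_autE pkx) rmorph_sum /=.
apply/polyP => i; rewrite coef_sum.
under eq_bigr do rewrite pFrobenius_autE exprZn aE -exprM coefZ coefXn.
have [/dvdnP[j ->]|pi] := boolP (p %| i)%N; last first.
  rewrite big1 => [|j _]; last first.
    by rewrite (_ : (i == j * p)%N = false) ?mulr0 //; apply: contraNF pi => /eqP ->; rewrite dvdn_mull.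
  case: i pi => [|i] pi; first by rewrite dvdn0 in pi.
  have := coef_deriv u i; rewrite u' coef0 => /esym/eqP.
  by rewrite -mulr_natr mulf_eq0 -(dvdn_pcharf pk) (negPf pi) orbF => /eqP.
have [lt|ge] := ltnP j (size u); last first.
  rewrite nth_default; last by apply: leq_trans ge _; rewrite leq_pmulr.
  rewrite big1 // => l _; rewrite eqn_pmul2r // gtn_eqF ?mulr0 //.
  exact: leq_trans (ltn_ord l) ge.
rewrite (bigD1 (Ordinal lt)) //= eqxx mulr1 big1 ?addr0 // => l lj.
rewrite eqn_pmul2r //; case: eqP => [e|_]; last by rewrite mulr0.
by case/eqP: lj; apply: val_inj.
Qed.

Lemma nonseparable_square f : f \is monic -> ~~ separable_poly f ->
  exists g, [/\ g \is monic, (1 < size g)%N & g ^+ 2 %| f].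
Proof.
move=> fm nsep; have f0 := monic_neq0 fm.
suff [d sd df] : exists2 d : {poly k}, (1 < size d)%N & d ^+ 2 %| f.
  have d0 : d != 0 by rewrite -size_poly_gt0 ltnW.
  have [g gm gd] := monic_normalize d0; exists g; rewrite (eqp_size gd); split=> //.
  by apply: dvdp_trans df; rewrite dvdp_exp2r // (eqp_dvdl _ gd).
apply: contrapT => nsq; move/negP: nsep; apply; apply/separable_polyP; split.
  move=> u v uvf; apply/negPn/negP => ncop; apply: nsq; exists (gcdp u v).
    have uv0 : gcdp u v != 0.
      rewrite gcdp_eq0; apply: contraNN f0 => /andP[/eqP u0 _].
      by move: uvf; rewrite u0 mul0r dvd0p.
    by rewrite ltn_neqAle eq_sym size_poly_gt0 uv0 andbT.
  by apply: dvdp_trans uvf; rewrite expr2 dvdp_mul ?dvdp_gcdl ?dvdp_gcdr.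
move=> u uf su; apply/eqP => u'0; apply: nsq.
have [p p_pr pk] := finPcharP k; have [w uw] := deriv0_pth_power pk u'0.
have w1 : (1 < size w)%N.
  rewrite ltnNge; apply/negP => sw; move: su; rewrite uw.
  have [c ->] : exists c, w = c%:P by exists w`_0; exact: size1_polyC.
  by rewrite -rmorphXn /= ltnNge size_polyC leq_b1.
exists w => //; apply: dvdp_trans uf; rewrite uw.
by apply: dvdp_exp2l; exact: prime_gt1.
Qed.

(** Writing f = g^2 h with h squarefree and g = X g1 + c, the pair (g1^2 h, c)
    determines f. *)
Lemma card_nonseparable m :
  (#|[set c : m.+2.-tuple k | ~~ separable_poly (tuple_poly c)]| <= q ^ m.+1)%N.
Proof.
set B := [set c | _].
have dec (c : m.+2.-tuple k) : exists gh : {poly k} * {poly k}, c \in B ->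
    [/\ gh.1 \is monic, gh.2 \is monic, squarefree gh.2, (1 < size gh.1)%N
      & tuple_poly c = gh.1 ^+ 2 * gh.2].
  have [cB|] := boolP (c \in B); last by exists (0, 0).
  have cm := monic_tuple_poly c.
  have [g [h [gm hm hs e]]] := squarefree_decomposition cm.
  exists (g, h) => _; split=> //=; rewrite ltnNge; apply/negP => sg.
  have g1 : g = 1.
    have gc := size1_polyC sg; move: gm; rewrite gc monicE lead_coefC.
    by move=> /eqP ->.
  move: cB; rewrite inE => /(nonseparable_square cm)[u [um su]].
  by rewrite e g1 expr1n mul1r => /(hs _ um) su1; rewrite su1 in su.
have {dec} /choice[gh ghE] := dec.
pose g1 c := drop_poly 1 (gh c).1.
have gE c : (gh c).1 = g1 c * 'X + ((gh c).1`_0)%:P.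
  rewrite -[LHS](poly_take_drop 1) addrC expr1; congr (_ + _).
  by apply/polyP => i; rewrite coef_take_poly coefC; case: i.
have g1m c : c \in B -> g1 c \is monic /\ size (gh c).1 = (size (g1 c)).+1.
  move=> /ghE[gm _ _ sg _].
  have g10 : g1 c != 0.
    apply: contraTneq sg => g10; rewrite gE g10 mul0r add0r.
    by rewrite -leqNgt size_polyC leq_b1.
  have lt : (size ((gh c).1`_0)%:P < size (g1 c * 'X)%R)%N.
    by rewrite size_mulX // ltnS (leq_trans (size_polyC_leq1 _)) // size_poly_gt0.
  split; last by rewrite {1}gE size_polyDl // size_mulX.
  by move: gm; rewrite gE !monicE lead_coefDl // lead_coefMX.
have tl c : exists c' : m.-tuple k, c \in B -> tuple_poly c' = g1 c ^+ 2 * (gh c).2.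
  have [cB|] := boolP (c \in B); last by exists (nseq_tuple m 0).
  have [gm hm _ _ e] := ghE c cB; have [g1M sg] := g1m c cB.
  have : g1 c ^+ 2 * (gh c).2 \is monic by rewrite monicMl ?monic_exp.
  case/(@tuple_polyP _ m) => [|c' ->]; last by exists c'.
  have := size_tuple_poly c; rewrite e.
  have h0 := monic_neq0 hm; have g0 := monic_neq0 gm; have g10 := monic_neq0 g1M.
  rewrite !(size_Mmonic (expf_neq0 _ _)) // !expr2 !size_Mmonic // sg.
  have := size_poly_gt0 (gh c).2; have := size_poly_gt0 (g1 c).
  by rewrite h0 g10; move: (size (g1 c)) (size (gh c).2) => a b; lia.
have {tl} /choice[tl tlE] := tl.
pose phi c := (tl c, (gh c).1`_0).
have phiI : {in B &, injective phi}.
  move=> c d cB dB [e1 e2]; have [gm hm hs _ cE] := ghE c cB.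
  have [gm' hm' hs' _ dE] := ghE d dB.
  have [c1 _] := g1m c cB; have [d1 _] := g1m d dB.
  have := tlE c cB; rewrite e1 tlE //.
  move/(squarefree_decomposition_unique d1 hm' hs' c1 hm hs) => [eg eh].
  by apply: tuple_poly_inj; rewrite cE dE gE (gE d) eg eh e2.
rewrite -(card_in_imset phiI); apply: leq_trans (max_card _) _.
by rewrite card_prod card_tuple expnSr.
Qed.

End NonSeparable.

(** * Comparing group actions by their resolvents *)

Section FixedCoefficients.

(** The generic linear combination of the r_i: powers of the indeterminate serve as
    coefficients, so that it determines every r_i. *)
Definition gen_lin (A : nzRingType) n (r : 'I_n -> A) : {poly A} :=
  \sum_(i < n) r i *: 'X^i.

Lemma gen_linE (A : nzRingType) n (r : 'I_n -> A) (i : 'I_n) :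
  (gen_lin r)`_i = r i.
Proof.
rewrite coef_sum (bigD1 i) //= coefZ coefXn eqxx mulr1 big1 ?addr0 // => j ji.
by rewrite coefZ coefXn (inj_eq val_inj) eq_sym (negPf ji) mulr0.
Qed.

Lemma map_gen_lin (A B : nzRingType) (a : {rmorphism A -> B}) n (r : 'I_n -> A) :
  map_poly a (gen_lin r) = gen_lin (fun i => a (r i)).
Proof.
by rewrite rmorph_sum; apply: eq_bigr => i _; rewrite /= map_polyZ map_polyXn.
Qed.

Definition resolvent (A : nzRingType) n (J : finType) (b : J -> 'I_n -> A) :
    {poly {poly A}} := \prod_j ('X - (gen_lin (b j))%:P).

Lemma resolvent_fixed (A : comNzRingType) n (J : finType) (b : J -> 'I_n -> A)
    (a : {rmorphism A -> A}) (s : J -> J) :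
  injective s -> (forall j i, a (b j i) = b (s j) i) ->
  forall l m, a (resolvent b)`_l`_m = (resolvent b)`_l`_m.
Proof.
move=> sI ab l m.
suff e : map_poly (map_poly a) (resolvent b) = resolvent b.
  by rewrite -{2}e !coef_map.
rewrite rmorph_prod [RHS](reindex_inj sI); apply: eq_bigr => j _.
rewrite rmorphB /= map_polyX map_polyC /= map_gen_lin.
by congr ('X - (gen_lin _)%:P); apply/funext => i; rewrite ab.
Qed.

(** The coefficients of the resolvent are values of both a1 and a2, so it lifts to a
    polynomial F over A on which a1 and a2 agree. The generic combination of the r_i
    is a root of F because b_j0 comes from a1; applying a2 shows that the generic
    combination of the a2(r_i) is a root of the resolvent, that is, equal to the one
    of some b_j. *)
Lemma fixed_coefficients (A : comNzRingType) (B : idomainType)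
    (a1 a2 : {rmorphism A -> B}) n (r : 'I_n -> A) (J : finType)
    (b : J -> 'I_n -> B) (j0 : J) :
  injective a1 -> (forall i, b j0 i = a1 (r i)) ->
  (forall l m, exists x, a1 x = (resolvent b)`_l`_m /\ a2 x = (resolvent b)`_l`_m) ->
  exists j, forall i, a2 (r i) = b j i.
Proof.
move=> a1I b0 PE; set P := resolvent b in PE *.
have /choice[x xE] l : exists x, forall m, a1 (x m) = P`_l`_m /\ a2 (x m) = P`_l`_m.
  by have /choice[x ?] := PE l; exists x.
pose F : {poly {poly A}} := \poly_(l < size P) \poly_(m < size P`_l) x l m.
have FE (a : {rmorphism A -> B}) : (forall l m, a (x l m) = P`_l`_m) ->
    map_poly (map_poly a) F = P.
  move=> ax; apply/polyP => l; rewrite coef_map coef_poly.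
  case: ltnP => [_|le]; last by rewrite [RHS]nth_default //; apply: rmorph0.
  apply/polyP => m; rewrite coef_map coef_poly.
  case: ltnP => [_|le]; last by rewrite [RHS]nth_default //; apply: rmorph0.
  exact: ax.
have F1 := FE a1 (fun l m => (xE l m).1).
have F2 := FE a2 (fun l m => (xE l m).2).
have ev (a : {rmorphism A -> B}) (c : {poly A}) :
    map_poly a F.[c] = (map_poly (map_poly a) F).[map_poly a c].
  by rewrite horner_map.
have F0 : F.[gen_lin r] = 0.
  apply: (map_inj_poly a1I); first exact: rmorph0.
  rewrite rmorph0 ev F1 map_gen_lin /P /resolvent (bigD1 j0) //= hornerM.
  have -> : gen_lin (fun i => a1 (r i)) = gen_lin (b j0).
    by congr gen_lin; apply/funext => i; rewrite b0.
  by rewrite hornerXsubC subrr mul0r.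
have := ev a2 (gen_lin r); rewrite F0 rmorph0 F2 map_gen_lin /P /resolvent.
rewrite horner_prod => /esym/eqP/prodf_eq0[j _].
rewrite hornerXsubC subr_eq0 => /eqP e; exists j => i.
by have := congr1 (fun c : {poly B} => c`_i) e; rewrite !gen_linE.
Qed.

End FixedCoefficients.

(** * Galois groups acting on tuples *)

Section GaloisActions.
Variables (K : fieldType).
Hypothesis pchar0 : [pchar K] =i pred0.

Lemma galois_pchar0 (L : splittingFieldType K) : galois 1 {:L}.
Proof.
rewrite /galois sub1v normalFieldf andbT /=; apply/separableP => x _.
apply/negPn/negP => /separablePn_pchar[p pL _].
by have := pchar0 p; rewrite -(pchar_lalg L) pL.
Qed.

Lemma gal_alg (L : splittingFieldType K) (g : gal_of {:L}) c : g c%:A = c%:A.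
Proof. exact: rmorph_alg. Qed.

Lemma gal_full (L : splittingFieldType K) (g : gal_of {:L}) : g \in 'Gal({:L} / 1)%g.
Proof. by rewrite gal_kHom ?sub1v // k1AHom. Qed.

Lemma gal_fixed_alg (L : splittingFieldType K) (x : L) :
  (forall g : gal_of {:L}, g x = x) -> exists c, x = c%:A.
Proof.
move=> gx; have /galois_fixedField fE := galois_pchar0 L.
suff /vlineP : x \in 1%VS by [].
by rewrite -fE; apply/fixedFieldP; rewrite ?memvf.
Qed.

Lemma gal_resolvent_alg (L : splittingFieldType K) n (r : 'I_n -> L) l m :
  exists c, (resolvent (fun (g : gal_of {:L}) i => g (r i)))`_l`_m = c%:A.
Proof.
apply: gal_fixed_alg => h.
apply: (resolvent_fixed (s := fun g => (g * h)%g)) => [|g i]; first exact: mulIg.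
by rewrite galM ?memvf.
Qed.

(** The resolvent of a Galois orbit has coefficients in K, so it is fixed by the
    automorphisms of any other extension: this restricts and extends automorphisms
    along an embedding, as far as their effect on finitely many elements goes. *)
Lemma gal_restrict (L M : splittingFieldType K) (io : {rmorphism L -> M}) n
    (r : 'I_n -> L) (t : gal_of {:M}) : (forall c, io c%:A = c%:A) ->
  exists g : gal_of {:L}, forall i, t (io (r i)) = io (g (r i)).
Proof.
move=> ioA; pose b (g : gal_of {:L}) i := io (g (r i)).
have [|i|l m|g gE] := @fixed_coefficients _ _ io (t \o io) n r _ b 1%g.
- exact: fmorph_inj.
- by rewrite /b gal_id.
- have [c cE] := gal_resolvent_alg r l m; exists c%:A.
  have -> : (resolvent b)`_l`_m = c%:A.
    suff -> : resolvent b = map_poly (map_poly io)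
        (resolvent (fun (g : gal_of {:L}) i => g (r i))).
      by rewrite !coef_map cE; apply: ioA.
    rewrite rmorph_prod; apply: eq_bigr => g _.
    by rewrite rmorphB /= map_polyX map_polyC /= map_gen_lin.
  by rewrite /= ioA gal_alg.
by exists g.
Qed.

Lemma gal_extend (L M : splittingFieldType K) (io : {rmorphism L -> M}) n
    (r : 'I_n -> L) (g : gal_of {:L}) : (forall c, io c%:A = c%:A) ->
  exists t : gal_of {:M}, forall i, t (io (r i)) = io (g (r i)).
Proof.
move=> ioA; pose b (t : gal_of {:M}) i := t (io (r i)).
have [|i|l m|t tE] := @fixed_coefficients _ _ io (io \o g) n r _ b 1%g.
- exact: fmorph_inj.
- by rewrite /b gal_id.
- have [c cE] := gal_resolvent_alg (fun i => io (r i)) l m; exists c%:A.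
  by rewrite /= gal_alg !ioA -cE.
by exists t => i; apply/esym/tE.
Qed.

End GaloisActions.

Section PadicCharacteristic.
Variables (R : realType) (p : nat) (p_prime : prime p) (Q : padicField R p).
Variable K : fieldExtType Q.

Lemma padic_pchar0 : [pchar Q] =i pred0.
Proof.
apply/pcharf0P => m; apply/idP/eqP => [|-> //]; apply: contraTeq => m0.
apply/eqP => mQ; have := padic_norm_rat Q m%:R.
rewrite ratr_nat mQ; have /padic_norm_eq0 -> := erefl (0 : Q).
rewrite /padic_abs pnatr_eq0 (negPf m0) => /esym/eqP.
by rewrite mulf_eq0 invr_eq0 !expf_eq0 !pnatr_eq0 (gtn_eqF (prime_gt0 p_prime)) !andbF.
Qed.

Lemma padic_ext_pchar0 : [pchar K] =i pred0.
Proof. by move=> l; rewrite pchar_lalg padic_pchar0. Qed.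

End PadicCharacteristic.

Section RootPermutations.
Variables (R : realType) (p : nat) (p_prime : prime p) (Q : padicField R p).
Variable K : fieldExtType Q.
Let pchar0 := @padic_ext_pchar0 R p p_prime Q K.

Lemma root_permsP (L : splittingFieldType K) n (r : n.-tuple L) (s : 'S_n) :
  reflect (exists g : gal_of {:L}, forall i, g (tnth r i) = tnth r (s i))
    (s \in root_perms r).
Proof.
rewrite inE; apply: (iffP existsP) => [[g /andP[_ /forallP gE]]|[g gE]].
  by exists g => i; apply/eqP.
by exists g; rewrite gal_full /=; apply/forallP => i; rewrite gE.
Qed.

Lemma root_perms_map (L M : splittingFieldType K) (io : {rmorphism L -> M}) n
    (r : n.-tuple L) : (forall c, io c%:A = c%:A) ->
  root_perms (map_tuple io r) = root_perms r.
Proof.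
move=> ioA; apply/finset.setP => s; apply/root_permsP/root_permsP => -[g gE].
  have [t tE] := gal_restrict pchar0 (tnth r) g ioA.
  exists t => i; apply: (fmorph_inj io); rewrite -tE.
  by have := gE i; rewrite !tnth_map.
have [t tE] := gal_extend pchar0 (tnth r) g ioA.
by exists t => i; rewrite !tnth_map tE gE.
Qed.

Lemma root_perms_reindex (L : splittingFieldType K) n (r r' : n.-tuple L)
    (s : 'S_n) : (forall i, tnth r i = tnth r' (s i)) ->
  root_perms r = (root_perms r' :^ s^-1)%g.
Proof.
move=> rE; apply/finset.setP => t; rewrite mem_conjg invgK.
apply/root_permsP/root_permsP => -[g gE]; exists g => i.
  have := gE ((s^-1)%g i); rewrite !rE permKV => ->.
  by rewrite conjgE !permM.
have := gE (s i); rewrite -rE => ->.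
by rewrite conjgE !permM permK -rE.
Qed.

End RootPermutations.

Section ConjClass.
Variable n : nat.
Implicit Types A B G : {set 'S_n}.

Lemma mem_conj_class A : A \in conj_class A.
Proof. by apply/imsetP; exists 1%g; rewrite ?inE // conjsg1. Qed.

Lemma conj_class_eq A G : A \in conj_class G -> conj_class A = conj_class G.
Proof.
move=> /imsetP[x _ ->]; apply/finset.setP => B; apply/imsetP/imsetP => -[y _ ->].
  by exists (x * y)%g; rewrite ?inE // conjsgM.
by exists (x^-1 * y)%g; rewrite ?inE // conjsgM conjsgK.
Qed.

Lemma conj_classJ A x : conj_class (A :^ x)%g = conj_class A.
Proof. by apply: conj_class_eq; apply/imsetP; exists x; rewrite ?inE. Qed.

End ConjClass.

(** * Splitting fields and common extensions *)

Section SplittingFields.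

Lemma irreducible_factor (F : fieldType) (g : {poly F}) :
  (1 < size g)%N -> exists2 u, u %| g & irreducible_poly u.
Proof.
move: {2}(size g) (leqnn (size g)) => N; elim: N g => [|N IH] g.
  by rewrite leqn0 => /eqP ->.
move=> gN g1; have [irr|] := pselect (irreducible_poly g); first by exists g.
move/not_andP => [//|/existsNP[u /not_implyP[su /not_implyP[ug nug]]]].
have g0 : g != 0 by rewrite -size_poly_gt0 ltnW.
have u0 : u != 0 by apply: contraTneq ug => ->; rewrite dvd0p.
have lt : (size u < size g)%N.
  by rewrite ltn_neqAle dvdp_leq // andbT dvdp_size_eqp //; apply/negP.
have [||w wu irr] := IH u; first by rewrite -ltnS (leq_trans lt).
  by rewrite ltn_neqAle eq_sym su size_poly_gt0.
by exists w => //; apply: dvdp_trans ug.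
Qed.

Lemma exists_split_ext N (F : fieldType) (g : {poly F}) :
  (size g <= N)%N -> g != 0 -> exists (L : fieldExtType F) (zs : seq L),
    map_poly (in_alg L) g %= \prod_(z <- zs) ('X - z%:P).
Proof.
elim: N F g => [|N IH] F g; first by rewrite leqn0 size_poly_eq0 => ->.
move=> gN g0; have [g1|g1] := leqP (size g) 1.
  exists F^o, [::]; rewrite big_nil -size_poly_eq1 size_map_poly.
  by rewrite eqn_leq g1 size_poly_gt0.
have [u ug irr] := irreducible_factor g1.
have [F1 _ [x ux _]] := irredp_FAdjoin irr.
have : root (map_poly (in_alg F1) g) x.
  by rewrite -(divpK ug) rmorphM rootM ux orbT.
move=> /factor_theorem[w gE].
have w0 : w != 0.
  by apply: contraNneq g0 => w0; move: gE; rewrite w0 mul0r => /eqP; rewrite map_poly_eq0.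
have [|//|L [zs wE]] := IH F1 w.
  have := size_map_poly (in_alg F1) g; rewrite gE size_mul ?polyXsubC_eq0 // size_XsubC.
  by rewrite addn2 /= => e; rewrite -ltnS e.
exists (baseFieldType L), (x%:A :: zs).
have -> : map_poly (in_alg (baseFieldType L)) g
    = map_poly (in_alg L) (map_poly (in_alg F1) g).
  rewrite -map_poly_comp; apply: eq_map_poly => a /=.
  exact: baseField_scaleE.
rewrite gE rmorphM big_cons mulrC /= rmorphB /= map_polyX map_polyC /=.
by rewrite eqp_mull.
Qed.

(** Cut an extension that splits g down to the subfield generated by the roots. *)
Lemma exists_splitting_field (F : fieldType) (g : {poly F}) : g != 0 ->
  exists L : splittingFieldType F, splittingFieldFor 1 (map_poly (in_alg L) g) {:L}.
Proof.
move=> g0; have [L [zs gE]] := exists_split_ext (leqnn (size g)) g0.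
pose M := subvs_of <<1 & zs>>; pose toL := linfun (vsval : M -> L).
pose zM := [seq vsproj <<1 & zs>> z | z <- zs].
have zME : [seq toL z | z <- zM] = zs.
  rewrite -map_comp map_id_in // => z zz /=.
  by rewrite lfunE /= vsprojK // seqv_sub_adjoin.
have split : splittingFieldFor 1 (map_poly (in_alg M) g) {:M}.
  exists zM.
    set lhs := (X in X %= _); set rhs := (X in _ %= X).
    suff : map_poly toL lhs %= map_poly toL rhs by rewrite eqp_map.
    have -> : map_poly toL lhs = map_poly (in_alg L) g.
      by rewrite -map_poly_comp; apply: eq_map_poly => a; apply: rmorph_alg.
    have -> // : map_poly toL rhs = \prod_(z <- zs) ('X - z%:P).
    rewrite -[in RHS]zME big_map rmorph_prod; apply: eq_bigr => z _.
    by rewrite rmorphB /= map_polyX map_polyC.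
  apply/vspaceP => u; rewrite memvf.
  have : vsval u \in (toL @: <<1 & zM>>)%VS.
    by rewrite aimg_adjoin_seq aimg1 zME subvsP.
  by case/memv_imgP => v vM; rewrite lfunE => /val_inj ->.
have ax : splitting_field_axiom M.
  by exists (map_poly (in_alg M) g) => //; apply/polyOver1P; exists g.
pose mM := FieldExt_isSplittingField.Build F M ax.
pose S : splittingFieldType F := HB.pack M mM.
by exists S.
Qed.

(** Sending u(x) to u(y), for u over F, is well defined since g divides every
    polynomial that vanishes at x. *)
Lemma embed_primitive (F : fieldType) (L M : fieldExtType F) (x : L) (y : M)
    (g : {poly F}) : <<1; x>>%VS = fullv -> minPoly 1 x = map_poly (in_alg L) g ->
  root (map_poly (in_alg M) g) y ->
  exists io : {rmorphism L -> M}, forall c, io c%:A = c%:A.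
Proof.
move=> xL gE gy.
have ev (u v : {poly F}) : (map_poly (in_alg L) u).[x] = (map_poly (in_alg L) v).[x] ->
    (map_poly (in_alg M) u).[y] = (map_poly (in_alg M) v).[y].
  move=> e; apply/eqP; rewrite -subr_eq0 -hornerN -hornerD -rmorphB.
  have : map_poly (in_alg L) g %| map_poly (in_alg L) (u - v).
    rewrite -gE; apply: minPoly_dvdp; first by apply/polyOver1P; exists (u - v).
    by rewrite /root rmorphB hornerD hornerN e subrr.
  rewrite dvdp_map => /dvdpP[w ->].
  by rewrite rmorphM hornerM (eqP gy) mulr0.
have /choice[P PE] (z : L) : exists u, z = (map_poly (in_alg L) u).[x].
  have : z \in <<1; x>>%VS by rewrite xL memvf.
  by move/Fadjoin_polyP => [u /polyOver1P[w ->] ->]; exists w.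
pose io z := (map_poly (in_alg M) (P z)).[y].
have ioA c : io c%:A = c%:A.
  have e : (map_poly (in_alg L) (P c%:A)).[x] = (map_poly (in_alg L) c%:P).[x].
    by rewrite -PE map_polyC hornerC.
  by rewrite /io (ev _ _ e) map_polyC hornerC.
have ioB : nmod_morphism io.
  split=> [|u v].
    by have := ioA 0; rewrite !scale0r.
  rewrite /io -hornerD -rmorphD; apply: ev.
  by rewrite -PE rmorphD hornerD -!PE.
have ioM : monoid_morphism io.
  split=> [|u v].
    by have := ioA 1; rewrite !scale1r.
  rewrite /io -hornerM -rmorphM; apply: ev.
  by rewrite -PE rmorphM hornerM -!PE.
pose m1 := GRing.isNmodMorphism.Build _ _ io ioB.
pose m2 := GRing.isMonoidMorphism.Build _ _ io ioM.
pose f : {rmorphism L -> M} := HB.pack io m1 m2.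
by exists f.
Qed.

(** Both fields are generated by one element; split the product of the two minimal
    polynomials. *)
Lemma common_extension (F : fieldType) (L1 L2 : splittingFieldType F) :
  [pchar F] =i pred0 ->
  exists (M : splittingFieldType F) (i1 : {rmorphism L1 -> M}) (i2 : {rmorphism L2 -> M}),
    (forall c, i1 c%:A = c%:A) /\ (forall c, i2 c%:A = c%:A).
Proof.
move=> pchar0.
have prim (L : splittingFieldType F) : exists (x : L) (g : {poly F}),
    [/\ <<1; x>>%VS = fullv, minPoly 1 x = map_poly (in_alg L) g & (1 < size g)%N].
  have /and3P[_ sep _] := galois_pchar0 pchar0 L.
  pose x := separable_generator 1 {:L}.
  have /polyOver1P[g gE] := minPolyOver 1 x.
  exists x, g; split=> //; first by rewrite -eq_adjoin_separable_generator ?sub1v.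
  by rewrite -(size_map_poly (in_alg L)) -gE size_minPoly ltnS adjoin_degreeE divn_gt0 ?dimvS ?subv_adjoin // dimv1.
have [x1 [g1 [x1L g1E s1]]] := prim L1; have [x2 [g2 [x2L g2E s2]]] := prim L2.
have g0 : g1 * g2 != 0 by rewrite mulf_neq0 // -size_poly_gt0 ltnW.
have [M [zs gE _]] := exists_splitting_field g0.
have emb (L : splittingFieldType F) (x : L) (g : {poly F}) : <<1; x>>%VS = fullv ->
    minPoly 1 x = map_poly (in_alg L) g -> (1 < size g)%N -> g %| g1 * g2 ->
    exists io : {rmorphism L -> M}, forall c, io c%:A = c%:A.
  move=> xL gxE sg gd.
  have : map_poly (in_alg M) g %| \prod_(z <- zs) ('X - z%:P).
    by rewrite -(eqp_dvdr _ gE) dvdp_map.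
  move=> /dvdp_prod_XsubC[m mE].
  case em: (mask m zs) mE => [|z s] mE.
    move: sg; rewrite -(size_map_poly (in_alg M)) (eqp_size mE) big_nil size_poly1.
    by [].
  apply: (embed_primitive (y := z) xL gxE); rewrite (eqp_root mE).
  by rewrite root_prod_XsubC inE eqxx.
have [i1 i1A] := emb L1 x1 g1 x1L g1E s1 (dvdp_mulr _ (dvdpp _)).
have [i2 i2A] := emb L2 x2 g2 x2L g2E s2 (dvdp_mull _ (dvdpp _)).
by exists M, i1, i2.
Qed.

End SplittingFields.

(** * The Galois group of a polynomial over K *)

Section GaloisGroupOfPolynomial.
Variables (R : realType) (p : nat) (p_prime : prime p) (Q : padicField R p).
Variable K : fieldExtType Q.
Let pchar0 := @padic_ext_pchar0 R p p_prime Q K.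

Lemma exists_splitting_roots n (f : {poly K}) : f \is monic -> size f = n.+1 ->
  exists (L : splittingFieldType K) (r : n.-tuple L),
    let fL := map_poly (in_alg L) f in
    fL = \prod_(i < n) ('X - (tnth r i)%:P) /\ splittingFieldFor 1 fL {:L}.
Proof.
move=> fm sf; have [L fL] := exists_splitting_field (monic_neq0 fm).
have [zs zsE _] := fL.
have e : map_poly (in_alg L) f = \prod_(z <- zs) ('X - z%:P).
  by apply/eqP; rewrite -eqp_monic ?map_monic // monic_prod_XsubC.
have szs : size zs == n.
  by rewrite -eqSS -(size_prod_XsubC _ id) -e size_map_poly sf.
exists L, (Tuple szs); split=> //.
by rewrite e -(big_tuple _ _ (Tuple szs) xpredT (fun z => 'X - z%:P)).
Qed.

Lemma uniq_separable_roots n (L : fieldExtType K) (f : {poly K}) (r : n.-tuple L) :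
  map_poly (in_alg L) f = \prod_(i < n) ('X - (tnth r i)%:P) ->
  uniq r = separable_poly f.
Proof.
move=> e; rewrite -(separable_map (in_alg L)) e.
by rewrite -(big_tuple _ _ r xpredT (fun z => 'X - z%:P)) separable_prod_XsubC.
Qed.

Lemma gal_permutes_roots n (L : splittingFieldType K) (f : {poly K}) (r : 'I_n -> L)
    (g : gal_of {:L}) : injective r ->
  map_poly (in_alg L) f = \prod_i ('X - (r i)%:P) ->
  exists t : 'S_n, forall i, g (r i) = r (t i).
Proof.
move=> rI e; apply: (@prod_XsubC_perm L n (g \o r) r).
  by move=> i i' /fmorph_inj/rI.
transitivity (map_poly g (\prod_i ('X - (r i)%:P))).
  rewrite rmorph_prod; apply: eq_bigr => i _.
  by rewrite rmorphB /= map_polyX map_polyC.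
rewrite -e -map_poly_comp; apply: eq_map_poly => c; exact: rmorph_alg.
Qed.

(** In a common extension the two root systems differ by a permutation, which
    conjugates the two groups. *)
Lemma has_galois_group_conj n (f : {poly K}) (A B : {set 'S_n}) :
  has_galois_group f A -> has_galois_group f B -> conj_class A = conj_class B.
Proof.
case=> L1 [r1 [f1 u1 _ rA]] [L2 [r2 [f2 u2 _ rB]]].
rewrite -(conj_class_eq rA) -(conj_class_eq rB).
have [M [i1 [i2 [i1A i2A]]]] := common_extension L1 L2 pchar0.
have fM (L : splittingFieldType K) (io : {rmorphism L -> M}) (r : n.-tuple L) :
    (forall c, io c%:A = c%:A) ->
    map_poly (in_alg L) f = \prod_(i < n) ('X - (tnth r i)%:P) ->
    map_poly (in_alg M) f = \prod_(i < n) ('X - (tnth (map_tuple io r) i)%:P).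
  move=> ioA fE; have -> : map_poly (in_alg M) f = map_poly io (map_poly (in_alg L) f).
    by rewrite -map_poly_comp; apply: eq_map_poly => a; exact/esym/ioA.
  rewrite fE rmorph_prod; apply: eq_bigr => i _.
  by rewrite rmorphB /= map_polyX map_polyC tnth_map.
have inj1 : injective (tnth (map_tuple i1 r1)).
  by apply/tuple_uniqP; rewrite map_inj_uniq //; exact: fmorph_inj.
have e := etrans (esym (fM _ _ _ i1A f1)) (fM _ _ _ i2A f2).
have [s sE] := prod_XsubC_perm inj1 e.
rewrite -(root_perms_map p_prime r1 i1A) -(root_perms_map p_prime r2 i2A).
by rewrite (root_perms_reindex sE) conj_classJ.
Qed.

End GaloisGroupOfPolynomial.

(** * Hensel's lemma over the p-adic numbers *)

Section Hensel.
Variables (R : realType) (p : nat) (Q : padicField R p).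
Local Notation N := (@padic_norm R p Q).
Implicit Types (x y : Q) (d e : R) (g h u v w : {poly Q}).

Lemma padic_norm0 : N 0 = 0. Proof. exact/padic_norm_eq0. Qed.

Lemma padic_normB x y : N (x - y) <= Num.max (N x) (N y).
Proof. by rewrite -(padic_normN y); exact: padic_normD. Qed.

Lemma padic_normV x : N x^-1 = (N x)^-1.
Proof.
have [->|x0] := eqVneq x 0; first by rewrite invr0 padic_norm0 invr0.
have nx : N x != 0 by apply: contra_neq x0 => /padic_norm_eq0.
by apply: (mulIf nx); rewrite -padic_normM !mulVf // padic_norm1.
Qed.

Lemma padic_normX x n : N (x ^+ n) = N x ^+ n.
Proof. by elim: n => [|n IH]; rewrite ?padic_norm1 // !exprS padic_normM IH. Qed.

Lemma padic_norm_le_add d x y : N x <= d -> N y <= d -> N (x + y) <= d.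
Proof. by move=> xd yd; apply: le_trans (padic_normD _ _) _; rewrite ge_max xd. Qed.

Lemma padic_norm_le_sub d x y : N x <= d -> N y <= d -> N (x - y) <= d.
Proof. by move=> xd yd; apply: padic_norm_le_add => //; rewrite padic_normN. Qed.

Lemma padic_norm_le_sum d (I : Type) (s : seq I) (P : pred I) (F : I -> Q) :
  0 <= d -> (forall i, P i -> N (F i) <= d) -> N (\sum_(i <- s | P i) F i) <= d.
Proof.
move=> d0 Fd; elim/big_ind: _ => [|x y|i]; first by rewrite padic_norm0.
  exact: padic_norm_le_add.
exact: Fd.
Qed.

Lemma expr_small e d : 0 <= e < 1 -> 0 < d -> exists k, e ^+ k < d.
Proof.
move=> /andP[e0 e1] d0.
have /cvgrPdist_lt/(_ d d0) : ((fun k => e ^+ k) @ \oo --> (0 : R))%classic.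
  by apply: cvg_expr; rewrite ger0_norm.
case=> k _ /(_ k (leqnn k)); rewrite sub0r normrN ger0_norm ?exprn_ge0 //.
by exists k.
Qed.

Lemma padic_norm_le0 e x : 0 <= e < 1 -> (forall k, N x <= e ^+ k) -> x = 0.
Proof.
move=> e01 xe; apply/padic_norm_eq0/eqP; rewrite eq_le padic_norm_ge0 andbT leNgt.
apply/negP => x0; have [k] := expr_small e01 x0.
by rewrite ltNge xe.
Qed.

Lemma padic_limit e (a : nat -> Q) : 0 <= e < 1 ->
  (forall k, N (a k.+1 - a k) <= e ^+ k) ->
  exists x, forall k, N (a k - x) <= e ^+ k.
Proof.
move=> e01 ae; have /andP[e0 e1] := e01.
have aD k m : N (a (k + m)%N - a k) <= e ^+ k.
  elim: m => [|m IH]; first by rewrite addn0 subrr padic_norm0 exprn_ge0.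
  rewrite -(subrKA (a (k + m)%N)) addnS; apply: padic_norm_le_add => //.
  by apply: le_trans (ae _) _; rewrite exprD ler_piMr ?exprn_ge0 // exprn_ile1 // ltW.
have [|x xE] := @padic_complete _ _ Q a.
  move=> d d0; have [k kd] := expr_small e01 d0; exists k => i j ki kj.
  apply: le_lt_trans kd; rewrite -(subrKA (a k)) -(opprB (a j)).
  by apply: padic_norm_le_sub; [rewrite -(subnKC ki)|rewrite -(subnKC kj)]; apply: aD.
exists x => k; rewrite leNgt; apply/negP => kx.
have [|m mE] := xE (N (a k - x)); first by apply: le_lt_trans kx; rewrite exprn_ge0.
have := mE (k + m)%N (leq_addl _ _); set b := a (k + m)%N => bx.
have : N (a k - x) <= Num.max (N (b - x)) (N (b - a k)).
  have -> : a k - x = (b - x) - (b - a k) by ring.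
  exact: padic_normB.
rewrite leNgt => /negP; apply; rewrite gt_max bx /=.
by apply: le_lt_trans kx; apply: aD.
Qed.


Definition bounded_poly d g := forall i, N g`_i <= d.

Lemma bounded_polyD d g h : bounded_poly d g -> bounded_poly d h -> bounded_poly d (g + h).
Proof. by move=> gd hd i; rewrite coefD padic_norm_le_add. Qed.

Lemma bounded_polyB d g h : bounded_poly d g -> bounded_poly d h -> bounded_poly d (g - h).
Proof. by move=> gd hd i; rewrite coefB padic_norm_le_sub. Qed.

Lemma bounded_polyM d e g h : 0 <= d -> 0 <= e ->
  bounded_poly d g -> bounded_poly e h -> bounded_poly (d * e) (g * h).
Proof.
move=> d0 e0 gd he i; rewrite coefM; apply: padic_norm_le_sum => [|j _].
  exact: mulr_ge0.
by rewrite padic_normM ler_pM ?padic_norm_ge0.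
Qed.

Lemma bounded_poly_le d e g : d <= e -> bounded_poly d g -> bounded_poly e g.
Proof. by move=> de gd i; apply: le_trans (gd i) de. Qed.

(** In the division algorithm the multiples of u are only scaled by leading
    coefficients of the successive dividends, so no coefficient grows. *)
Lemma bounded_poly_div i u g m : size u = i.+1 -> u`_i = 1 -> bounded_poly 1 u ->
  (size g <= m)%N -> exists w v,
  [/\ g = u * w + v, (size v <= i)%N, (size w <= m - i)%N
    & forall d, 0 <= d -> bounded_poly d g -> bounded_poly d w /\ bounded_poly d v].
Proof.
move=> su ui ub; elim: m g => [|m IH] g gm.
  exists 0, 0; move: gm; rewrite leqn0 size_poly_eq0 => /eqP ->.
  by rewrite mulr0 addr0 size_poly0; split=> // d d0 _; split=> j; rewrite coef0 padic_norm0.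
have [mi|im] := ltnP m i.
  exists 0, g; rewrite mulr0 add0r size_poly0; split=> //; first exact: leq_trans gm mi.
  by move=> d d0 gd; split=> // j; rewrite coef0 padic_norm0.
pose t := g`_m *: 'X^(m - i); have ts : (size t <= m.+1 - i)%N.
  by apply: leq_trans (size_scale_leq _ _) _; rewrite size_polyXn subSn.
have tb d : 0 <= d -> bounded_poly d g -> bounded_poly d t.
  move=> d0 gd j; rewrite coefZ coefXn; case: eqP => _; rewrite ?mulr1 ?mulr0 //.
  by rewrite padic_norm0.
have [|w [v [e sv sw wb]]] := IH (g - u * t).
  apply/leq_sizeP => j mj; rewrite coefB /t -scalerAr coefZ coefMXn.
  rewrite ltnNge (leq_trans (leq_subr _ _) mj) /=.
  have [jm|jm] := eqVneq j m; first by rewrite jm subKn // ui mulr1 subrr.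
  have mj' : (m < j)%N by rewrite ltn_neqAle eq_sym jm.
  have gj : g`_j = 0 by rewrite nth_default // (leq_trans gm).
  have uj : u`_(j - (m - i)) = 0 by rewrite nth_default // su; move: mj' im; lia.
  by rewrite gj uj mulr0 subrr.
exists (t + w), v; split=> //.
- by rewrite mulrDr -addrA -e addrC subrK.
- apply: leq_trans (size_polyD _ _) _; rewrite geq_max ts.
  by apply: leq_trans sw _; rewrite leq_sub2r.
move=> d d0 gd; have [|wd vd] := wb d d0; last first.
  by split=> //; apply: bounded_polyD => //; exact: tb.
apply: bounded_polyB => //; rewrite -[d]mul1r; apply: bounded_polyM => //.
exact: tb.
Qed.

(** Hensel's lemma for a polynomial whose reduction has smaller degree i: the
    Newton iteration (u, v) |-> (u + t, v + w), where g - u v = u w + t, splits off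
    a monic factor of degree i. *)
Lemma hensel_factor g i e : 0 <= e < 1 -> (i.+1 < size g)%N ->
  bounded_poly 1 g -> g`_i = 1 -> (forall j, (i < j)%N -> N g`_j <= e) ->
  exists u v, [/\ g = u * v, size u = i.+1 & u`_i = 1].
Proof.
move=> e01 ig g1 gi ge; have /andP[e0 e1] := e01.
have e1' := ltW e1.
pose D := size g.
(* Along the iteration v stays within e of 1, so that the new error t (1 - v - w) is
   smaller than the old one by a factor e. *)
pose Inv d (uv : {poly Q} * {poly Q}) :=
  [/\ size uv.1 = i.+1 /\ uv.1`_i = 1, bounded_poly 1 uv.1, (size uv.2 <= D)%N,
      bounded_poly e (uv.2 - 1) & bounded_poly d (g - uv.1 * uv.2)].
have /choice[next nextE] (uv : {poly Q} * {poly Q}) : exists uv' : {poly Q} * {poly Q},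
    forall d, 0 <= d <= e -> Inv d uv ->
      [/\ Inv (d * e) uv', bounded_poly d (uv'.1 - uv.1) & bounded_poly d (uv'.2 - uv.2)].
  case: uv => u v; have [[su ui ub sv]|ninv] := pselect
    [/\ size u = i.+1, u`_i = 1, bounded_poly 1 u & (size v <= D)%N]; last first.
    by exists (u, v) => d _ [[? ?] ? ? _ _]; case: ninv.
  have sr : (size (g - u * v)%R <= i + D)%N.
    apply: leq_trans (size_polyD _ _) _; rewrite size_polyN geq_max leq_addl /=.
    by apply: leq_trans (size_polyMleq _ _) _; rewrite su addSn /= leq_add2l.
  have [w [t [tE st sw wb]]] := bounded_poly_div su ui ub sr.
  exists (u + t, v + w) => d /andP[d0 de] [/= _ _ _ vb rb].
  have [wd td] := wb d d0 rb.
  have d1 := le_trans de e1'.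
  have uE : u + t - u = t by ring.
  have vE : v + w - v = w by ring.
  split=> /=; rewrite ?uE ?vE //; split=> /=.
  - have tl : (size t < size u)%N by rewrite su ltnS.
    by rewrite size_polyDl // coefD ui nth_default // addr0.
  - by apply: bounded_polyD => //; apply: bounded_poly_le td.
  - apply: leq_trans (size_polyD _ _) _; rewrite geq_max sv.
    by apply: leq_trans sw _; rewrite addKn.
  - rewrite addrAC; apply: bounded_polyD => //; exact: bounded_poly_le wd.
  have -> : g - (u + t) * (v + w) = t * (1 - v - w).
    have -> : g = u * v + (u * w + t) by rewrite -tE addrC subrK.
    by ring.
  apply: bounded_polyM => //; apply: bounded_polyB; last exact: bounded_poly_le wd.
  by rewrite -opprB => j; rewrite coefN padic_normN.
pose s k := iter k next (\poly_(j < i.+1) g`_j, 1).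
have sI k : Inv (e ^+ k.+1) (s k) /\ bounded_poly (e ^+ k) ((s k.+1).1 - (s k).1)
    /\ bounded_poly (e ^+ k) ((s k.+1).2 - (s k).2).
  have ek m : 0 <= e ^+ m.+1 <= e.
    by rewrite exprn_ge0 //= exprS ler_piMr // exprn_ile1.
  have le m : e ^+ m.+1 <= e ^+ m by rewrite exprS ler_piMl ?exprn_ge0.
  suff IV : Inv (e ^+ k.+1) (s k).
    split=> //; have [_ h1 h2] := nextE (s k) _ (ek k) IV.
    by split; apply: bounded_poly_le (le k) _.
  elim: k => [|k IH]; last first.
    by rewrite exprSr; have [] := nextE (s k) _ (ek k) IH.
  split=> /=.
  - split; last by rewrite coef_poly ltnSn.
    by apply: size_poly_eq; rewrite gi oner_neq0.
  - by move=> j; rewrite coef_poly; case: ifP => // _; rewrite padic_norm0 ler01.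
  - by rewrite size_poly1; apply: leq_trans ig.
  - by move=> j; rewrite subrr coef0 padic_norm0.
  move=> j; rewrite mulr1 coefB coef_poly expr1; case: ltnP => [_|ij].
    by rewrite subrr padic_norm0.
  by rewrite subr0; apply: ge.
have lim (c : nat -> {poly Q}) n : (forall k, size (c k) <= n)%N ->
    (forall k, bounded_poly (e ^+ k) (c k.+1 - c k)) ->
    exists C : {poly Q}, forall k, bounded_poly (e ^+ k) (c k - C).
  move=> cn cb; have /choice[x xE] j : exists x, forall k, N ((c k)`_j - x) <= e ^+ k.
    by apply: padic_limit => // k; rewrite -coefB; exact: cb.
  exists (\poly_(j < n) x j) => k j; rewrite coefB coef_poly; case: ltnP => [_|nj].
    exact: xE.
  by rewrite nth_default ?(leq_trans (cn k)) // subrr padic_norm0 exprn_ge0.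
have [|k|u uE] := lim (fun k => (s k).1) i.+1.
- by move=> k; have [[[-> _] _ _ _ _] _] := sI k.
- by have [_ []] := sI k.
have [|k|v vE] := lim (fun k => (s k).2) D.
- by move=> k; have [[_ _ sv _ _] _] := sI k.
- by have [_ []] := sI k.
have coefE (x : Q) j (c : nat -> {poly Q}) (C : {poly Q}) :
    (forall k, bounded_poly (e ^+ k) (c k - C)) -> (forall k, (c k)`_j = x) -> C`_j = x.
  move=> cC cx; apply/esym/eqP; rewrite -subr_eq0; apply/eqP.
  by apply: (padic_norm_le0 e01) => k; rewrite -(cx k) -coefB; exact: cC.
have ui : u`_i = 1.
  by apply: (coefE _ _ _ _ uE) => k; have [[[_ ->] _ _ _ _] _] := sI k.
exists u, v; split=> //; last first.
  apply/eqP; rewrite eqn_leq; apply/andP; split.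
    apply/leq_sizeP => j ij; apply: (coefE _ _ _ _ uE) => k.
    by have [[[sk _] _ _ _ _] _] := sI k; rewrite nth_default // sk.
  rewrite ltnNge; apply/negP => su; move: ui; rewrite nth_default //.
  by move/eqP; rewrite eq_sym oner_eq0.
apply/polyP => j; apply/eqP; rewrite -subr_eq0 -coefB; apply/eqP.
apply: (padic_norm_le0 e01) => k.
have [[_ ub _ vb rb] _] := sI k.
have -> : g - u * v = (g - (s k).1 * (s k).2) + ((s k).1 - u) * (s k).2
    + u * ((s k).2 - v) by ring.
have b1 (C : {poly Q}) : bounded_poly e (C - 1) -> bounded_poly 1 C.
  move=> Cb; rewrite -(subrK 1 C); apply: bounded_polyD; first exact: bounded_poly_le Cb.
  by move=> l; rewrite coef1; case: eqP => _; rewrite ?padic_norm1 ?padic_norm0.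
have ek := exprn_ge0 k e0.
have u1 : bounded_poly 1 u.
  rewrite -(subKr (s 0).1 u); apply: bounded_polyB; last first.
    exact: uE.
  by have [[_ + _ _ _] _] := sI 0%N.
suff: bounded_poly (e ^+ k) (g - (s k).1 * (s k).2 + ((s k).1 - u) * (s k).2
    + u * ((s k).2 - v)) by apply.
apply: bounded_polyD; first apply: bounded_polyD.
- by apply: bounded_poly_le rb; rewrite exprS ler_piMl.
- by rewrite -[e ^+ k]mulr1; apply: bounded_polyM => //; exact: b1.
- by rewrite -[e ^+ k]mul1r; apply: bounded_polyM.
Qed.

End Hensel.

(** * Integral elements form a valuation ring *)

Section ValuationRing.
Variables (R : realType) (p : nat) (Q : padicField R p).
Local Notation N := (@padic_norm R p Q).

Definition padic_map (F : fieldType) (io : {rmorphism Q -> F}) : padic_integers Q -> F :=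
  io \o val.
HB.instance Definition _ F io := GRing.RMorphism.on (@padic_map F io).

Definition zp_integral (F : fieldType) (io : {rmorphism Q -> F}) (x : F) : Prop :=
  integralOver (padic_map io) x.

Section OneField.
Variables (F : fieldType) (io : {rmorphism Q -> F}).
Local Notation intg := (zp_integral io).

Lemma integral_padicP (x : F) : intg x <->
  exists g : {poly Q}, [/\ g \is monic, bounded_poly 1 g & root (map_poly io g) x].
Proof.
split=> [[g gm gx]|[g [gm gb gx]]].
  exists (map_poly val g); rewrite map_poly_comp /= in gx; split=> //.
    exact: monic_map.
  by move=> i; rewrite coef_map /=; exact: (valP g`_i).
have gi i : g`_i \in @padic_integer R p Q by exact: gb.
pose h := \poly_(i < size g) MkPadicInteger (gi i).
have hE : map_poly val h = g.
  apply/polyP => i; rewrite coef_map coef_poly; case: ltnP => // si.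
  by rewrite nth_default.
exists h; last by rewrite map_poly_comp hE.
have vI : injective (val : padic_integers Q -> Q) by exact: val_inj.
by apply/monicP; apply: vI; rewrite -lead_coef_map_inj // hE (monicP gm).
Qed.

Lemma integral_padic (y : Q) : N y <= 1 -> intg (io y).
Proof. by move=> y1; exact: (integral_id (padic_map io) (MkPadicInteger y1)). Qed.

(** If y had norm greater than 1, the leading power in an integral equation for y
    would be the unique term of largest norm. *)
Lemma integral_padic_le1 (y : Q) : intg (io y) -> N y <= 1.
Proof.
move=> /integral_padicP[g [gm gb]]; rewrite fmorph_root => gy.
rewrite leNgt; apply/negP => y1.
have y0 : 0 <= N y by exact: padic_norm_ge0.
case sg : (size g) => [|[|D]].
- by have := monic_neq0 gm; rewrite -size_poly_eq0 sg.
- have g1 : g = 1.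
    have gc := size1_polyC (eq_leq sg); move: gm; rewrite gc monicE lead_coefC.
    by move=> /eqP ->.
  by move: gy; rewrite g1 (negPf (root1 _)).
have gD : g`_D.+1 = 1 by have /monicP := gm; rewrite lead_coefE sg.
have yD : y ^+ D.+1 = - \sum_(j < D.+1) g`_j * y ^+ j.
  apply/eqP; rewrite -addr_eq0 addrC; move: gy; rewrite /root horner_coef sg.
  by rewrite big_ord_recr /= gD mul1r.
have : N (y ^+ D.+1) <= N y ^+ D.
  rewrite yD padic_normN; apply: padic_norm_le_sum => [|j _]; first exact: exprn_ge0.
  rewrite padic_normM padic_normX -[X in _ <= X]mul1r; apply: ler_pM => //.
  - exact: padic_norm_ge0.
  - exact: exprn_ge0.
  - by apply: ler_weXn2l; [exact: ltW|rewrite -ltnS].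
have yD0 : 0 < N y ^+ D by rewrite exprn_gt0 // (lt_trans ltr01).
by rewrite padic_normX exprS ger_pMl // leNgt y1.
Qed.

Lemma last_argmax (a : nat -> R) m : (0 < m)%N -> exists i, [/\ (i < m)%N,
  forall j, (j < m)%N -> a j <= a i & forall j, (j < m)%N -> (i < j)%N -> a j < a i].
Proof.
elim: m => // m IH _; have [->|m0] := posnP m.
  by exists 0%N; split=> // j; rewrite ltnS leqn0 => /eqP ->.
have [i [im ai ai']] := IH m0; have [lt|ge] := ltP (a m) (a i).
  exists i; split=> [|j|j]; first exact: ltn_trans im (ltnSn m).
    by rewrite ltnS leq_eqVlt => /orP[/eqP -> |/ai//]; exact: ltW.
  by rewrite ltnS leq_eqVlt => /orP[/eqP -> //|/ai'].
exists m; split=> // j; rewrite ltnS.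
  by rewrite leq_eqVlt => /orP[/eqP -> //|/ai/le_trans->].
by rewrite leqNgt => /negPf ->.
Qed.

Lemma fin_bound_lt1 (a : nat -> R) m : (forall j, (j < m)%N -> a j < 1) ->
  exists e, 0 <= e < 1 /\ forall j, (j < m)%N -> a j <= e.
Proof.
elim: m => [|m IH] am; first by exists 0; rewrite lexx ltr01.
have [j jm|e [/andP[e0 e1] eE]] := IH; first by rewrite am // ltnW.
exists (Num.max e (a m)); rewrite le_max e0 /= gt_max e1 am //; split=> // j.
by rewrite ltnS leq_eqVlt => /orP[/eqP -> |/eE je]; rewrite le_max ?lexx ?orbT ?je.
Qed.

(** Scale the minimal polynomial so that its largest coefficient is 1, and let i
    be the last place where it is attained: if i is neither 0 nor the degree,
    Hensel's lemma yields a proper factor. *)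
Lemma integral_or_inv (x : F) : algebraicOver io x -> intg x \/ intg x^-1.
Proof.
have [->|x0] := eqVneq x 0.
  by move=> _; left; exact: (mxpoly.integral0 (padic_map io)).
case=> P0 P00 P0x.
pose good m := `[< exists P : {poly Q}, [/\ P != 0, root (map_poly io P) x & size P = m] >].
have exg : exists m, good m by exists (size P0); apply/asboolP; exists P0.
case: (ex_minnP exg) => m /asboolP[P [Pn Px sP]] mmin.
have {mmin} mmin (u : {poly Q}) : u != 0 -> root (map_poly io u) x -> (m <= size u)%N.
  by move=> u0 ux; apply: mmin; apply/asboolP; exists u.
have m0 : (0 < m)%N by rewrite -sP size_poly_gt0.
have [i [im Pi Pi']] := last_argmax (fun j => N P`_j) m0.
have Pi0 : P`_i != 0.
  apply: contraNneq Pn => Pi0; rewrite -lead_coef_eq0; apply/eqP/padic_norm_eq0/eqP.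
  rewrite eq_le padic_norm_ge0 andbT lead_coefE sP.
  by apply: le_trans (Pi _ _) _; rewrite ?prednK // Pi0 padic_norm0.
have NPi : 0 < N P`_i.
  by rewrite lt_def padic_norm_ge0 andbT; apply: contra_neq Pi0 => /padic_norm_eq0.
pose g := (P`_i)^-1 *: P.
have sg : size g = m by rewrite size_scale ?invr_eq0.
have gx : root (map_poly io g) x by rewrite map_polyZ rootZ // fmorph_eq0 invr_eq0.
have gi : g`_i = 1 by rewrite coefZ mulVf.
have gj j : N g`_j = N P`_j / N P`_i by rewrite coefZ padic_normM padic_normV mulrC.
have gb : bounded_poly 1 g.
  move=> j; rewrite gj ler_pdivrMr // mul1r; have [jm|mj] := ltnP j m; first exact: Pi.
  by rewrite nth_default ?sP // padic_norm0 padic_norm_ge0.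
have gb' j : (i < j)%N -> N g`_j < 1.
  move=> ij; rewrite gj ltr_pdivrMr // mul1r; have [jm|mj] := ltnP j m; first exact: Pi'.
  by rewrite nth_default ?sP // padic_norm0.
have [im1|im1] := leqP m i.+1.
  have mi : m = i.+1 by apply/eqP; rewrite eqn_leq im1.
  left; apply/integral_padicP; exists g; split=> //.
  by rewrite monicE lead_coefE sg mi gi.
have [i0|i0] := posnP i; last first.
  have [e [e01 eE]] : exists e, 0 <= e < 1 /\ forall j, (i < j)%N -> N g`_j <= e.
    have [j jm|e [e01 eE]] := @fin_bound_lt1 (fun j => if (i < j)%N then N g`_j else 0) m.
      by case: ifP => // /gb'.
    exists e; split=> // j ij; have [jm|mj] := ltnP j m; first by have := eE j jm; rewrite ij.
    by rewrite nth_default ?sg // padic_norm0; case/andP: e01.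
  have [|u [v [gE su ui]]] := hensel_factor e01 _ gb gi eE; first by rewrite sg.
  have g0 : g != 0 by rewrite -size_poly_gt0 sg.
  have u0 : u != 0 by apply: contraNneq g0 => u0; rewrite gE u0 mul0r.
  have v0 : v != 0 by apply: contraNneq g0 => v0; rewrite gE v0 mulr0.
  have sv : m = (i + size v)%N by rewrite -sg gE size_mul // su addSn.
  move: gx; rewrite gE rmorphM rootM => /orP[/(mmin _ u0)|/(mmin _ v0)].
    by rewrite su leqNgt im1.
  by rewrite sv -[X in (_ <= X)%N]add0n leq_add2r leqNgt i0.
right; apply/integral_padicP; exists (\poly_(j < m) g`_(m.-1 - j)); split.
- rewrite i0 in gi; rewrite monicE lead_coefE size_poly_eq ?subnn ?gi ?oner_neq0 //.
  by rewrite coef_poly ltn_predL m0 subnn gi.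
- by move=> j; rewrite coef_poly; case: ifP => _; [exact: gb|rewrite padic_norm0 ler01].
have xm : x ^+ m.-1 != 0 by rewrite expf_neq0.
rewrite /root -(mulrI_eq0 _ (mulfI xm)); move: gx; rewrite /root => /eqP.
rewrite (horner_coef_wide _ (n := m)) ?size_map_poly ?sg // => gx.
rewrite (horner_coef_wide _ (n := m)) ?size_map_poly ?size_poly // mulr_sumr.
rewrite -[X in _ == X]gx (reindex_inj rev_ord_inj); apply/eqP/eq_bigr => j _ /=.
rewrite !coef_map /= coef_poly.
have mj : (m - j.+1 < m)%N by rewrite ltn_subrL m0.
have jm := ltn_ord j; have e1 : (m.-1 - (m - j.+1))%N = j by lia.
have e2 : m.-1 = (j + (m - j.+1))%N by lia.
rewrite mj e1 mulrCA {1}e2 exprD exprVn; congr (_ * _).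
by rewrite mulfK // expf_neq0.
Qed.

Hypothesis p_prime : prime p.

Lemma padic_norm_p : N p%:R < 1.
Proof.
have p0 := prime_gt0 p_prime.
have := padic_norm_rat Q p%:R; rewrite ratr_nat => ->.
rewrite /padic_abs pnatr_eq0 gtn_eqF //.
have -> : (p%:R : rat) = (p%:Z)%:~R by [].
rewrite denq_int numq_int /= logn1 expr0 mul1r logn_prime // eqxx expr1.
by rewrite invf_lt1 ?ltr0n // ltr1n prime_gt1.
Qed.

(** If c clears the denominators of a monic equation of degree D for x, then c x
    satisfies the equation with coefficients c^(D - j) P_j. *)
Lemma integral_scale (x : F) : algebraicOver io x -> exists k, intg (p%:R ^+ k * x).
Proof.
case=> P0 P00 P0x; pose P := (lead_coef P0)^-1 *: P0.
have l0 : lead_coef P0 != 0 by rewrite lead_coef_eq0.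
have Px : root (map_poly io P) x by rewrite map_polyZ rootZ // fmorph_eq0 invr_eq0.
have Pm : P \is monic by rewrite monicE lead_coefZ mulVf.
case sP : (size P) => [|D]; first by have := monic_neq0 Pm; rewrite -size_poly_eq0 sP.
have PD : P`_D = 1 by have /monicP := Pm; rewrite lead_coefE sP.
have [k kE] : exists k, forall j, (j < D)%N -> N (p%:R ^+ k * P`_j) <= 1.
  have np : 0 <= N p%:R < 1 by rewrite padic_norm_ge0 padic_norm_p.
  have [i [_ iE _]] := last_argmax (fun j => N P`_j) (ltn0Sn D).
  have Ni := padic_norm_ge0 P`_i.
  have Ni1 : 0 < N P`_i + 1 by rewrite ltr_wpDl.
  have /(expr_small np)[k kE] : 0 < (N P`_i + 1)^-1 by rewrite invr_gt0.
  exists k => j jD; rewrite padic_normM padic_normX.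
  apply: (@le_trans _ _ ((N P`_i + 1)^-1 * (N P`_i + 1))); last first.
    by rewrite mulVf // gt_eqF.
  apply: ler_pM; rewrite ?exprn_ge0 ?padic_norm_ge0 //; first exact: ltW.
  by apply: le_trans (iE j _) _; [exact: ltnW|rewrite lerDl ler01].
exists k; pose c : Q := p%:R ^+ k.
have cE : io c = p%:R ^+ k by rewrite rmorphXn rmorph_nat.
have c1 : N c <= 1.
  by rewrite padic_normX exprn_ile1 ?padic_norm_ge0 // ltW ?padic_norm_p.
apply/integral_padicP; exists (\poly_(j < D.+1) (c ^+ (D - j) * P`_j)); split.
- rewrite monicE lead_coefE size_poly_eq ?subnn ?PD ?mulr1 ?oner_neq0 //.
  by rewrite coef_poly ltnSn subnn PD mulr1.
- move=> j; rewrite coef_poly ltnS; case: leqP => jD; last by rewrite padic_norm0 ler01.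
  move: jD; rewrite leq_eqVlt => /orP[/eqP ->|jD].
    by rewrite subnn PD mulr1 padic_norm1.
  rewrite -[(D - j)%N]prednK ?subn_gt0 // exprSr -mulrA padic_normM padic_normX.
  by rewrite mulr_ile1 ?exprn_ge0 ?exprn_ile1 ?padic_norm_ge0 ?kE.
move: Px; rewrite /root => /eqP.
rewrite (horner_coef_wide _ (n := D.+1)) ?size_map_poly ?sP // => Px.
rewrite (horner_coef_wide _ (n := D.+1)) ?size_map_poly ?size_poly //.
apply/eqP; transitivity (io c ^+ D * \sum_(i < D.+1) (map_poly io P)`_i * x ^+ i).
  2: by rewrite Px mulr0.
rewrite mulr_sumr; apply: eq_bigr => j _.
rewrite !coef_map /= coef_poly ltn_ord rmorphM rmorphXn -cE exprMn.
have jD : (j <= D)%N by rewrite -ltnS.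
have -> : io c ^+ D = io c ^+ (D - j) * io c ^+ j by rewrite -exprD subnK.
by ring.
Qed.

Lemma not_integral_Vp : ~ intg (p%:R)^-1.
Proof.
have -> : (p%:R)^-1 = io (p%:R)^-1 by rewrite fmorphV rmorph_nat.
move=> /integral_padic_le1; rewrite padic_normV => h.
have p0 : (p%:R : Q) != 0.
  by have /pcharf0P -> := padic_pchar0 p_prime Q; rewrite -lt0n prime_gt0.
have np : 0 < N p%:R.
  by rewrite lt_def padic_norm_ge0 andbT; apply: contra_neq p0 => /padic_norm_eq0.
by move: h; rewrite invf_le1 // leNgt padic_norm_p.
Qed.

End OneField.

Lemma integral_map (F F' : fieldType) (io : {rmorphism Q -> F}) (j : {rmorphism F -> F'})
    (io' : {rmorphism Q -> F'}) (x : F) : (forall y, io' y = j (io y)) ->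
  zp_integral io' (j x) <-> zp_integral io x.
Proof.
move=> e; split=> [] [g gm gx]; exists g => //.
  move: gx; rewrite (_ : map_poly (padic_map io') g = map_poly j (map_poly (padic_map io) g)).
    by rewrite fmorph_root.
  by rewrite -map_poly_comp; apply: eq_map_poly => y; exact: e.
rewrite (_ : map_poly (padic_map io') g = map_poly j (map_poly (padic_map io) g)).
  by rewrite fmorph_root.
by rewrite -map_poly_comp; apply: eq_map_poly => y; exact: e.
Qed.
End ValuationRing.

(** * Residue fields *)

Section LocalRings.

Lemma rmorphism_descent (A B C : nzRingType) (f : {rmorphism A -> B})
    (g : {rmorphism A -> C}) :
  (forall y, exists x, f x = y) -> (forall x, f x = 0 -> g x = 0) ->
  exists h : {rmorphism B -> C}, forall x, h (f x) = g x.
Proof.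
move=> /choice[s sE] fg.
have gE x y : f x = f y -> g x = g y.
  move=> e; apply/eqP; rewrite -subr_eq0 -rmorphB; apply/eqP/fg.
  by rewrite rmorphB e subrr.
pose h y := g (s y).
have hf x : h (f x) = g x by apply: gE; rewrite sE.
have hB : nmod_morphism h.
  split=> [|u v]; first by rewrite -(rmorph0 f) hf rmorph0.
  by rewrite /h -rmorphD; apply: gE; rewrite rmorphD !sE.
have hM : monoid_morphism h.
  split=> [|u v]; first by rewrite -(rmorph1 f) hf rmorph1.
  by rewrite /h -rmorphM; apply: gE; rewrite rmorphM !sE.
pose m1 := GRing.isNmodMorphism.Build _ _ h hB.
pose m2 := GRing.isMonoidMorphism.Build _ _ h hM.
pose hh : {rmorphism B -> C} := HB.pack h m1 m2.
by exists hh.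
Qed.

Lemma residue_field_exists (A : comNzRingType) (U : A -> Prop) :
  (forall x, U x <-> exists y, x * y = 1) ->
  (forall x y, ~ U x -> ~ U y -> ~ U (x + y)) ->
  exists (k : fieldType) (f : {rmorphism A -> k}),
    (forall y, exists x, f x = y) /\ (forall x, f x = 0 <-> ~ U x).
Proof.
move=> UE UD; pose I : A -> bool := fun x => `[< ~ U x >].
have Iid : idealr_closed (I : {pred A}).
  split.
  - by apply/asboolP => /UE[y]; rewrite mul0r => /eqP; rewrite eq_sym oner_eq0.
  - by apply/asboolPn => nU; apply: nU; apply/UE; exists 1; rewrite mulr1.
  move=> a u v /asboolP uI /asboolP vI; apply/asboolP; apply: UD => // /UE[y e].
  by apply: uI; apply/UE; exists (a * y); rewrite mulrA [u * a]mulrC.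
pose mI := isIdealr.Build A I Iid.
pose II : idealr A := HB.pack I mI.
pose B := {ideal_quot II}.
pose f : {rmorphism A -> B} := \pi_B%qT.
have f0 x : (f x == 0) = I x.
  by have := Quotient.idealrBE II x 0; rewrite subr0 -(rmorph0 f) => <-.
have fS y : exists x, f x = y by exists (generic_quotient.repr y); exact: generic_quotient.reprK.
have /choice[inv invP] (y : B) : exists z, (y != 0 -> z * y = 1) /\ (y = 0 -> z = 0).
  have [->|y0] := eqVneq y 0; first by exists 0.
  have [x xE] := fS y; move: y0; rewrite -xE f0 => /asboolPn/contrapT/UE[z e].
  exists (f z); split=> [_|fx0].
    by rewrite mulrC; have := rmorphM f x z; rewrite e rmorph1.
  by have := rmorph1 f; rewrite -e rmorphM fx0 mul0r => /eqP; rewrite eq_sym oner_eq0.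
pose mF := GRing.ComNzRing_isField.Build B (fun y => (invP y).1) ((invP 0).2 erefl).
pose k : fieldType := HB.pack B mF.
exists k, f; split=> // x; split=> [/eqP|nU]; first by rewrite [_ == _]f0 => /asboolP.
by apply/eqP; rewrite [_ == _]f0; apply/asboolP.
Qed.

End LocalRings.

Section ZpRing.
Variables (R : realType) (p : nat) (Q : padicField R p).
Variables (F : fieldType) (io : {rmorphism Q -> F}).

Definition zp_int : {pred F} := fun x => `[< zp_integral io x >].

Fact zp_int_subring : subring_closed zp_int.
Proof.
split=> [|x y /asboolP x1 /asboolP y1|x y /asboolP x1 /asboolP y1].
- by apply/asboolP/(mxpoly.integral1 (padic_map io)).
- exact/asboolP/(mxpoly.integral_sub (RtoK := padic_map io)).
- exact/asboolP/(mxpoly.integral_mul (RtoK := padic_map io)).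
Qed.

HB.instance Definition _ :=
  GRing.isSubringClosed.Build F zp_int zp_int_subring.

Record zp_ring := MkZpRing { zp_val :> F; _ : zp_val \in zp_int }.

HB.instance Definition _ := [isSub for zp_val].
HB.instance Definition _ := [Choice of zp_ring by <:].
HB.instance Definition _ := [SubChoice_isSubComNzRing of zp_ring by <:].

Hypothesis io_alg : forall x : F, algebraicOver io x.

Lemma zp_ring_unitP (x : zp_ring) :
  (exists y, x * y = 1) <-> (val x != 0 /\ zp_integral io (val x)^-1).
Proof.
split=> [[y xy]|[x0 xV]].
  have e : val x * val y = 1 by rewrite -rmorphM xy rmorph1.
  have x0 : val x != 0.
    by apply/eqP => x0; move/eqP: e; rewrite x0 mul0r eq_sym oner_eq0.
  split=> //; suff -> : (val x)^-1 = val y by exact/asboolP/(valP y).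
  by apply: (mulfI x0); rewrite mulfV.
exists (MkZpRing (introT (asboolP _) xV)); apply: val_inj.
by rewrite rmorphM /= mulfV.
Qed.

(** One of x / y and y / x is integral, say u / v; then u + v is a multiple of v. *)
Lemma zp_ring_local (x y : zp_ring) : ~ (exists z, x * z = 1) ->
  ~ (exists z, y * z = 1) -> ~ (exists z, (x + y) * z = 1).
Proof.
have wlog (u v : zp_ring) : val v != 0 -> zp_integral io (val u / val v) ->
    ~ (exists z, v * z = 1) -> ~ (exists z, (u + v) * z = 1).
  move=> v0 uv nv [z e]; apply: nv; pose w := MkZpRing (introT (asboolP _) uv).
  exists ((w + 1) * z); rewrite mulrA; suff -> : v * (w + 1) = u + v by [].
  apply: val_inj; have -> : val (v * (w + 1)) = val v * (val u / val v + 1) by [].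
  by rewrite mulrDr mulr1 mulrC divfK.
move=> nx ny; have [x0|x0] := eqVneq (val x) 0.
  by have -> : x = 0 by [exact: val_inj]; rewrite add0r.
have [y0|y0] := eqVneq (val y) 0.
  by have -> : y = 0 by [exact: val_inj]; rewrite addr0.
have [xy|] := integral_or_inv (io_alg (val x / val y)); first exact: wlog.
by rewrite invf_div => yx; rewrite addrC; exact: wlog.
Qed.

Lemma zp_residue_field : exists (k : fieldType) (f : {rmorphism zp_ring -> k}),
  (forall y, exists x, f x = y) /\ (forall x, f x = 0 <-> ~ exists y, x * y = 1).
Proof.
exact: (residue_field_exists (U := fun x : zp_ring => exists y, x * y = 1)) zp_ring_local.
Qed.

End ZpRing.

(** * Frobenius generates the Galois group of an unramified polynomial *)

Section Tower.
Variables (R : realType) (p : nat) (Q : padicField R p) (K : fieldExtType Q).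

Definition tower_map (L : fieldExtType K) : {rmorphism Q -> L} := in_alg L \o in_alg K.

Lemma tower_algebraic (L : fieldExtType K) (x : L) : algebraicOver (tower_map L) x.
Proof.
apply/integral_algebraic.
have /polyOver1P[g gE] := minPolyOver 1 x.
have gm := monic_minPoly 1 x.
apply: (integral_root_monic gm (root_minPoly 1 x)).
apply/mxpoly.integral_poly => i; rewrite gE coef_map.
apply: (mxpoly.integral_rmorph (in_alg L)); set c := g`_i.
have /polyOver1P[u uE] := minPolyOver 1 c.
exists u; first by rewrite -(map_monic (in_alg K)) -uE monic_minPoly.
by rewrite -uE root_minPoly.
Qed.

Lemma integral_tower (L : fieldExtType K) (c : K) :
  zp_integral (tower_map L) c%:A <-> zp_integral (in_alg K) c.
Proof. exact: (integral_map (j := in_alg L)). Qed.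

Lemma integers_integral (x : integers K) : zp_integral (in_alg K) (val x).
Proof. exact/asboolP/(valP x). Qed.

Lemma exists_integers (c : K) : zp_integral (in_alg K) c ->
  exists x : integers K, val x = c.
Proof. by move=> cI; exists (MkIntegers (introT (asboolP _) cI)). Qed.

Definition lift_integers (L : fieldExtType K) (x : integers K) : zp_ring (tower_map L) :=
  MkZpRing (introT (asboolP _) (proj2 (integral_tower L (val x)) (integers_integral x))).

Fact lift_integers_nmod (L : fieldExtType K) : nmod_morphism (lift_integers L).
Proof.
split=> [|x y]; apply: val_inj; first exact: (rmorph0 (in_alg L)).
exact: (rmorphD (in_alg L)).
Qed.

Fact lift_integers_monoid (L : fieldExtType K) : monoid_morphism (lift_integers L).
Proof.
split=> [|x y]; apply: val_inj; first exact: (rmorph1 (in_alg L)).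
exact: (rmorphM (in_alg L)).
Qed.

HB.instance Definition _ L := GRing.isNmodMorphism.Build (integers K)
  (zp_ring (tower_map L)) (lift_integers L) (lift_integers_nmod L).
HB.instance Definition _ L := GRing.isMonoidMorphism.Build (integers K)
  (zp_ring (tower_map L)) (lift_integers L) (lift_integers_monoid L).

Lemma lift_integersE (L : fieldExtType K) (x : integers K) :
  val (lift_integers L x) = (val x)%:A.
Proof. by []. Qed.

Lemma lift_nonunit (L : fieldExtType K) (x : integers K) : max_ideal x ->
  ~ exists y, lift_integers L x * y = 1.
Proof.
move=> mx /zp_ring_unitP[]; rewrite lift_integersE => x0 xV; apply: mx.
have [|y yE] := @exists_integers (val x)^-1.
  by apply/(integral_tower L); rewrite -[_%:A]/(in_alg L _) fmorphV.
exists y; apply: val_inj; have -> : val (x * y) = val x * val y by [].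
rewrite [val y]yE mulfV //; by apply: contraNneq x0 => ->; rewrite scale0r.
Qed.

End Tower.

Section Unramified.
Variables (R : realType) (p : nat) (p_prime : prime p) (Q : padicField R p).
Variables (K : fieldExtType Q) (k : finFieldType) (red : {rmorphism integers K -> k}).
Hypothesis residue : is_residue_map red.
Let pchar0 := @padic_ext_pchar0 R p p_prime Q K.
Local Notation q := #|k|.

Section OneExtension.
Variable L : splittingFieldType K.
Local Notation A := (zp_ring (tower_map L)).

Lemma gal_integral (g : gal_of {:L}) (x : A) : zp_integral (tower_map L) (g (val x)).
Proof.
apply/(@integral_map _ _ _ _ _ (tower_map L) g) => [y|]; last exact/asboolP/(valP x).
exact/esym/(rmorph_alg g).
Qed.

Definition gal_int (g : gal_of {:L}) (x : A) : A :=
  MkZpRing (introT (asboolP _) (gal_integral g x)).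

Fact gal_int_nmod g : nmod_morphism (gal_int g).
Proof.
split=> [|x y]; apply: val_inj; first exact: (rmorph0 g).
exact: (rmorphD g).
Qed.

Fact gal_int_monoid g : monoid_morphism (gal_int g).
Proof.
split=> [|x y]; apply: val_inj; first exact: (rmorph1 g).
exact: (rmorphM g).
Qed.

HB.instance Definition _ g := GRing.isNmodMorphism.Build A A (gal_int g) (gal_int_nmod g).
HB.instance Definition _ g := GRing.isMonoidMorphism.Build A A (gal_int g) (gal_int_monoid g).

(** Galois automorphisms preserve integrality, hence nonunits, and so descend to the
    residue field kL; likewise nonunits of K stay nonunits in L, which embeds k
    into kL. *)
Lemma residue_extension : exists (kL : fieldType) (f : {rmorphism A -> kL})
    (j : {rmorphism k -> kL}) (gb : gal_of {:L} -> {rmorphism kL -> kL}),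
  [/\ forall x, j (red x) = f (lift_integers L x),
      forall g x, gb g (f x) = f (gal_int g x)
    & forall g c, gb g (j c) = j c].
Proof.
have [kL [f [fS f0]]] := zp_residue_field (tower_algebraic (L := L)).
have [redS red0] := residue.
have [j jE] : exists j : {rmorphism k -> kL}, forall x, j (red x) = (f \o lift_integers L) x.
  apply: rmorphism_descent redS _ => x /red0/lift_nonunit nx.
  exact: (proj2 (f0 _) (nx L)).
have /choice[gb gbE] (g : gal_of {:L}) : exists h : {rmorphism kL -> kL},
    forall x, h (f x) = (f \o gal_int g) x.
  apply: rmorphism_descent fS _ => x /f0 nx; apply: (proj2 (f0 _)) => -[y xy]; apply: nx.
  exists (gal_int g^-1%g y).
  have := congr1 (gal_int g^-1%g) xy; rewrite rmorph1 rmorphM => <-; congr (_ * _).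
  by apply: val_inj => /=; rewrite -galM ?memvf // mulgV gal_id.
exists kL, f, j, gb; split=> // g c; have [x <-] := redS c.
rewrite jE /= gbE /=; congr (f _); apply: val_inj => /=.
exact: rmorph_alg.
Qed.

(** Both inclusions between the Galois group and the group generated by Frobenius
    come from polynomials with coefficients in the base: Frobenius fixes the
    reduction of the resolvent of the Galois group, and Galois automorphisms fix
    the resolvent of Frobenius. *)
Lemma frobenius_root_perms n (a : n.-tuple (integers K)) (r : n.-tuple L) :
  map_poly (in_alg L) (map_poly val (monic_poly a)) = \prod_(i < n) ('X - (tnth r i)%:P) ->
  separable_poly (tuple_poly (map_tuple red a)) ->
  exists s : 'S_n, root_perms r = <[s]>%g /\
    exists (B : fieldType) (j : {rmorphism k -> B}) (rb : 'I_n -> B),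
      [/\ injective rb, forall i, rb i ^+ q = rb (s i)
        & map_poly j (tuple_poly (map_tuple red a)) = \prod_i ('X - (rb i)%:P)].
Proof.
move=> rE sep; have [kL [f [j [gb [jE gbE gbj]]]]] := residue_extension.
have rI i : zp_integral (tower_map L) (tnth r i).
  apply: (integral_root_monic (p := \prod_(i < n) ('X - (tnth r i)%:P))).
  - by apply: monic_prod => l _; exact: monicXsubC.
  - by rewrite /root horner_prod (bigD1 i) //= hornerXsubC subrr mul0r.
  apply/mxpoly.integral_poly => l; rewrite -rE !coef_map /=.
  exact: (proj2 (integral_tower L _) (integers_integral _)).
pose rA i : A := MkZpRing (introT (asboolP _) (rI i)).
pose rb i := f (rA i).
have fA : map_poly (lift_integers L) (monic_poly a) = \prod_i ('X - (rA i)%:P).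
  have valI : injective (val : A -> L) by exact: val_inj.
  apply: (map_inj_poly valI) => //.
  transitivity (\prod_i ('X - (tnth r i)%:P)); last first.
    rewrite rmorph_prod; apply: eq_bigr => i _.
    rewrite rmorphB; congr (_ - _); first exact/esym/map_polyX.
    exact/esym/map_polyC.
  by rewrite -rE -!map_poly_comp.
have fb : map_poly j (tuple_poly (map_tuple red a)) = \prod_i ('X - (rb i)%:P).
  rewrite -map_tuple_poly -map_poly_comp (eq_map_poly (g := f \o lift_integers L)) //.
  rewrite map_poly_comp [map_poly _ (tuple_poly a)]fA rmorph_prod.
  by apply: eq_bigr => i _; rewrite rmorphB /= map_polyX map_polyC.
have rbI : injective rb.
  have : uniq [seq rb i | i <- enum 'I_n].
    by rewrite -separable_prod_XsubC big_map big_enum -fb separable_map.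
  by move/injectiveP.
pose P := \prod_i ('X - (rb i)%:P).
have [s sE] : exists s : 'S_n, forall i, frob j (rb i) = rb (s i).
  have [||s sE] := @prod_XsubC_perm kL n (frob j \o rb) rb; last by exists s.
    by move=> i i' /fmorph_inj/rbI.
  transitivity (map_poly (frob j) P).
    rewrite rmorph_prod; apply: eq_bigr => i _.
    by rewrite rmorphB /= map_polyX map_polyC.
  rewrite -[RHS]fb /P -fb -map_poly_comp; apply: eq_map_poly => c /=.
  exact: frob_emb.
have sEm i m : rb ((s ^+ m)%g i) = rb i ^+ (q ^ m).
  elim: m => [|m IH]; first by rewrite perm1 expr1.
  by rewrite expgSr permM -sE IH /frob -exprM expnSr.
have rI' : injective (tnth r).
  move=> i i' e; apply: rbI; congr (f _); exact: val_inj.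
have galP (g : gal_of {:L}) : exists t : 'S_n,
    (forall i, g (tnth r i) = tnth r (t i)) /\ (forall i, gb g (rb i) = rb (t i)).
  have [t tE] := gal_permutes_roots g rI' rE.
  exists t; split=> // i; rewrite gbE; congr (f _); apply: val_inj; exact: tE.
have sG : s \in root_perms r.
  pose b (g : gal_of {:L}) i := gb g (rb i).
  have [|i|l m|g gE] := @fixed_coefficients _ _ idfun (frob j) n rb _ b 1%g.
  - by [].
  - have [t [tE tE']] := galP 1%g; rewrite /b tE'; congr rb; apply: rI'.
    by rewrite -tE gal_id.
  - have [c cE] := gal_resolvent_alg pchar0 (tnth r) l m.
    pose PA := resolvent (fun (g : gal_of {:L}) i => gal_int g (rA i)).
    have PAL : map_poly (map_poly val) PA
        = resolvent (fun (g : gal_of {:L}) i => g (tnth r i)).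
      rewrite rmorph_prod; apply: eq_bigr => g _.
      rewrite rmorphB; congr (_ - _); first exact: map_polyX.
      apply: etrans (map_polyC _ _) _; congr _%:P; exact: map_gen_lin.
    have PAb : map_poly (map_poly f) PA = resolvent b.
      rewrite rmorph_prod; apply: eq_bigr => g _.
      rewrite rmorphB /= map_polyX map_polyC /= map_gen_lin.
      by congr ('X - (gen_lin _)%:P); apply/funext => i; rewrite /b gbE.
    have vE : val PA`_l`_m = c%:A by rewrite -cE -PAL !coef_map.
    have [|x xE] := @exists_integers _ _ _ K c.
      apply/(integral_tower L); rewrite -vE; exact/asboolP/(valP PA`_l`_m).
    have PAx : PA`_l`_m = lift_integers L x.
      by apply: val_inj; rewrite vE lift_integersE xE.
    have e : (resolvent b)`_l`_m = j (red x) by rewrite -PAb !coef_map PAx jE.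
    by exists (j (red x)); rewrite e; split=> //; exact: frob_emb.
  have [t [tE tE']] := galP g.
  apply/root_permsP; exists g => i; rewrite tE; congr tnth.
  by apply: rbI; rewrite -sE -tE' gE.
exists s; split; last by exists kL, j, rb.
apply/finset.setP => t; apply/idP/cycleP => [/root_permsP[g gE]|[m ->]]; last first.
  have /root_permsP[g gE] := sG; apply/root_permsP.
  elim: m => [|m [h hE]]; first by exists 1%g => i; rewrite perm1 gal_id.
  exists (h * g)%g => i; rewrite galM ?memvf // expgSr permM -gE; congr (g _).
  exact: hE.
have [t' [tE' tbE]] := galP g.
have {tE'} tt : t' = t.
  by apply/permP => i; apply: rI'; rewrite -tE' gE.
pose b (m : 'I_#[s]%g) i := rb ((s ^+ m)%g i).
have [|i|l m|m mE] := @fixed_coefficients _ _ idfun (gb g) n rb _ b (Ordinal (order_gt0 s)).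
- by [].
- by rewrite /b /= perm1.
- have [|x xE] := @frob_fixed k kL j (resolvent b)`_l`_m.
    apply: (resolvent_fixed (a := frob j) (s := @ordS #[s]%g)) => [|m' i].
      exact: ordS_inj.
    apply: etrans (sE _) _.
    by rewrite /b -permM -expgSr /= expg_mod_order.
  by exists (j x); rewrite gbj xE.
by exists m; apply/permP => i; apply: rbI; rewrite -tt -tbE mE.
Qed.

End OneExtension.
End Unramified.

(** * Discriminants and reduction *)

Section ResultantReduction.
Variables (A : comNzRingType) (k : fieldType) (red : {rmorphism A -> k}).
Variables (f g : {poly A}).
Hypothesis f_monic : f \is monic.
Local Notation fb := (map_poly red f).
Local Notation gb := (map_poly red g).

(** The Sylvester matrix keeps its shape under reduction even if the degree of g
    drops; as f is monic, a kernel vector still contradicts coprimality. *)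
Lemma resultant_red_neq0 : coprimep fb gb -> red (resultant f g) != 0.
Proof.
move=> cop; rewrite /resultant -det_map_mx; apply/negP => /det0P[v v0].
pose band m n (r : {poly k}) : 'M[k]_(m, n) := lin1_mx (poly_rV \o r \o* rVpoly).
have bandE m n (r : {poly A}) :
    map_mx red (lin1_mx (poly_rV \o r \o* rVpoly)) = band m n (map_poly red r).
  apply/matrixP => i j; rewrite !mxE /= !rVpoly_delta -coef_map rmorphM /=.
  by rewrite map_polyXn.
rewrite /Sylvester_mx map_col_mx !bandE -[v]hsubmxK mul_row_col !mul_rV_lin1 /=.
set u := rVpoly (lsubmx v); set w := rVpoly (rsubmx v).
rewrite -linearD /= => e0.
have su : (size u <= (size g).-1)%N by exact: size_poly.
have sw : (size w <= (size f).-1)%N by exact: size_poly.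
have sfb : size fb = size f.
  by rewrite size_map_poly_id0 // (monicP f_monic) rmorph1 oner_neq0.
have sgb : (size gb <= size g)%N by exact: size_poly.
have sf0 : (0 < size f)%N by rewrite size_poly_gt0 monic_neq0.
have e : u * fb + w * gb = 0.
  rewrite -(poly_rV_K (d := ((size g).-1 + (size f).-1)%N) (p := u * fb + w * gb)).
    by rewrite e0 linear0.
  apply: leq_trans (size_polyD _ _) _; rewrite geq_max; apply/andP; split.
    apply: leq_trans (size_polyMleq _ _) _; rewrite sfb.
    by move: su sf0; move: (size u) (size f) (size g) => a b c; lia.
  apply: leq_trans (size_polyMleq _ _) _.
  by move: sw sgb; move: (size w) (size f) (size gb) (size g) => a b c d; lia.
have w0 : w = 0.
  have : fb %| w * gb.
    by move/eqP: e; rewrite addrC addr_eq0 => /eqP ->; rewrite dvdpNr dvdp_mull.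
  rewrite Gauss_dvdpl // => /dvdp_leq h; apply/eqP/negPn/negP => /h.
  by rewrite sfb leqNgt -(prednK sf0) ltnS sw.
have fb0 : fb != 0 by rewrite -size_poly_gt0 sfb.
have u0 : u = 0.
  by move/eqP: e; rewrite w0 mul0r addr0 mulf_eq0 (negPf fb0) orbF => /eqP.
move/negP: v0; apply; apply/eqP; rewrite -[v]hsubmxK.
by rewrite -[lsubmx v]rVpolyK -[rsubmx v]rVpolyK -/u -/w u0 w0 !linear0 row_mx0.
Qed.

Lemma coprimep_of_resultant : (1 < size f)%N -> (1 < size g)%N ->
  red (resultant f g) != 0 -> coprimep fb gb.
Proof.
move=> sf sg r0; have [[u v] /= _ e] := resultant_in_ideal sf sg.
apply/Bezout_coprimepP; exists (map_poly red u, map_poly red v) => /=.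
have := congr1 (map_poly red) e; rewrite map_polyC rmorphD !rmorphM => <-.
by rewrite -size_poly_eq1 size_polyC r0.
Qed.

End ResultantReduction.

Section UnramifiedGaloisGroup.
Variables (R : realType) (p : nat) (p_prime : prime p) (Q : padicField R p).
Variables (K : fieldExtType Q) (k : finFieldType) (red : {rmorphism integers K -> k}).
Hypothesis residue : is_residue_map red.
Variable n : nat.
Hypothesis n_ge2 : (2 <= n)%N.
Implicit Type a : n.-tuple (integers K).

Lemma natr_integers_neq0 m : (0 < m)%N -> (m%:R : integers K) != 0.
Proof.
move=> m0; apply/eqP => /(congr1 val); rewrite rmorph_nat rmorph0 => /eqP.
by have /pcharf0P -> := padic_ext_pchar0 p_prime K; rewrite gtn_eqF.
Qed.

Lemma deriv_tuple_poly_size a : (1 < size (tuple_poly a)^`())%N.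
Proof.
pose f := tuple_poly a.
rewrite ltnNge; apply/negP => /leq_sizeP/(_ n.-1) h.
have n1 : n.-1.+1 = n by rewrite prednK // ltnW.
have h0 : f^`()`_n.-1 = 0 by apply: h; rewrite -ltnS n1.
have fn : f`_n = 1.
  by have /monicP := monic_tuple_poly a; rewrite lead_coefE size_tuple_poly.
move: h0; rewrite coef_deriv n1 fn => /eqP; apply/negP.
exact: natr_integers_neq0 (ltnW n_ge2).
Qed.

Lemma discriminant_unit a : ~ max_ideal (discriminant (monic_poly a)) <->
  separable_poly (tuple_poly (map_tuple red a)).
Proof.
have [_ red0] := residue; pose f := tuple_poly a.
have rd : ~ max_ideal (discriminant (monic_poly a)) <-> red (resultant f f^`()) != 0.
  rewrite -red0 /discriminant rmorphM rmorphXn rmorphN rmorph1.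
  split=> [/eqP|]; first by rewrite mulf_eq0 negb_or => /andP[].
  by move=> r0; apply/eqP; rewrite mulf_neq0 // signr_eq0.
rewrite rd -map_tuple_poly unlock -/f; rewrite deriv_map; split.
  apply: coprimep_of_resultant; last exact: deriv_tuple_poly_size.
  by rewrite size_tuple_poly ltnS ltnW.
exact: resultant_red_neq0 (monic_tuple_poly a).
Qed.

Lemma galois_tuples_unramified a (G : {group 'S_n}) :
  separable_poly (tuple_poly (map_tuple red a)) ->
  exists s : 'S_n, (galois_tuples (K := K) G a <-> <[s]>%g \in conj_class G) /\
    exists (B : fieldType) (j : {rmorphism k -> B}) (rb : 'I_n -> B),
      [/\ injective rb, forall i, rb i ^+ #|k| = rb (s i)
        & map_poly j (tuple_poly (map_tuple red a)) = \prod_i ('X - (rb i)%:P)].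
Proof.
move=> sep; pose f := map_poly (val : integers K -> K) (monic_poly a).
have fE : f = tuple_poly (map_tuple val a) by exact: map_tuple_poly.
have rE (L : splittingFieldType K) (r : n.-tuple L) :
    map_poly (in_alg L) f = \prod_(i < n) ('X - (tnth r i)%:P) ->
    exists s : 'S_n, root_perms r = <[s]>%g /\
      exists (B : fieldType) (j : {rmorphism k -> B}) (rb : 'I_n -> B),
        [/\ injective rb, forall i, rb i ^+ #|k| = rb (s i)
          & map_poly j (tuple_poly (map_tuple red a)) = \prod_i ('X - (rb i)%:P)].
  by move=> e; exact: (frobenius_root_perms p_prime residue e sep).
have gE (L : splittingFieldType K) (r : n.-tuple L) :
    map_poly (in_alg L) f = \prod_(i < n) ('X - (tnth r i)%:P) -> uniq r ->
    splittingFieldFor 1 (map_poly (in_alg L) f) {:L} ->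
    has_galois_group f (root_perms r).
  by move=> e u sp; exists L, r; split=> //; exact: mem_conj_class.
have fm : f \is monic by rewrite fE monic_tuple_poly.
have sf : size f = n.+1 by rewrite fE size_tuple_poly.
have fsep : separable_poly f.
  have : red (resultant (tuple_poly a) (tuple_poly a)^`()) != 0.
    have := sep; rewrite -map_tuple_poly unlock deriv_map.
    exact: resultant_red_neq0 (monic_tuple_poly a).
  move=> r0; rewrite unlock deriv_map.
  apply: (coprimep_of_resultant (f := tuple_poly a)).
  - by rewrite size_tuple_poly ltnS ltnW.
  - exact: deriv_tuple_poly_size.
  apply: contraNneq r0 => r0; apply/eqP.
  have -> : resultant (tuple_poly a) (tuple_poly a)^`() = 0 by exact: val_inj.
  exact: rmorph0.
have [L [r [rf rs]]] := exists_splitting_roots fm sf.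
have ru : uniq r by rewrite (uniq_separable_roots rf).
have [s [sr sB]] := rE L r rf; exists s; split=> //; rewrite -sr.
have gr := gE L r rf ru rs; split=> [gG|rG]; last by exists L, r.
have := has_galois_group_conj p_prime gr gG => e.
by rewrite -e mem_conj_class.
Qed.

End UnramifiedGaloisGroup.

(** * The unramified tuples with a given cyclic Galois group *)

Section BigFiniteField.

(** Split the product of all monic polynomials of degree n and of the X^(q^d) - X
    for d <= n. *)
Lemma exists_big_field (k : finFieldType) n :
  exists (E : finFieldType) (io : {rmorphism k -> E}),
    (forall d, (0 < d)%N -> (d <= n)%N ->
      #|[set y : E | y ^+ (#|k| ^ d) == y]| = (#|k| ^ d)%N) /\
    (forall c : n.-tuple k, exists r : n.-tuple E,
      map_poly io (tuple_poly c) = \prod_i ('X - (tnth r i)%:P)).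
Proof.
pose g d : {poly k} := 'X^(#|k| ^ d) - 'X.
have gm d : (0 < d)%N -> g d \is monic /\ size (g d) = (#|k| ^ d).+1.
  move=> d0; have lt : (size (- 'X : {poly k})%R < size ('X^(#|k| ^ d) : {poly k}))%N.
    have : (1 ^ d < #|k| ^ d)%N by rewrite ltn_exp2r ?q_gt1.
    by rewrite exp1n size_polyN size_polyX size_polyXn.
  by rewrite monicE lead_coefDl // lead_coefXn eqxx size_polyDl // size_polyXn.
have gsep d : (0 < d)%N -> separable_poly (g d).
  move=> d0; rewrite unlock /g derivB derivX derivXn.
  have z : (#|k| ^ d)%:R = 0 :> k.
    have [p p_pr pk] := finPcharP k; apply/eqP; rewrite -(dvdn_pcharf pk).
    have := card_pprimeChar pk; rewrite /pPrimeCharType => kE.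
    rewrite Euclid_dvdX // d0 andbT; have := q_gt1 k; rewrite kE.
    by case: (logn p #|k|) => [|l] // _; rewrite expnS dvdn_mulr.
  rewrite -scaler_nat z scale0r sub0r; apply/Bezout_coprimepP; exists (0, -1).
  by rewrite /= mul0r add0r mulrNN mulr1 eqpxx.
pose G : {poly k} := (\prod_(d < n) g d.+1) * \prod_(c : n.-tuple k) tuple_poly c.
have Gm : G \is monic.
  rewrite monicMl; apply: monic_prod => i _; first exact: monic_tuple_poly.
  by have [] := gm i.+1 isT.
have [L [zs GE _]] := FinSplittingFieldFor (monic_neq0 Gm).
pose E := FinFieldExtType L; pose io : {rmorphism k -> E} := in_alg L.
have div (u : {poly k}) : u \is monic -> u %| G ->
    exists s : seq E, map_poly io u = \prod_(z <- s) ('X - z%:P).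
  move=> um uG.
  have : map_poly io u %| \prod_(z <- (zs : seq E)) ('X - z%:P).
    by rewrite -(eqp_dvdr _ GE) dvdp_map.
  move=> /dvdp_prod_XsubC[m mE]; exists (mask m zs).
  by apply/eqP; rewrite -eqp_monic ?map_monic // monic_prod_XsubC.
exists E, io; split=> [d d0 dn|c].
  have [gdm gds] := gm d d0; have [|s sE] := div (g d) gdm.
    apply: dvdp_mulr; have lt : (d.-1 < n)%N by rewrite prednK.
    by rewrite (bigD1 (Ordinal lt)) //= prednK // dvdp_mulr.
  have us : uniq s by rewrite -separable_prod_XsubC -sE separable_map gsep.
  have -> : #|[set y : E | y ^+ (#|k| ^ d) == y]| = size s.
    rewrite -(card_uniqP us); apply: eq_card => y; rewrite inE -root_prod_XsubC -sE.
    by rewrite /g rmorphB /= map_polyXn map_polyX /root hornerD hornerN hornerXn hornerX subr_eq0.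
  by apply: succn_inj; rewrite -(size_prod_XsubC _ id) -sE size_map_poly.
have [|s sE] := div (tuple_poly c) (monic_tuple_poly c).
  by apply: dvdp_mull; rewrite (bigD1 c) //= dvdp_mulr.
have ss : size s == n.
  by rewrite -eqSS -(size_prod_XsubC _ id) -sE size_map_poly size_tuple_poly.
by exists (Tuple ss); rewrite sE -(big_tuple _ _ (Tuple ss) xpredT (fun z => 'X - z%:P)).
Qed.

End BigFiniteField.

Section FrobeniusType.
Variables (n : nat) (k E : finFieldType) (io : {rmorphism k -> E}).
Hypothesis split : forall c : n.-tuple k, exists r : n.-tuple E,
  map_poly io (tuple_poly c) = \prod_i ('X - (tnth r i)%:P).

Lemma frob_polys_separable mu (c : n.-tuple k) :
  c \in frob_polys n io mu -> separable_poly (tuple_poly c).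
Proof.
rewrite inE => /existsP[s /existsP[r /and3P[_ /frob_rootsP[rI _] /eqP e]]].
rewrite -(separable_map io) e -big_enum -(big_map r xpredT (fun z => 'X - z%:P)) /=.
by rewrite separable_prod_XsubC; apply/injectiveP.
Qed.

Lemma mem_frob_polys (B : fieldType) (j : {rmorphism k -> B}) (rb : 'I_n -> B)
    (c : n.-tuple k) (s : 'S_n) mu :
  injective rb -> (forall i, rb i ^+ #|k| = rb (s i)) ->
  map_poly j (tuple_poly c) = \prod_i ('X - (rb i)%:P) ->
  (c \in frob_polys n io mu) = (cycle_type s == mu).
Proof.
move=> rbI rbs cb; apply/idP/eqP => [|<-{mu}].
  rewrite inE => /existsP[t /existsP[r /and3P[/eqP <- /frob_rootsP[rI rt] /eqP e]]].
  exact: frob_cycle_type rbI rbs cb rI rt e.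
have [r rE] := split c.
have rI : injective (tnth r).
  have : uniq [seq tnth r i | i <- enum 'I_n].
    rewrite -separable_prod_XsubC big_map big_enum /= -rE separable_map.
    rewrite -(separable_map j) cb -big_enum -(big_map rb xpredT (fun z => 'X - z%:P)) /=.
    by rewrite separable_prod_XsubC; apply/injectiveP.
  by move/injectiveP.
have [||t tE] := @prod_XsubC_perm E n (frob io \o tnth r) (tnth r).
- by move=> i i' /fmorph_inj/rI.
- transitivity (map_poly (frob io) (\prod_i ('X - (tnth r i)%:P))).
    rewrite rmorph_prod; apply: eq_bigr => i _.
    by rewrite rmorphB /= map_polyX map_polyC.
  rewrite -rE -map_poly_comp; apply: eq_map_poly => x /=.
  exact: frob_emb.
rewrite inE; apply/existsP; exists t; apply/existsP; exists [ffun i => tnth r i].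
apply/and3P; split.
- by apply/eqP; apply: frob_cycle_type rI tE rE rbI rbs cb.
- apply/frob_rootsP; split=> [i i'|i]; rewrite !ffunE; first by move/rI.
  exact: tE.
by apply/eqP; rewrite rE; apply: eq_bigr => i _; rewrite ffunE.
Qed.

End FrobeniusType.

Section UnramifiedTuples.
Variables (R : realType) (p : nat) (p_prime : prime p) (Q : padicField R p).
Variables (K : fieldExtType Q) (k : finFieldType) (red : {rmorphism integers K -> k}).
Hypothesis residue : is_residue_map red.
Variable n : nat.
Hypothesis n_ge2 : (2 <= n)%N.
Variables (E : finFieldType) (io : {rmorphism k -> E}).
Hypothesis split : forall c : n.-tuple k, exists r : n.-tuple E,
  map_poly io (tuple_poly c) = \prod_i ('X - (tnth r i)%:P).
Implicit Types (G : {group 'S_n}) (a : n.-tuple (integers K)).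

Lemma unramified_galois_tuplesE G a : cyclic G ->
  unramified_galois_tuples (K := K) G a <->
  map_tuple red a \in frob_polys n io (generator_type G).
Proof.
move=> cG; split=> [[Ga /(discriminant_unit p_prime residue n_ge2) sep]|aG].
  have [s [sG [B [j [rb [rbI rbs rbE]]]]]] :=
    galois_tuples_unramified p_prime residue n_ge2 G sep.
  rewrite (mem_frob_polys split _ rbI rbs rbE).
  by move/sG: Ga; rewrite cycle_conj_classE => /andP[].
have sep := frob_polys_separable aG.
have [s [sG [B [j [rb [rbI rbs rbE]]]]]] :=
  galois_tuples_unramified p_prime residue n_ge2 G sep.
split; last exact/(discriminant_unit p_prime residue n_ge2).
by apply/sG; rewrite cycle_conj_classE cG -(mem_frob_polys split _ rbI rbs rbE).
Qed.

Lemma ramified_of_noncyclic G a : ~~ cyclic G -> galois_tuples (K := K) G a ->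
  ~~ separable_poly (tuple_poly (map_tuple red a)).
Proof.
move=> ncG Ga; apply/negP => sep.
have [s [sG _]] := galois_tuples_unramified p_prime residue n_ge2 G sep.
by move/sG: Ga; rewrite cycle_conj_classE (negPf ncG).
Qed.

End UnramifiedTuples.

(** * Krasner's argument: Galois groups are locally constant *)

Section Krasner.
Variables (R : realType) (p : nat) (p_prime : prime p) (Q : padicField R p).
Variable K : fieldExtType Q.
Let pchar0 := @padic_ext_pchar0 R p p_prime Q K.

Section IntegralElements.
Variable L : fieldExtType K.
Local Notation intg := (zp_integral (tower_map L)).

Lemma intg1 : intg 1.
Proof. exact: (mxpoly.integral1 (padic_map (tower_map L))). Qed.

Lemma intgM (x y : L) : intg x -> intg y -> intg (x * y).
Proof. exact: (mxpoly.integral_mul (RtoK := padic_map (tower_map L))). Qed.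

Lemma intgB (x y : L) : intg x -> intg y -> intg (x - y).
Proof. exact: (mxpoly.integral_sub (RtoK := padic_map (tower_map L))). Qed.

Lemma intg_prod (I : Type) (s : seq I) (P : pred I) (F : I -> L) :
  (forall i, P i -> intg (F i)) -> intg (\prod_(i <- s | P i) F i).
Proof. by move=> FI; elim/big_ind: _ => //; [exact: intg1|exact: intgM]. Qed.

Lemma intg_nat m : intg m%:R.
Proof. exact: (mxpoly.integral_nat (padic_map (tower_map L))). Qed.

Lemma p_neq0 : (p%:R : L) != 0.
Proof.
have /pcharf0P -> : [pchar L] =i pred0 by move=> l; rewrite pchar_lalg pchar0.
by rewrite -lt0n prime_gt0.
Qed.

Lemma integral_root (n : nat) (b : n.-tuple (integers K)) (z : L) :
  root (map_poly (in_alg L) (map_poly val (monic_poly b))) z -> intg z.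
Proof.
move=> bz; apply: (integral_root_monic _ bz).
  by rewrite map_monic; apply: monic_map; exact: monic_tuple_poly.
apply/mxpoly.integral_poly => l; rewrite !coef_map /=.
exact: (proj2 (integral_tower L _) (integers_integral _)).
Qed.

(** Some p^m / x is integral; if x / p^d were integral with d > m, then so would be
    1 / p. *)
Lemma not_integral_div (x : L) : x != 0 -> exists c, forall d, (c <= d)%N -> ~ intg (x / p%:R ^+ d).
Proof.
move=> x0; have [m mI] := integral_scale p_prime (tower_algebraic x^-1).
exists m.+1 => d md xI; apply: (not_integral_Vp p_prime (io := tower_map L)).
have pn := p_neq0.
have -> : (p%:R)^-1 = p%:R ^+ (d - m.+1) * ((p%:R ^+ m * x^-1) * (x / p%:R ^+ d)).
  have -> : p%:R ^+ d = p%:R ^+ (d - m.+1) * (p%:R * p%:R ^+ m) :> L.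
    by rewrite -exprS -exprD subnK.
  move: (_ ^+ (d - _)) (_ ^+ m) (expf_neq0 (d - m.+1) pn) (expf_neq0 m pn) => u v u0 v0.
  by field; rewrite u0 v0 pn x0.
by apply: intgM; [rewrite -natrX; exact: intg_nat|exact: intgM].
Qed.

End IntegralElements.

Lemma gal_integral_iff (M : splittingFieldType K) (g : gal_of {:M}) (x : M) :
  zp_integral (tower_map M) (g x) <-> zp_integral (tower_map M) x.
Proof.
by apply: (integral_map (j := g)) => y; exact/esym/(rmorph_alg g).
Qed.

(** Automorphisms preserve closeness modulo p^c, and closeness matches each root of
    f with exactly one root of g, because distinct roots of f are not close. *)
Lemma close_root_perms n (M : splittingFieldType K) (f g : {poly K}) (r s : n.-tuple M) c :
  map_poly (in_alg M) f = \prod_i ('X - (tnth r i)%:P) ->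
  map_poly (in_alg M) g = \prod_i ('X - (tnth s i)%:P) ->
  (forall i j, i != j -> ~ zp_integral (tower_map M) ((tnth r i - tnth r j) / p%:R ^+ c)) ->
  (forall i, zp_integral (tower_map M) ((tnth r i - tnth s i) / p%:R ^+ c)) ->
  root_perms r = root_perms s /\ uniq s.
Proof.
set intg := zp_integral _ => rE sE rsep rs.
have closeP i j : intg ((tnth r i - tnth s j) / p%:R ^+ c) -> i = j.
  move=> ij; apply/eqP/negPn/negP => /rsep; apply.
  have -> : (tnth r i - tnth r j) / p%:R ^+ c =
    (tnth r i - tnth s j) / p%:R ^+ c - (tnth r j - tnth s j) / p%:R ^+ c by ring.
  by apply: intgB; [exact: ij|exact: rs].
have galc (t : gal_of {:M}) x y : intg ((x - y) / p%:R ^+ c) -> intg ((t x - t y) / p%:R ^+ c).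
  move=> /(gal_integral_iff t); rewrite fmorph_div rmorphB rmorphXn rmorph_nat.
  by [].
have rI : injective (tnth r).
  move=> i i' e; apply/eqP/negPn/negP => /rsep; apply; rewrite e subrr mul0r.
  exact: (mxpoly.integral0 (padic_map (tower_map M))).
have sI : injective (tnth s).
  by move=> i i' e; apply: closeP; rewrite -e; exact: rs.
split; last exact/tuple_uniqP.
apply/finset.setP => t; apply/root_permsP/root_permsP => -[h hE]; exists h => i.
  have [u uE] := gal_permutes_roots h sI sE; rewrite uE; congr tnth.
  by apply/esym/closeP; rewrite -hE -uE; apply: galc; exact: rs.
have [u uE] := gal_permutes_roots h rI rE; rewrite uE; congr tnth.
by apply: closeP; rewrite -hE -uE; apply: galc; exact: rs.
Qed.

Lemma perturbed_poly n (a b : n.-tuple (integers K)) N (M : fieldExtType K) :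
  (forall i, exists y, tnth b i = tnth a i + p%:R ^+ N * y) ->
  exists y : {poly integers K}, map_poly (in_alg M) (map_poly val (monic_poly b)) =
    map_poly (in_alg M) (map_poly val (monic_poly a)) +
    (p%:R ^+ N)%:P * map_poly (in_alg M) (map_poly val y).
Proof.
move=> /choice[y yE]; exists (\poly_(i < n) [tuple y i | i < n]`_i).
have -> : monic_poly b = monic_poly a
    + (p%:R ^+ N)%:P * \poly_(i < n) [tuple y i | i < n]`_i.
  rewrite /monic_poly -addrA; congr (_ + _); apply/polyP => i.
  rewrite coefD coefCM !coef_poly; case: ltnP => [lt|_]; last by rewrite mulr0 addr0.
  have nE (A : nzRingType) (t : n.-tuple A) : t`_i = tnth t (Ordinal lt).
    by rewrite (tnth_nth 0).
  by rewrite !nE tnth_mktuple yE.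
rewrite !rmorphD !rmorphM; congr (_ + _ * _).
apply: etrans (congr1 _ (map_polyC _ _)) _; apply: etrans (map_polyC _ _) _.
congr _%:P; transitivity (in_alg M (p%:R ^+ N)); last by rewrite rmorphXn rmorph_nat.
apply: (congr1 (in_alg M)).
apply: etrans (rmorphXn (val : {rmorphism integers K -> K}) N p%:R) _.
by rewrite rmorph_nat.
Qed.

(** If b is congruent to a modulo p^(n c), then the product over j of the
    (r_i - s_j) / p^c is integral for every root r_i of the first polynomial, so one
    of the factors is: every r_i is close to some root s_j of the second one. *)
Lemma galois_tuples_open n (a : n.-tuple (integers K)) (H : {set 'S_n}) : (0 < n)%N ->
  galois_tuples (K := K) H a -> exists N, forall b : n.-tuple (integers K),
    (forall i, exists y, tnth b i = tnth a i + p%:R ^+ N * y) -> galois_tuples (K := K) H b.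
Proof.
move=> n0 [L [r [rE ru rs rH]]].
have rI : injective (tnth r) by exact/tuple_uniqP.
have /choice[c0 c0E] (ij : 'I_n * 'I_n) : exists c, ij.1 != ij.2 ->
    forall d, (c <= d)%N -> ~ zp_integral (tower_map L) ((tnth r ij.1 - tnth r ij.2) / p%:R ^+ d).
  have [->|ij0] := eqVneq ij.1 ij.2; first by exists 0%N.
  have [|c cE] := @not_integral_div L (tnth r ij.1 - tnth r ij.2).
    by rewrite subr_eq0 (inj_eq rI).
  by exists c.
pose c := \max_ij c0 ij.
have rsep i j : i != j -> ~ zp_integral (tower_map L) ((tnth r i - tnth r j) / p%:R ^+ c).
  by move=> ij; apply: (c0E (i, j)) => //; exact: leq_bigmax.
exists (n * c)%N => b ab.
pose g := map_poly (val : integers K -> K) (monic_poly b).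
have gT : g = tuple_poly (map_tuple val b) by exact: map_tuple_poly.
have [L2 [s [sE ss]]] := exists_splitting_roots (f := g)
  (eq_ind_r (fun u => is_true (u \is monic)) (monic_tuple_poly _) gT)
  (etrans (congr1 (fun u : {poly K} => size u) gT) (size_tuple_poly _)).
have [M [i1 [i2 [i1A i2A]]]] := common_extension L L2 pchar0.
pose f := map_poly (val : integers K -> K) (monic_poly a).
have mapE (L' : splittingFieldType K) (io : {rmorphism L' -> M}) (h : {poly K}) (t : n.-tuple L') :
    (forall c, io c%:A = c%:A) -> map_poly (in_alg L') h = \prod_(i < n) ('X - (tnth t i)%:P) ->
    map_poly (in_alg M) h = \prod_i ('X - (tnth (map_tuple io t) i)%:P).
  move=> ioA hE; have -> : map_poly (in_alg M) h = map_poly io (map_poly (in_alg L') h).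
    by rewrite -map_poly_comp; apply: eq_map_poly => x; exact/esym/ioA.
  rewrite hE rmorph_prod; apply: eq_bigr => i _.
  by rewrite rmorphB /= map_polyX map_polyC tnth_map.
have fM := mapE _ _ f r i1A rE; have gM := mapE _ _ g s i2A sE.
set rM := map_tuple i1 r in fM; set sM := map_tuple i2 s in gM.
pose intg := zp_integral (tower_map M).
have pn := p_neq0 M.
have rMsep i j : i != j -> ~ intg ((tnth rM i - tnth rM j) / p%:R ^+ c).
  move=> ij h; apply: (rsep i j ij); apply/(integral_map (j := i1) (io' := tower_map M)).
    by move=> y; exact/esym/i1A.
  by rewrite fmorph_div rmorphB rmorphXn rmorph_nat; move: h; rewrite !tnth_map.
have rootf i : root (map_poly (in_alg M) f) (tnth rM i).
  by rewrite fM /root horner_prod (bigD1 i) //= hornerXsubC subrr mul0r.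
have rMI i : intg (tnth rM i) by exact: integral_root (rootf i).
have [pi piE] : exists pi : 'I_n -> 'I_n, forall i, intg ((tnth rM i - tnth sM (pi i)) / p%:R ^+ c).
  (* Otherwise all inverses are integral, and the integral product times all
     inverses but one would be an integral factor. *)
  suff ex i : exists j, intg ((tnth rM i - tnth sM j) / p%:R ^+ c).
    by have /choice[u uE] := ex; exists u.
  apply: contrapT => nex.
  pose z j := (tnth rM i - tnth sM j) / p%:R ^+ c.
  have zN j : ~ intg (z j) by move=> zj; apply: nex; exists j.
  have zV j : intg (z j)^-1 by have [/zN|] := integral_or_inv (tower_algebraic (z j)).
  have z0 j : z j != 0.
    apply/eqP => e; apply: (zN j); rewrite e.
    exact: (mxpoly.integral0 (padic_map (tower_map M))).
  have zI : intg (\prod_j z j).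
    have -> : \prod_j z j = (map_poly (in_alg M) g).[tnth rM i] / p%:R ^+ (n * c).
      rewrite gM horner_prod prodf_div prodr_const card_ord -exprM mulnC.
      by congr (_ / _); apply: eq_bigr => j _; rewrite hornerXsubC.
    have [y yE] := perturbed_poly M ab; rewrite yE hornerD (eqP (rootf i)) add0r hornerM.
    rewrite hornerC mulrAC mulfV ?expf_neq0 // mul1r.
    apply: (mxpoly.integral_horner (RtoK := padic_map (tower_map M))); last exact: rMI.
    apply/mxpoly.integral_poly => l; rewrite !coef_map /=.
    exact: (proj2 (integral_tower M _) (integers_integral _)).
  pose j0 := Ordinal n0; apply: (zN j0).
  have -> : z j0 = (\prod_j z j) * \prod_(j | j != j0) (z j)^-1.
    rewrite [\prod_j z j](bigD1 j0) //= prodfV mulfK //.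
    by apply/prodf_neq0 => j _; exact: z0.
  by apply: intgM => //; apply: intg_prod => j _; exact: zV.
have piI : injective pi.
  move=> i i' e; apply/eqP/negPn/negP => /rMsep; apply.
  have -> : (tnth rM i - tnth rM i') / p%:R ^+ c =
    (tnth rM i - tnth sM (pi i)) / p%:R ^+ c - (tnth rM i' - tnth sM (pi i')) / p%:R ^+ c.
    by rewrite e; ring.
  by apply: intgB; exact: piE.
pose w := perm piI; pose sw := [tuple tnth sM (w i) | i < n].
have swE i : tnth sw i = tnth sM (w i) by rewrite tnth_mktuple.
have gsw : map_poly (in_alg M) g = \prod_i ('X - (tnth sw i)%:P).
  rewrite gM -(prod_XsubC_reindex _ w); apply: eq_bigr => i _.
  by rewrite swE.
have [|rsE su] := close_root_perms fM gsw rMsep.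
  by move=> i; rewrite swE permE; exact: piE.
have us : uniq s.
  have : uniq sM.
    by rewrite (uniq_separable_roots gM) -(uniq_separable_roots gsw).
  by rewrite map_inj_uniq //; exact: fmorph_inj.
exists L2, s; split=> //.
rewrite -(root_perms_map p_prime s i2A) -/sM.
have e1 := root_perms_reindex swE.
rewrite -(root_perms_map p_prime r i1A) -/rM rsE e1 in rH.
rewrite -(conj_class_eq rH) conj_classJ; exact: mem_conj_class.
Qed.

End Krasner.

(** * Measurability *)

Section MeasurableBoxes.
Local Open Scope classical_set_scope.

Lemma measurable_tuple_box d (T : measurableType d) n (A : 'I_n -> set T) :
  (forall i, measurable (A i)) ->
  measurable [set t : n.-tuple T | forall i, A i (tnth t i)].
Proof.
move=> mA; have -> : [set t : n.-tuple T | forall i, A i (tnth t i)]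
    = \bigcap_(i in [set: 'I_n]) ((fun t : n.-tuple T => tnth t i) @^-1` A i).
  by apply/seteqP; split=> [t tA i _|t tA i]; [exact: tA|exact: (tA i)].
apply: fin_bigcap_measurable => // i _; rewrite -[_ @^-1` _]setTI.
exact: measurable_tnth.
Qed.

Lemma measurable_countable (T : countType) d (S : measurableType d) (F : T -> set S) :
  (forall t, measurable (F t)) -> measurable (\bigcup_t F t).
Proof.
move=> mF.
have -> : \bigcup_t F t = \bigcup_k (if unpickle k is Some t then F t else set0).
  apply/seteqP; split=> x [t _ tx]; last first.
    by move: tx; case: (unpickle t) => // u ux; exists u.
  by exists (pickle t) => //; rewrite pickleK.
by apply: bigcupT_measurable => k; case: (unpickle k).
Qed.

End MeasurableBoxes.

Section Measurability.
Variables (R : realType) (p : nat) (p_prime : prime p) (Q : padicField R p).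
Variable K : fieldExtType Q.
Local Open Scope classical_set_scope.
Local Notation O := (integers K).

Definition coset (x : O) N : set (borel_integers K) :=
  [set z : O | exists y : O, z = x + p%:R ^+ N * y].

Lemma measurable_open_integers (U : set (borel_integers K)) :
  integers_open (U : set O) -> measurable U.
Proof. by move=> oU; apply: sub_gen_smallest. Qed.

Lemma measurable_coset x N : measurable (coset x N).
Proof.
apply: measurable_open_integers => z [y ->]; exists N => t; exists (y + t).
by rewrite mulrDr addrA.
Qed.

Local Notation d := (\dim {:K}).

(** Approximate the coordinates of x in a basis by rationals, to within a power of p
    that also clears the denominators of the basis. *)
Lemma rational_approx (x : K) N : exists v : {ffun 'I_d -> rat},
  zp_integral (in_alg K) ((x - \sum_i (ratr (v i) : Q) *: (vbasis {:K})`_i) / p%:R ^+ N).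
Proof.
have alg (z : K) : algebraicOver (in_alg K) z.
  have /polyOver1P[g gE] := minPolyOver 1 z.
  exists g; first by rewrite -(map_poly_eq0 (in_alg K)) -gE monic_neq0 // monic_minPoly.
  by rewrite -gE root_minPoly.
have /choice[m mE] (i : 'I_d) : exists m, zp_integral (in_alg K) (p%:R ^+ m * (vbasis {:K})`_i).
  exact: integral_scale.
pose M := \max_i m i.
have intM (u v : K) : zp_integral (in_alg K) u -> zp_integral (in_alg K) v ->
    zp_integral (in_alg K) (u * v).
  exact: (mxpoly.integral_mul (RtoK := padic_map (in_alg K))).
have ME (i : 'I_d) : zp_integral (in_alg K) (p%:R ^+ M * (vbasis {:K})`_i).
  have -> : p%:R ^+ M = p%:R ^+ (M - m i) * p%:R ^+ m i :> K.
    by rewrite -exprD subnK // leq_bigmax.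
  rewrite -mulrA; apply: intM => //; rewrite -natrX.
  exact: (mxpoly.integral_nat (padic_map (in_alg K))).
have pQ : (p%:R : Q) != 0.
  by have /pcharf0P -> := padic_pchar0 p_prime Q; rewrite gtn_eqF // prime_gt0.
have np : 0 < padic_norm (p%:R : Q).
  by rewrite lt_def padic_norm_ge0 andbT; apply: contra_neq pQ => /padic_norm_eq0.
have /choice[v vE] (i : 'I_d) : exists v : rat,
    padic_norm (coord (vbasis {:K}) i x - ratr v) <= padic_norm (p%:R ^+ (N + M) : Q).
  have [|v vE] := padic_dense (coord (vbasis {:K}) i x) (e := padic_norm (p%:R ^+ (N + M) : Q)).
    by rewrite padic_normX exprn_gt0.
  by exists v; exact: ltW.
exists [ffun i => v i].
have pK : (p%:R : K) != 0.
  by have /pcharf0P -> := padic_ext_pchar0 p_prime K; rewrite gtn_eqF // prime_gt0.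
have xE := coord_vbasis (memvf x).
have -> : (x - \sum_i (ratr ([ffun i => v i] i) : Q) *: (vbasis {:K})`_i) / p%:R ^+ N =
  \sum_i ((coord (vbasis {:K}) i x - ratr (v i)) / p%:R ^+ (N + M))%:A * (p%:R ^+ M * (vbasis {:K})`_i).
  rewrite {1}xE -sumrB mulr_suml; apply: eq_bigr => i _; rewrite ffunE -scalerBl.
  set c := _ - ratr _; rewrite -[in LHS]mulr_algl.
  have -> : (c / p%:R ^+ (N + M))%:A = c%:A / (p%:R ^+ N * p%:R ^+ M) :> K.
    rewrite -[_%:A]/(in_alg K _) fmorph_div rmorphXn rmorph_nat exprD.
    by [].
  have pM : (p%:R ^+ M : K) != 0 by rewrite expf_neq0.
  by rewrite invfM !mulrA (mulfVK pM) mulrAC.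
apply: (big_ind (fun z => zp_integral (in_alg K) z)) => [|u w uI wI|i _].
- exact: (mxpoly.integral0 (padic_map (in_alg K))).
- exact: (mxpoly.integral_add (RtoK := padic_map (in_alg K))).
apply: intM => //; apply: (integral_padic (in_alg K)).
by rewrite padic_normM padic_normV ler_pdivrMr ?mul1r // padic_normX exprn_gt0.
Qed.

Lemma dense_integers : exists D : {ffun 'I_d -> rat} -> nat -> O,
  forall (x : O) N, exists v, coset (D v N) N x.
Proof.
pose close (v : {ffun 'I_d -> rat}) N (x : O) := zp_integral (in_alg K)
  ((val x - \sum_i (ratr (v i) : Q) *: (vbasis {:K})`_i) / p%:R ^+ N).
have ex v N : exists y : O, forall x, close v N x -> close v N y.
  have [[y yc]|nex] := pselect (exists y, close v N y); first by exists y.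
  by exists 0 => x xc; case: nex; exists x.
have /choice[D DE] v : exists f : nat -> O, forall N x, close v N x -> close v N (f N).
  by have /choice[f fE] := ex v; exists f.
exists D => x N; have [v vx] := rational_approx (val x) N; exists v.
have := DE v N x vx => dv; have pK : (p%:R : K) != 0.
  by have /pcharf0P -> := padic_ext_pchar0 p_prime K; rewrite gtn_eqF // prime_gt0.
have [|y yE] := @exists_integers _ _ _ K ((val x - val (D v N)) / p%:R ^+ N).
  have := mxpoly.integral_sub (RtoK := padic_map (in_alg K)) vx dv.
  by rewrite -mulrBl opprB addrA subrK.
exists y; apply: val_inj.
have -> : val (D v N + p%:R ^+ N * y) = val (D v N) + val (p%:R ^+ N : O) * val y by [].
have -> : val (p%:R ^+ N : O) = p%:R ^+ N.
  apply: etrans (rmorphXn (val : {rmorphism O -> K}) N p%:R) _.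
  by rewrite rmorph_nat.
by rewrite yE mulrC divfK ?expf_neq0 // addrC subrK.
Qed.

(** A union of boxes indexed by a precision N and one point of the countable dense
    set for each coordinate. *)
Lemma measurable_galois_tuples n (H : {set 'S_n}) : (0 < n)%N ->
  measurable (galois_tuples (K := K) H).
Proof.
move=> n0; have [D DE] := dense_integers.
pose T : countType := (nat * n.-tuple {ffun 'I_d -> rat})%type.
pose box (t : T) : set (n.-tuple (borel_integers K)) :=
  [set a | forall i, coset (D (tnth t.2 i) t.1) t.1 (tnth a i)].
have -> : galois_tuples (K := K) H =
    \bigcup_(t : T) (if `[< box t `<=` galois_tuples (K := K) H >] then box t else set0).
  apply/seteqP; split=> [a aH|a [t _]]; last by case: asboolP => // + ta; apply.
  have [N NE] := galois_tuples_open p_prime n0 aH.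
  have /choice[v vE] (i : 'I_n) := DE (tnth a i) N.
  exists (N, [tuple v i | i < n]) => //=; rewrite asboolT.
    by move=> i; rewrite /= tnth_mktuple; exact: vE.
  move=> b bb; apply: NE => i; have [y yE] := bb i; have [z zE] := vE i.
  exists (y - z); rewrite yE /= tnth_mktuple [in RHS]zE mulrBr addrA addrAC.
  by rewrite addrK.
apply: measurable_countable => t; case: asboolP => // _.
apply: (measurable_tuple_box (A := fun i => coset (D (tnth t.2 i) t.1) t.1)) => i.
exact: measurable_coset.
Qed.

End Measurability.

(** * Measures of sets defined by reductions *)

Section FiniteFibers.
Local Open Scope classical_set_scope.
Variables (d : measure_display) (X : measurableType d) (R : realType).
Variables (T : finType) (phi : X -> T).
Hypothesis mphi : forall c, measurable [set x | phi x = c].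

Lemma fibers_bigcup (S : {set T}) : [set x | phi x \in S] =
  \bigcup_(c in [set` enum S]) [set x | phi x = c].
Proof.
apply/seteqP; split=> [x xS|x [c /= cS xc]]; last by rewrite xc -mem_enum.
by exists (phi x) => //=; rewrite mem_enum.
Qed.

Lemma measurable_fibers (S : {set T}) : measurable [set x | phi x \in S].
Proof. by rewrite fibers_bigcup; apply: fin_bigcup_measurable. Qed.

Lemma measure_fibers (mu : {measure set X -> \bar R}) (S : {set T}) :
  mu [set x | phi x \in S] = (\sum_(c in S) mu [set x | phi x = c])%E.
Proof.
rewrite fibers_bigcup measure_fin_bigcup //.
  by rewrite -fsbig_seq ?enum_uniq // big_enum.
by move=> c c' _ _ [x [/= -> ->]].
Qed.

End FiniteFibers.

Section WeightedMeasures.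
Local Open Scope classical_set_scope.
Variables (d : measure_display) (X : measurableType d) (R : realType).

(** A weighted sum of measures is the integral of a sum of indicators. *)
Lemma weighted_measure_le (mu : {measure set X -> \bar R}) (J : finType)
    (A : J -> set X) (w : J -> R) (B : set X) :
  (forall j, measurable (A j)) -> measurable B -> (forall j, 0 <= w j) ->
  (forall x, \sum_j w j * \1_(A j) x <= \1_B x) ->
  (\sum_j (w j)%:E * mu (A j) <= mu B)%E.
Proof.
move=> mA mB w0 wB.
have mI (C : set X) : measurable C ->
    measurable_fun [set: X] (EFin \o (\1_C : X -> R)).
  by move=> mC; apply/measurable_EFinP; exact: measurable_indic.
have mF j : measurable_fun [set: X] (fun x => (w j)%:E * (EFin \o (\1_(A j) : X -> R)) x)%E.
  by apply: emeasurable_funM => //; exact: mI.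
have I0 (C : set X) x : (0 <= (\1_C x : R)%:E)%E by rewrite lee_fin.
have -> : (\sum_j (w j)%:E * mu (A j) =
    \int[mu]_x (\sum_j (w j)%:E * (\1_(A j) x)%:E))%E.
  rewrite ge0_integral_sum //; last by move=> j x _; rewrite mule_ge0 ?lee_fin.
  apply: eq_bigr => j _; rewrite ge0_integralZl_EFin ?integral_indic ?setIT //.
  exact: mI.
rewrite -[B in mu B]setIT -integral_indic //.
apply: ge0_le_integral => //.
- by move=> x _; apply: sume_ge0 => j _; rewrite mule_ge0 ?lee_fin.
- exact: emeasurable_sum.
- exact: mI.
by move=> x _; under eq_bigr do rewrite -EFinM; rewrite sumEFin lee_fin.
Qed.

End WeightedMeasures.

Section BoxMeasure.
Local Open Scope classical_set_scope.
Variables (d : measure_display) (T : measurableType d) (R : realType).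
Variable h : probability T R.

Lemma tuple_probability_box n (A : 'I_n -> set T) : (forall i, measurable (A i)) ->
  tuple_probability h n [set t | forall i, A i (tnth t i)] = (\prod_(i < n) h (A i))%E.
Proof.
elim: n A => [|n IH] A mA.
  rewrite big_ord0 /= diracE; apply/eqP; rewrite eqe pnatr_eq1 eqb1.
  by apply/mem_set => -[].
have mA' i : measurable (A (lift ord0 i)) by [].
rewrite big_ord_recl -IH //=.
rewrite /distribution /pushforward.
have -> : (consT (n := n)) @^-1` [set t : n.+1.-tuple T | forall i, A i (tnth t i)] =
    A ord0 `*` [set t : n.-tuple T | forall i, A (lift ord0 i) (tnth t i)].
  apply/seteqP; split=> [[x t] /= xt|[x t] /= [xA tA] i].
    split; first by have := xt ord0; rewrite (tnth_nth x).
    by move=> i; have := xt (lift ord0 i); rewrite !(tnth_nth x).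
  by case: (unliftP ord0 i) => [j ->|->]; rewrite (tnth_nth x) //= -(tnth_nth x).
rewrite product_measure1E //.
exact: (measurable_tuple_box (A := fun i => A (lift ord0 i))).
Qed.

End BoxMeasure.

Section HaarResidue.
Local Open Scope classical_set_scope.
Variables (R : realType) (p : nat) (p_prime : prime p) (Q : padicField R p).
Variables (K : fieldExtType Q) (k : finFieldType) (red : {rmorphism integers K -> k}).
Hypothesis residue : is_residue_map red.
Variables (e : nat) (card_k : #|k| = (p ^ e)%N).
Variable h : probability (borel_integers K) R.
Hypothesis haar : is_haar h.
Local Notation q := #|k|.

Lemma measurable_residue c : measurable [set x : borel_integers K | red x = c].
Proof.
apply: measurable_open_integers => x /= xc; exists 1%N => y /=.
rewrite rmorphD xc rmorphM expr1 rmorph_nat.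
by rewrite (pcharf0 (card_finPcharP card_k p_prime)) mul0r addr0.
Qed.

(** The q residue classes are translates of each other. *)
Lemma haar_residue c : h [set x : borel_integers K | red x = c] = (q%:R^-1)%:E.
Proof.
have [redS _] := residue.
pose A0 : set (borel_integers K) := [set x | red x = 0].
have hE u : h [set x : borel_integers K | red x = u] = h A0.
  have [a au] := redS u; rewrite -(haar a (measurable_residue 0)); congr (h _).
  apply/seteqP; split=> [x /= xu|_ [x /= x0 <-]]; last by rewrite /= rmorphD au x0 addr0.
  exists (x - a); last by rewrite addrC subrK.
  by rewrite /= rmorphB xu au subrr.
have : (\sum_(u in [set: k]%SET) h [set x : borel_integers K | red x = u])%E = 1%E.
  rewrite -[RHS](probability_setT h).
  apply: etrans (esym (measure_fibers measurable_residue h [set: k]%SET)) _.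
  by congr (h _); apply/seteqP; split=> x //= _; rewrite inE.
rewrite (eq_bigr (fun=> h A0)) => [|u _]; last exact: hE.
rewrite hE; have mA0 : measurable A0 := measurable_residue 0.
rewrite -(fineK (fin_num_measure h A0 mA0)) sumEFin => -[].
rewrite big_const cardsT iter_addr_0 => e1; congr EFin.
have q0 : (q%:R : R) != 0 by rewrite pnatr_eq0 -lt0n q_gt0.
by apply: (mulfI q0); rewrite mulfV // mulr_natl e1.
Qed.

Lemma tuple_residueE n (c : n.-tuple k) :
  [set a : n.-tuple (borel_integers K) | map_tuple red a = c] =
  [set a | forall i, [set x : borel_integers K | red x = tnth c i] (tnth a i)].
Proof.
apply/seteqP; split=> [a /= <- i|a /= ac]; first by rewrite tnth_map.
by apply: eq_from_tnth => i; rewrite tnth_map ac.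
Qed.

Lemma measurable_tuple_residue n (c : n.-tuple k) :
  measurable [set a : n.-tuple (borel_integers K) | map_tuple red a = c].
Proof.
rewrite tuple_residueE.
apply: (measurable_tuple_box (A := fun i => [set x : borel_integers K | red x = tnth c i])).
by move=> i; exact: measurable_residue.
Qed.

Lemma tuple_probability_residue n (S : {set n.-tuple k}) :
  tuple_probability h n [set a | map_tuple red a \in S] = (#|S|%:R / q%:R ^+ n)%:E.
Proof.
rewrite (measure_fibers (@measurable_tuple_residue n)).
rewrite (eq_bigr (fun=> (q%:R ^- n)%:E)) => [|c _].
  by rewrite sumEFin big_const iter_addr_0 mulr_natl.
rewrite tuple_residueE; apply: etrans (tuple_probability_box h
  (A := fun i => [set x : borel_integers K | red x = tnth c i]) _) _.
  by move=> i; exact: measurable_residue.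
rewrite (eq_bigr (fun=> (q%:R^-1)%:E)) => [|i _]; last exact: haar_residue.
by rewrite prodEFin prodr_const card_ord exprVn.
Qed.

End HaarResidue.

(** * The two density estimates *)

Section Counting.
Variables (R : realType) (n : nat) (k E : finFieldType) (io : {rmorphism k -> E}).
Hypothesis card_roots : forall d, (0 < d)%N -> (d <= n)%N ->
  #|[set y : E | y ^+ (#|k| ^ d) == y]| = (#|k| ^ d)%N.
Variable G : {group 'S_n}.
Hypothesis cyclicG : cyclic G.
Local Notation q := (#|k|%:R : R).
Local Notation ET := (erdos_turan R G).
Local Notation v := (#|frob_polys n io (generator_type G)|%:R / q ^+ n : R).

Lemma erdos_turan_gt0 : 0 < ET.
Proof.
rewrite /erdos_turan cyclicG /cycle_freq divr_gt0 ?ltr0n ?fact_gt0 //.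
by have [s sC] := cycle_class_generator cyclicG; apply/card_gt0P; exists s.
Qed.

Lemma frob_polys_density : v <= ET /\ q * ET <= q * v + n%:R ^+ 2 * ET.
Proof.
rewrite /erdos_turan cyclicG /cycle_freq; set mu := generator_type G.
set C := cycle_class n mu; set S := frob_polys n io mu.
have cS := card_frob_polys n io mu; rewrite -/C -/S in cS.
have q0 : 0 < q by rewrite ltr0n q_gt0.
have f0 : 0 < (n`!%:R : R) by rewrite ltr0n fact_gt0.
have qn0 : 0 < q ^+ n by rewrite exprn_gt0.
have up : (n`! * #|S| <= #|C| * #|k| ^ n)%N.
  rewrite cS -sum_nat_const; apply: leq_sum => s _.
  by have [] := card_frob_roots io card_roots s.
have lo : (#|k| * (#|C| * #|k| ^ n) <= #|k| * (n`! * #|S|) + n ^ 2 * (#|C| * #|k| ^ n))%N.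
  rewrite cS -sum_nat_const !big_distrr -big_split /=; apply: leq_sum => s _.
  by have [] := card_frob_roots io card_roots s.
move: up lo; rewrite -!(ler_nat R) !(natrD, natrM, natrX).
set F := n`!%:R in f0 *; set c := #|C|%:R; set t := #|S|%:R; set N := n%:R; set Q := q ^+ n in qn0 *.
move=> up lo; split.
  by rewrite ler_pdivrMr // mulrAC ler_pdivlMr // mulrC.
have -> : q * (c / F) = (q * (c * Q)) / (F * Q) by field; rewrite !gt_eqF.
have -> : q * (t / Q) + N ^+ 2 * (c / F) = (q * (F * t) + N ^+ 2 * (c * Q)) / (F * Q).
  by field; rewrite !gt_eqF.
by rewrite ler_pM2r // invr_gt0 mulr_gt0.
Qed.

End Counting.

Lemma relative_error_bound (R : realFieldType) (q N e v : R) :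
  0 < N -> N < q -> 0 < e -> v <= e -> q * e <= q * v + N * e ->
  `|v - e| < N / (q - N) * e.
Proof.
move=> N0 Nq e0 ve qe; rewrite ler0_norm ?subr_le0 // opprB.
rewrite mulrAC ltr_pdivlMr ?subr_gt0 //.
have [->|ne] := eqVneq v e; first by rewrite subrr mul0r mulr_gt0.
have lt : 0 < N * (e - v) by rewrite mulr_gt0 // subr_gt0 lt_neqAle ne.
by nra.
Qed.

Lemma prime_power_neq6 p f : prime p -> (p ^ f)%N <> 6.
Proof.
move=> p_pr e; have d2 : (2 %| p ^ f)%N by rewrite e.
have d3 : (3 %| p ^ f)%N by rewrite e.
move: d2 d3; rewrite !Euclid_dvdX // => /andP[+ _] /andP[+ _].
by rewrite !dvdn_prime2 // => /eqP <-.
Qed.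

(** The groups H with P H are members of one class, so there are at most as many of
    them as the denominator of their common weight. *)
Lemma conj_class_weight (n : nat) (A : {group 'S_n}) (R : realFieldType)
    (P : pred {group 'S_n}) (w : {group 'S_n} -> R) :
  (forall H, P H -> conj_class H = conj_class A /\ w H = #|conj_class A|%:R^-1) ->
  \sum_(H | P H) w H <= 1.
Proof.
move=> PH; rewrite (eq_bigr (fun=> #|conj_class A|%:R^-1)) => [|H /PH[]//].
have C0 : (0 < #|conj_class A|)%N by apply/card_gt0P; exists (gval A); exact: mem_conj_class.
rewrite sumr_const -[X in X <= _]mulr_natl ler_pdivrMr ?ltr0n // mul1r ler_nat.
rewrite -(card_imset _ (@val_inj _ _ {group 'S_n})); apply: subset_leq_card.
apply/fintype.subsetP => _ /imsetP[H PHH ->].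
by have [<- _] := PH H PHH; exact: mem_conj_class.
Qed.

Lemma card_nonseparable_density (k : finFieldType) n : (2 <= n)%N ->
  (#|k| * #|[set c : n.-tuple k | ~~ separable_poly (tuple_poly c)]| <= #|k| ^ n)%N.
Proof.
by case: n => [|[|m]] // _; rewrite [in leqRHS]expnS leq_mul2l card_nonseparable orbT.
Qed.

Theorem theorem1p4 (R : realType) (n : nat) (n_ge2 : (2 <= n)%N)
    (G : {group 'S_n}) (p : nat) (p_prime : prime p) (Q : padicField R p)
    (K : fieldExtType Q) (q f : nat) (q_eq : q = (p ^ f)%N)
    (k : finFieldType) (card_k : #|k| = q)
    (red : {rmorphism integers K -> k}) (residue : is_residue_map red)
    (h : probability (borel_integers K) R) (haar : is_haar h) :
  let vol (A : set (n.-tuple (borel_integers K))) : R :=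
    fine (tuple_probability h n A) in
  let P (H : {group 'S_n}) := galois_tuples (K := K) H in
  let Pstar (H : {group 'S_n}) := unramified_galois_tuples (K := K) H in
  let ET (H : {group 'S_n}) : R := erdos_turan R H in
  let N : R := n%:R ^+ 2 in
  let N' : R := n%:R ^+ 2 + n%:R in
  [/\ cyclic G -> (3 <= n)%N -> (n ^ 2 < q)%N ->
        `|vol (Pstar G) - ET G| < N / (q%:R - N) * ET G /\
        `|vol (P G) - ET G| < N / (q%:R - N) * ET G + q%:R^-1,
      cyclic G -> n = 2%N -> (n ^ 2 + n <= q)%N ->
        `|vol (Pstar G) - ET G| < N' / (q%:R - N') * ET G /\
        `|vol (P G) - ET G| < N' / (q%:R - N') * ET G + q%:R^-1
    & \sum_(H : {group 'S_n} | ~~ cyclic H)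
        vol (P H) / #|conj_class H|%:R <= q%:R^-1].
Proof.
move=> vol P Pstar ET N N'; rewrite -{q}card_k in q_eq *.
have [E [io [card_roots split]]] := exists_big_field k n.
have n0 : (0 < n)%N by exact: ltnW.
have q0 : 0 < (#|k|%:R : R) by rewrite ltr0n q_gt0.
pose B : {set n.-tuple k} := [set c | ~~ separable_poly (tuple_poly c)].
pose ram : set (n.-tuple (borel_integers K)) := [set a | map_tuple red a \in B]%classic.
have volS (S : {set n.-tuple k}) :
    vol [set a | map_tuple red a \in S]%classic = #|S|%:R / #|k|%:R ^+ n.
  by rewrite /vol (tuple_probability_residue p_prime residue q_eq haar).
have mS (S : {set n.-tuple k}) : measurable
    ([set a | map_tuple red a \in S]%classic : set (n.-tuple (borel_integers K))).
  apply: (measurable_fibers (phi := fun a : n.-tuple (borel_integers K) => map_tuple red a)) => c.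
  exact: (measurable_tuple_residue p_prime red q_eq).
have mP H : measurable (P H) by exact: measurable_galois_tuples.
have volE A : measurable A -> (vol A)%:E = tuple_probability h n A.
  by move=> mA; rewrite /vol fineK // fin_num_measure.
have vol_ram : vol ram <= #|k|%:R^-1.
  rewrite volS ler_pdivrMr ?exprn_gt0 // ler_pdivlMl //.
  by rewrite -natrX -natrM ler_nat card_nonseparable_density.
(* The reduction of a tuple of P G outside Pstar G is not separable. *)
have volP : cyclic G ->
    [/\ vol (Pstar G) = #|frob_polys n io (generator_type G)|%:R / #|k|%:R ^+ n,
      vol (Pstar G) <= vol (P G) & vol (P G) <= vol (Pstar G) + #|k|%:R^-1].
  move=> cG.
  have PE : Pstar G = [set a | map_tuple red a \in frob_polys n io (generator_type G)]%classic.
    apply/seteqP; split=> a /=.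
      by move/(unramified_galois_tuplesE p_prime residue n_ge2 split a cG).
    by move/(unramified_galois_tuplesE p_prime residue n_ge2 split a cG).
  have mPs : measurable (Pstar G) by rewrite PE; exact: mS.
  split; first by rewrite PE volS.
    rewrite -lee_fin !volE //; apply: le_measure; rewrite ?inE //.
    by move=> a [].
  apply: (@le_trans _ _ (vol (Pstar G) + vol ram)); last by rewrite lerD2l.
  rewrite -lee_fin EFinD !volE //; last exact: mS.
  apply: (@le_trans _ _ (tuple_probability h n (Pstar G `|` ram)%classic)); last first.
    by apply: measureU2 => //; exact: mS.
  apply: le_measure; rewrite ?inE //; first by apply: measurableU => //; exact: mS.
  move=> a aP; have [sep|nsep] := boolP (separable_poly (tuple_poly (map_tuple red a))).
    by left; split=> //; apply/(discriminant_unit p_prime residue n_ge2).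
  by right; rewrite /ram /= inE.
have main M : cyclic G -> N <= M -> M < #|k|%:R ->
    `|vol (Pstar G) - ET G| < M / (#|k|%:R - M) * ET G /\
    `|vol (P G) - ET G| < M / (#|k|%:R - M) * ET G + #|k|%:R^-1.
  move=> cG NM Mk; have [vE vl vu] := volP cG.
  have [le_v lo_v] := frob_polys_density R io card_roots cG.
  have e0 := erdos_turan_gt0 R cG.
  have N0 : 0 < N by rewrite exprn_gt0 // ltr0n.
  have bound : `|vol (Pstar G) - ET G| < M / (#|k|%:R - M) * ET G.
    apply: relative_error_bound => //; first exact: lt_le_trans NM.
      by rewrite vE.
    by rewrite vE; apply: le_trans lo_v _; rewrite lerD2l ler_pM2r.
  split=> //; apply: le_lt_trans (ler_distD (vol (Pstar G)) _ _) _.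
  rewrite addrC; apply: ltr_leD => //.
  by rewrite ger0_norm ?subr_ge0 // lerBlDl.
split.
- move=> cG _ nq; apply: main => //; rewrite /N -natrX ltr_nat //.
- move=> cG n2 nq; apply: main => //; first by rewrite lerDl.
  rewrite /N' -natrX -natrD ltr_nat ltn_neqAle nq andbT; apply/eqP => e.
  apply: (@prime_power_neq6 p f p_prime); rewrite -q_eq -e n2 //.
pose w (H : {group 'S_n}) : R := if cyclic H then 0 else #|conj_class H|%:R^-1.
have w0 H : 0 <= w H by rewrite /w; case: ifP => // _; rewrite invr_ge0.
have -> : \sum_(H : {group 'S_n} | ~~ cyclic H) vol (P H) / #|conj_class H|%:R
    = \sum_H w H * vol (P H).
  rewrite big_mkcond; apply: eq_bigr => H _; rewrite /w mulrC.
  by case: (cyclic H); rewrite /= ?mul0r.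
apply: le_trans vol_ram; rewrite -lee_fin volE; last exact: mS.
rewrite -sumEFin (eq_bigr (fun H => (w H)%:E * tuple_probability h n (P H))%E) => [|H _].
  2: by rewrite EFinM volE.
apply: weighted_measure_le => // [|a]; first exact: mS.
(* The noncyclic groups whose set contains the tuple a are conjugate to each other,
   so their weights add up to at most 1. *)
have ncP (H : {group 'S_n}) : ~~ cyclic H -> P H a -> a \in ram.
  by move=> ncH Ha; rewrite inE /ram /= inE; exact: ramified_of_noncyclic Ha.
have [[H0 [ncH0 PH0]]|none] := pselect (exists H : {group 'S_n}, ~~ cyclic H /\ P H a).
  rewrite indicE (ncP _ ncH0 PH0).
  rewrite (bigID (fun H : {group 'S_n} => ~~ cyclic H && (a \in P H))) /=.
  rewrite [X in _ + X]big1 ?addr0 => [|H].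
    rewrite (eq_bigr w) => [|H /andP[_ aH]]; last by rewrite indicE aH mulr1.
    apply: (@conj_class_weight n H0) => H /andP[ncH]; rewrite inE => PH.
    rewrite /w (negPf ncH).
    by have -> := has_galois_group_conj p_prime PH PH0.
  rewrite negb_and negbK indicE /w => /orP[->|/negPf ->]; first by rewrite mul0r.
  by rewrite mulr0.
rewrite big1 // => H _; rewrite indicE /w; case: ifPn => [_|ncH]; first by rewrite mul0r.
case: (boolP (a \in P H)) => [|_]; last by rewrite mulr0.
by rewrite inE => PH; case: none; exists H.
Qed.
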